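(* Let $p\in\{3,4,5\}$, let $\mathcal M=(\mathcal Q,\mathcal E,\mathcal V)$ be a quadrilateral mesh of $\Omega$, and let $\mathcal S^p(\mathcal M)$ be the global space determined by the local spaces $P^p_Q$, $Q\in\mathcal Q$, and the global degrees of freedom $\Lambda^p$. Then $\mathcal S^p(\mathcal M)\subset C^1(\Omega)$ and $$\dim\big(\mathcal S^p(\mathcal M)\big)=|\Lambda^p|=(7-p)^2\cdot|\mathcal Q|+1\cdot|\mathcal E|+6\cdot|\mathcal V|.$$
   Context: **Mesh.** $\Omega\subset\mathbb R^2$ is open and connected. A quadrilateral mesh $\mathcal M=(\mathcal Q,\mathcal E,\mathcal V)$ of $\Omega$ consists of finite sets of elements, edges and vertices such that: $\mathcal V\subset\mathbb R^2$; each $\varepsilon\in\mathcal E$ is an open segment with end points in $\mathcal V$; each $Q\in\mathcal Q$ is a non-empty, open, convex, non-degenerate quadrilateral whose vertices $\mathbf v_1,\dots,\mathbf v_4$ (counter-clockwise) lie in $\mathcal V$ and whose open sides $\varepsilon_i$, joining $\mathbf v_i$ and $\mathbf v_{i+1}$ (indices modulo 4), lie in $\mathcal E$; every edge and vertex of the mesh belongs to the closure of some element as a side, respectively a vertex; $\overline\Omega=\bigcup_{Q\in\mathcal Q}\overline Q$; and any two different members of $\mathcal Q\cup\mathcal E\cup\mathcal V$ are disjoint (no hanging vertices). For every edge $\varepsilon$ a unit normal $\mathbf n_\varepsilon$ is fixed once for the whole mesh; $\partial_{\mathbf n_\varepsilon}$ is the derivative in that direction and $\mathbf m_\varepsilon$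 is the midpoint of $\varepsilon$. **Parametrization and polynomials.** $\hat Q=[0,1]^2$ and $\mathbf F_Q:\hat Q\to\overline Q$, $\mathbf F_Q(\xi_1,\xi_2)=(1-\xi_1)(1-\xi_2)\mathbf v_1+\xi_1(1-\xi_2)\mathbf v_2+\xi_1\xi_2\mathbf v_3+(1-\xi_1)\xi_2\mathbf v_4$; $\hat\varepsilon=\mathbf F_Q^{-1}(\varepsilon)$. $\mathbb P^{(p,p)}$ denotes bivariate polynomials of bi-degree $(p,p)$, $\mathbb P^{p}$ polynomials of degree at most $p$. For $k\ge1$, $s_k(\hat Q)=\{[\frac ik,\frac{i+1}k]\times[\frac jk,\frac{j+1}k]:0\le i,j\le k-1\}$. **Local space $P^p_Q$.** $P^5_Q$: all $\varphi:\overline Q\to\mathbb R$ with $\varphi\circ\mathbf F_Q\in\mathbb P^{(5,5)}$ and $(\partial_{\mathbf n_{\varepsilon_i}}\varphi\circ\mathbf F_Q)|_{\hat\varepsilon_i}\in\mathbb P^4$, $1\le i\le4$. For $p\in\{3,4\}$, $P^p_Q$: all $\varphi:\overline Q\to\mathbb R$ with $\varphi\in C^{p-2}(Q)$, and for all $\hat q\in s_{6-p}(\hat Q)$ and $1\le i\le 4$: $(\varphi\circ\mathbf F_Q)|_{\hat q}\in\mathbb P^{(p,p)}$, $(\varphi\circ\mathbf F_Q)|_{\hat\varepsilon_i}\in C^{p-1}(\hat\varepsilon_i)$, $(\partial_{\mathbf n_{\varepsilon_i}}\varphi\circ\mathbf F_Q)|_{\hat\varepsilon_i\cap\hat q}\in\mathbb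 P^{p-1}$. **Global degrees of freedom $\Lambda^p$.** They are: $\varphi(\mathbf v),\partial_1\varphi(\mathbf v),\partial_2\varphi(\mathbf v),\partial_1\partial_1\varphi(\mathbf v),\partial_1\partial_2\varphi(\mathbf v),\partial_2\partial_2\varphi(\mathbf v)$ for all $\mathbf v\in\mathcal V$; $\partial_{\mathbf n_\varepsilon}\varphi(\mathbf m_\varepsilon)$ for all $\varepsilon\in\mathcal E$; and $\varphi(\mathbf F_Q(\eta_1,\eta_2))$ for all $Q\in\mathcal Q$ and $\eta_1,\eta_2\in E_p$, where $E_3=\{\frac29,\frac49,\frac59,\frac79\}$, $E_4=\{\frac14,\frac24,\frac34\}$, $E_5=\{\frac25,\frac35\}$. **Global space.** $\mathcal S^p(\mathcal M)$ is the space of piecewise functions $\varphi=(\varphi_Q)_{Q\in\mathcal Q}$ with $\varphi_Q\in P^p_Q$ for every $Q\in\mathcal Q$ for which the functionals in $\Lambda^p$ are single-valued: at every $\mathbf v\in\mathcal V$ the values, first and second derivatives of $\varphi_Q$ agree for all elements $Q$ having $\mathbf v$ as a vertex, and at every $\mathbf m_\varepsilon$ the derivatives $\partial_{\mathbf n_\varepsilon}\varphi_Q(\mathbf m_\varepsilon)$ agree for all elements $Q$ having $\varepsilon$ as a side. The inclusion $\mathcal S^p(\mathcal M)\subset C^1(\Omega)$ means that the $\varphi_Q$ agree on common boundary points in $\Omega$ and that the resulting function on $\Omega$, equal to $\varphi_Q$ on $\overline Q\cap\Omega$, is continuously differentiable. *)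

(* Defs.v *)
From HB Require Import structures.
From mathcomp Require Import all_boot all_order all_algebra finmap.
From mathcomp Require Import all_classical all_reals all_analysis.
Set Implicit Arguments.
Unset Strict Implicit.
Unset Printing Implicit Defensive.
Import Order.TTheory GRing.Theory Num.Theory.
Import numFieldNormedType.Exports.
Local Open Scope classical_set_scope.
Local Open Scope ring_scope.

Notation plane R := 'rV[R]_2.

Section Calculus.
Variable R : realType.

(* [f] is k times continuously differentiable on the (open) set [A]: all
   iterated directional derivatives of order at most k exist and are continuous
   on [A]. *)
Fixpoint Ck (V : normedModType R) (k : nat) (A : set V) (f : V -> R^o) : Prop :=
  (forall x, A x -> {for x, continuous f}) /\
  if k is k'.+1 then
    forall u : V, (forall x, A x -> derivable f x u) /\ Ck k' A ('D_u f)
  else True.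

Definition dir1 : plane R := delta_mx 0 0.
Definition dir2 : plane R := delta_mx 0 1.

(* Extension of [g], defined on the open set [Q], to the closure of [Q] by
   continuity.  This is how derivatives of functions on the closed element are
   understood at boundary points. *)
Definition cl_ext (Q : set (plane R)) (g : plane R -> R^o) (x : plane R) : R :=
  lim (g @ within Q (nbhs x)).

(* restriction of [g] to [A] is in P^n, resp. in P^(n,n) *)
Definition poly_on (n : nat) (A : set R) (g : R -> R) : Prop :=
  exists q : {poly R}, (size q <= n.+1)%N /\ forall t, A t -> g t = q.[t].

Definition bipoly_on (n : nat) (A : set (R * R)) (g : R * R -> R) : Prop :=
  exists c : 'M[R]_n.+1, forall xi, A xi ->
    g xi = \sum_(i < n.+1) \sum_(j < n.+1) c i j * xi.1 ^+ i * xi.2 ^+ j.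

(* The set [S] is a linear subspace of dimension [n]. *)
Definition has_dim (V : lmodType R) (S : set V) (n : nat) : Prop :=
  exists b : 'I_n -> V,
    (forall c : 'I_n -> R, \sum_i c i *: b i = 0 -> forall i, c i = 0) /\
    S = [set v | exists c : 'I_n -> R, v = \sum_i c i *: b i].

End Calculus.

Section Quadrilaterals.
Variable R : realType.

(* twice the signed area of the triangle abc *)
Definition orient (a b c : plane R) : R :=
  (b 0 0 - a 0 0) * (c 0 1 - a 0 1) - (b 0 1 - a 0 1) * (c 0 0 - a 0 0).

Definition open_segment (a b : plane R) : set (plane R) :=
  [set (1 - t) *: a + t *: b | t in `]0, 1[%classic].

(* Indices of vertices are taken in the ring 'I_4, so that [i + 1] is modulo 4.
   Every vertex not on the side from [c i] to [c (i + 1)] lies strictly to the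
   left of it: the vertices are in counter-clockwise order and strictly convex
   position. *)
Definition ccw_convex (c : 'I_4 -> plane R) : Prop :=
  forall i k : 'I_4, k != i -> k != i + 1 -> 0 < orient (c i) (c (i + 1)) (c k).

Definition open_quad (c : 'I_4 -> plane R) : set (plane R) :=
  [set x | forall i : 'I_4, 0 < orient (c i) (c (i + 1)) x].

Definition quad_side (c : 'I_4 -> plane R) (i : 'I_4) : set (plane R) :=
  open_segment (c i) (c (i + 1)).

Definition bilin (c : 'I_4 -> plane R) (xi : R * R) : plane R :=
  ((1 - xi.1) * (1 - xi.2)) *: c 0 + (xi.1 * (1 - xi.2)) *: c 1
  + (xi.1 * xi.2) *: c 2 + ((1 - xi.1) * xi.2) *: c 3.

(* [ref_side i], on the interval ]0, 1[, is the affine parametrization of the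
   preimage of the open side [quad_side c i] under [bilin c]. *)
Definition ref_side (i : 'I_4) (t : R) : R * R :=
  match val i with
  | 0%N => (t, 0)
  | 1%N => (1, t)
  | 2%N => (1 - t, 1)
  | _ => (0, 1 - t)
  end.

Definition subsquare (k : nat) (a b : 'I_k) : set (R * R) :=
  `[a%:R / k%:R, a.+1%:R / k%:R]%classic `*` `[b%:R / k%:R, b.+1%:R / k%:R]%classic.

End Quadrilaterals.

Section Mesh.
Variable R : realType.

Record quad_mesh (Omega : set (plane R)) := QuadMesh {
  elements : {fset set (plane R)};
  edges : {fset set (plane R)};
  vertices : {fset plane R};
  corner : set (plane R) -> 'I_4 -> plane R;
  ends : set (plane R) -> plane R * plane R;
  normal : set (plane R) -> plane R;
  edge_segment : forall e : set (plane R), e \in edges ->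
    [/\ (ends e).1 \in vertices, (ends e).2 \in vertices,
        (ends e).1 != (ends e).2 & e = open_segment (ends e).1 (ends e).2];
  normal_unit : forall e : set (plane R), e \in edges ->
    normal e 0 0 ^+ 2 + normal e 0 1 ^+ 2 = 1;
  normal_orth : forall e : set (plane R), e \in edges ->
    normal e 0 0 * ((ends e).2 0 0 - (ends e).1 0 0)
    + normal e 0 1 * ((ends e).2 0 1 - (ends e).1 0 1) = 0;
  element_quad : forall Q : set (plane R), Q \in elements ->
    ccw_convex (corner Q) /\ Q = open_quad (corner Q);
  element_corner : forall (Q : set (plane R)) i, Q \in elements -> corner Q i \in vertices;
  element_side : forall (Q : set (plane R)) i, Q \in elements ->
    quad_side (corner Q) i \in edges;
  edge_incident : forall e : set (plane R), e \in edges ->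
    exists (Q : set (plane R)) i, Q \in elements /\ e = quad_side (corner Q) i;
  vertex_incident : forall v : plane R, v \in vertices ->
    exists (Q : set (plane R)) i, Q \in elements /\ v = corner Q i;
  mesh_cover : closure Omega = \bigcup_(Q in [set` elements]) closure Q;
  mesh_disjoint :
    trivIset ([set` elements] `|` [set` edges] `|` [set [set v] | v in [set` vertices]])
             id }.

Variables (Omega : set (plane R)) (M : quad_mesh Omega).

Definition side (Q : set (plane R)) (i : 'I_4) : set (plane R) :=
  quad_side (corner M Q) i.

Definition param (Q : set (plane R)) : R * R -> plane R := bilin (corner M Q).

Definition midpoint (e : set (plane R)) : plane R :=
  2^-1 *: ((ends M e).1 + (ends M e).2).

(* derivative in the direction of the normal of the edge [e], on the closure
   of the element [Q] *)
Definition dnormal (Q e : set (plane R)) (f : plane R -> R^o) : plane R -> R :=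
  cl_ext Q ('D_(normal M e) f).

(* Functions on the closure of [Q] are represented by their extension by zero
   to the whole plane. *)
Definition on_closure (Q : set (plane R)) (f : plane R -> R^o) : Prop :=
  forall x, ~ closure Q x -> f x = 0.

Definition local_space5 (Q : set (plane R)) (f : plane R -> R^o) : Prop :=
  [/\ on_closure Q f,
      bipoly_on 5 (`[0, 1]%classic `*` `[0, 1]%classic) (f \o param Q) &
      forall i : 'I_4,
        poly_on 4 `]0, 1[%classic (dnormal Q (side Q i) f \o param Q \o ref_side i)].

Definition local_space34 (p : nat) (Q : set (plane R)) (f : plane R -> R^o) : Prop :=
  [/\ on_closure Q f,
      Ck (p - 2) Q f,
      forall a b : 'I_(6 - p), bipoly_on p (@subsquare R _ a b) (f \o param Q),
      forall i : 'I_4,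
        Ck (p - 1) (`]0, 1[%classic : set R^o) (f \o param Q \o ref_side i) &
      forall (i : 'I_4) (a b : 'I_(6 - p)),
        poly_on (p - 1) (`]0, 1[%classic `&` ref_side i @^-1` subsquare a b)
          (dnormal Q (side Q i) f \o param Q \o ref_side i)].

Definition local_space (p : nat) : set (plane R) -> (plane R -> R^o) -> Prop :=
  if p == 5%N then local_space5 else local_space34 p.

Definition vertex_dof (Q : set (plane R)) (v : plane R) (k : 'I_6)
    (f : plane R -> R^o) : R :=
  match val k with
  | 0%N => f v
  | 1%N => cl_ext Q ('D_(dir1 R) f) v
  | 2%N => cl_ext Q ('D_(dir2 R) f) v
  | 3%N => cl_ext Q ('D_(dir1 R) ('D_(dir1 R) f)) v
  | 4%N => cl_ext Q ('D_(dir1 R) ('D_(dir2 R) f)) v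
  | _ => cl_ext Q ('D_(dir2 R) ('D_(dir2 R) f)) v
  end.

Definition edge_dof (Q e : set (plane R)) (f : plane R -> R^o) : R :=
  dnormal Q e f (midpoint e).

Definition eta_points (p : nat) : seq R :=
  match p with
  | 3%N => [:: 2 / 9; 4 / 9; 5 / 9; 7 / 9]
  | 4%N => [:: 1 / 4; 2 / 4; 3 / 4]
  | 5%N => [:: 2 / 5; 3 / 5]
  | _ => [::]
  end.

Definition global_space (p : nat) : set (elements M -> plane R -> R^o) :=
  [set phi |
    [/\ forall Q : elements M, local_space p (val Q) (phi Q),
        forall (Q Q' : elements M) (v : plane R) (i i' : 'I_4),
          v = corner M (val Q) i -> v = corner M (val Q') i' ->
          forall k, vertex_dof (val Q) v k (phi Q) = vertex_dof (val Q') v k (phi Q') &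
        forall (Q Q' : elements M) (e : set (plane R)) (i i' : 'I_4),
          e = side (val Q) i -> e = side (val Q') i' ->
          edge_dof (val Q) e (phi Q) = edge_dof (val Q') e (phi Q')]].

(* The degrees of freedom as a set of functionals on the global space.  Those
   attached to a vertex (or an edge) are evaluated on an element [Q] having it
   as a vertex (a side); as they are single-valued on the global space,
   different choices of [Q] give the same functional. *)
Definition global_dofs (p : nat) : set ({phi | global_space p phi} -> R) :=
  [set l | exists (Q : elements M) (v : plane R) (i : 'I_4) (k : 'I_6),
     v = corner M (val Q) i /\ l = fun phi => vertex_dof (val Q) v k (sval phi Q)]
  `|` [set l | exists (Q : elements M) (e : set (plane R)) (i : 'I_4),
     e = side (val Q) i /\ l = fun phi => edge_dof (val Q) e (sval phi Q)]
  `|` [set l | exists (Q : elements M) (eta1 eta2 : R),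
     [/\ eta1 \in eta_points p, eta2 \in eta_points p &
         l = fun phi => sval phi Q (param (val Q) (eta1, eta2))]].

(* [phi] is single-valued on [Omega] and defines a C^1 function there *)
Definition piecewise_C1 (phi : elements M -> plane R -> R^o) : Prop :=
  exists g : plane R -> R^o,
    (forall (Q : elements M) x, closure (val Q) x -> Omega x -> g x = phi Q x) /\
    Ck 1 Omega g.

End Mesh.

Arguments global_space {R Omega} M p.
Arguments global_dofs {R Omega} M p.

(* Main.v *)
(* On an element the parametrization turns the local space into tensor products
   of univariate splines of degree p, of class C^(p-2), with knots at the
   multiples of 1/(6-p); these splines form a space of dimension 11-p.  Three univariate
   interpolation problems are unisolvent: values and first derivatives at the
   ends together with the values at E_p, for the whole spline space; the 2-jets
   at the ends, for the splines of class C^(p-1), which contain the traces on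
   the sides; and values and first derivatives at the ends together with the
   value at 1/2, for the splines of degree p-1, which contain the normal
   derivatives on the sides.  Hence the traces of a function and of its gradient
   on a side depend only on the degrees of freedom of that side and of its end
   points, which gives the C^1 continuity across edges.  When all degrees of
   freedom vanish, so do the function and its gradient on the boundary of the
   element, and tensor-product Hermite interpolation shows that the function
   vanishes.  Conversely, arbitrary degrees of freedom prescribe compatible
   boundary data, which the same interpolation extends to the element.  The
   degrees of freedom are therefore dual to a basis of the global space. *)

(* Two obstacles shape the proof. A derivative at a boundary point is only a limit from inside the
   element ([cl_ext]), and on a side the normal derivative is a quotient by the Jacobian, not
   visibly a spline. For the first, derivatives are taken relative to the closed element ([wder]).
   Increments of the inverse of [bilin c] are given exactly by Cramer's rule, so that gradients, and
   Hessians at the corners, become explicit formulas continuous up to the boundary. For the second,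
   the Jacobian is affine along a side. The quotient is piecewise of degree p-1 by assumption and of
   class C^(p-2) as a quotient, hence a spline; multiplying back by the Jacobian extends this to the
   ends of the side. Second derivatives of the splines may jump at knots. The ends 0 and 1 are never
   knots, so 2-jets at the corners make sense even for p = 3. Compatibility of prescribed data at a
   corner rests on the mixed derivative: from either side it is the gradient along the constant
   mixed derivative of the parametrization plus the Hessian on the two side directions, which is
   symmetric. *)
Require Import Defs.
From HB Require Import structures.
From mathcomp Require Import all_boot all_order all_algebra finmap.
From mathcomp Require Import all_classical all_reals all_analysis.
From mathcomp Require Import ring lra zify.

Set Implicit Arguments.
Unset Strict Implicit.
Unset Printing Implicit Defensive.
Import Order.TTheory GRing.Theory Num.Theory.
Import numFieldNormedType.Exports.
Local Open Scope classical_set_scope.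
Local Open Scope ring_scope.

(** * Derivatives relative to a set *)

Section Calculus.
Variables (R : realType) (V : normedModType R).
Implicit Types (A B : set V) (f g : V -> R^o) (x u : V).

(* Derivative at [x] along [u], computed inside [A] only: [x] may lie on the
   boundary of [A]. *)
Definition wder A f x u (l : R) : Prop :=
  (fun h : R => h^-1 * (f (h *: u + x) - f x))
    @ within (fun h => A (h *: u + x)) (0 : R)^' --> l.

Lemma cvg_ext (T : Type) (U : topologicalType) (F : set_system T) {FF : Filter F}
    (f g : T -> U) (l : U) :
  (\forall h \near F, f h = g h) -> f @ F --> l -> g @ F --> l.
Proof. by move=> fg; apply: cvg_trans; exact: near_eq_cvg. Qed.

Lemma line_cvg x u : (fun h : R => h *: u + x) @ (0 : R)^' --> x.
Proof.
apply: cvg_within_filter.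
have : (fun h : R => h *: u + x) @ (0:R) --> 0 *: u + x.
  by apply: cvgD; [apply: cvgZr_tmp; exact: cvg_id | exact: cvg_cst].
by rewrite scale0r add0r.
Qed.

Lemma wder_eq A f g x u l : (forall y, A y -> f y = g y) -> A x ->
  wder A f x u l -> wder A g x u l.
Proof.
move=> fg Ax; apply: cvg_ext.
by near do rewrite !fg //; apply: withinT.
Unshelve. all: by end_near. Qed.

Lemma wder_is_derive A f x u l : nbhs x A -> wder A f x u l -> is_derive x u f l.
Proof.
move=> nA; rewrite /wder => H.
have H' : (fun h : R => h^-1 * (f (h *: u + x) - f x)) @ (0 : R)^' --> l.
  move=> U HU; have /= W := H U HU; have /= L := @line_cvg x u A nA.
  rewrite nbhs_simpl /= in W; rewrite nbhs_simpl /= in L; rewrite nbhs_simpl /=.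
  near=> h; suff : A (h *: u + x) by near: h; exact: W.
  by near: h; exact: L.
split; first by apply/cvg_ex; exists l.
exact/cvg_lim.
Unshelve. all: by end_near. Qed.

Lemma is_derive_wder A f x u l : is_derive x u f l -> wder A f x u l.
Proof.
case=> df <-; apply: cvg_within_filter; exact: df.
Qed.

Lemma wder_cvg A f x u l : wder A f x u l ->
  (fun h : R => f (h *: u + x)) @ within (fun h => A (h *: u + x)) (0 : R)^' --> f x.
Proof.
move=> H.
have H0 : (fun h : R => h) @ within (fun h => A (h *: u + x)) (0 : R)^' --> (0:R).
  by apply: cvg_within_filter; apply: cvg_within_filter; exact: cvg_id.
have H1 : id h * (h^-1 * (f (h *: u + x) - f x)) + cst (f x) h
    @[h --> within (fun h => A (h *: u + x)) (0 : R)^'] --> 0 * l + f x.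
  by apply: cvgD; [exact: cvgM | exact: cvg_cst].
rewrite mul0r add0r in H1; apply: cvg_ext H1.
near=> h => /=; rewrite mulrA divff ?mul1r ?subrK //.
near: h; rewrite near_withinE; near=> k => _; near: k; exact: nbhs_dnbhs_neq.
Unshelve. all: by end_near. Qed.

Lemma wderD A f g x u l m : wder A f x u l -> wder A g x u m ->
  wder A (fun y => f y + g y) x u (l + m).
Proof.
move=> fl gm; apply: cvg_ext (cvgD fl gm).
by near=> h; rewrite /= !fctE; ring.
Unshelve. all: by end_near. Qed.

Lemma wderM A f g x u l m : wder A f x u l -> wder A g x u m ->
  wder A (fun y => f y * g y) x u (l * g x + f x * m).
Proof.
move=> fl gm; have H : (h^-1 * (f (h *: u + x) - f x)) * g (h *: u + x)
    + f x * (h^-1 * (g (h *: u + x) - g x))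
    @[h --> within (fun h => A (h *: u + x)) (0 : R)^'] --> l * g x + f x * m.
  by apply: cvgD; apply: cvgM => //; [exact: wder_cvg gm | exact: cvg_cst].
by apply: cvg_ext H; near=> h; ring.
Unshelve. all: by end_near. Qed.

Lemma wder_cst A (c : R) x u : wder A (fun=> c) x u 0.
Proof.
rewrite /wder; under eq_fun do rewrite subrr mulr0; exact: cvg_cst.
Qed.

Lemma wder_sum A (I : finType) (f : I -> V -> R^o) x u (l : I -> R) :
  (forall i, wder A (f i) x u (l i)) ->
  wder A (fun y => \sum_i f i y) x u (\sum_i l i).
Proof.
move=> H; elim: (index_enum I) => [|i s IH].
  by under [X in wder _ X]eq_fun do rewrite big_nil; rewrite big_nil; exact: wder_cst.
under [X in wder _ X]eq_fun do rewrite big_cons; rewrite big_cons; exact: (wderD (H i) IH).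
Qed.

(** Carathéodory's form of the outer derivative avoids a division by the increment of [f], which may
    vanish for [h != 0]. *)
Lemma wder_comp A f x u l (g : R^o -> R^o) (d : R) : wder A f x u l ->
  is_derive (f x : R^o) 1 g d -> wder A (fun y => g (f y)) x u (d * l).
Proof.
move=> fl /is_derive1_caratheodory [k [gE ck kd]].
have : k (f (h *: u + x)) @[h --> within (fun h => A (h *: u + x)) (0 : R)^'] --> d.
  by rewrite -kd; apply: (cvg_comp _ _ (wder_cvg fl)).
move=> /cvgM /(_ fl); apply: cvg_ext.
by near=> h => /=; rewrite gE; ring.
Unshelve. all: by end_near. Qed.

Lemma cont_eq_on A f g x : open A -> (forall y, A y -> f y = g y) -> A x ->
  {for x, continuous f} -> {for x, continuous g}.
Proof.
move=> oA fg Ax cf; have : f @ x --> g x by rewrite -(fg x Ax).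
apply: cvg_ext.
by near=> y; apply: fg; near: y; exact: open_nbhs_nbhs.
Unshelve. all: by end_near. Qed.

Lemma is_derive_eq_on A f g x u l : open A -> (forall y, A y -> f y = g y) -> A x ->
  is_derive x u f l -> is_derive x u g l.
Proof.
move=> oA fg Ax; apply: near_eq_is_derive.
by near=> y; apply: fg; near: y; exact: open_nbhs_nbhs.
Unshelve. all: by end_near. Qed.

Lemma Ck_eq_on k A f g : open A -> (forall y, A y -> f y = g y) ->
  Ck k A f -> Ck k A g.
Proof.
elim: k f g => [|k IH] f g oA fg /= [cf H].
  by split=> // x Ax; apply: (cont_eq_on oA fg Ax); exact: cf.
split=> [x Ax|u]; first by apply: (cont_eq_on oA fg Ax); exact: cf.
have [df Cf] := H u.
have D x : A x -> is_derive x u g ('D_u f x).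
  by move=> Ax; apply: (is_derive_eq_on oA fg Ax); apply: DeriveDef => //; exact: df.
split=> [x Ax|]; first by case: (D x Ax).
by apply: IH Cf => // y Ay; have [_ ->] := D y Ay.
Qed.

Lemma Ck_cont k A f : Ck k A f -> forall x, A x -> {for x, continuous f}.
Proof. by case: k => [|k] []. Qed.

Lemma CkS k A f : Ck k.+1 A f -> Ck k A f.
Proof.
elim: k f => [|k IH] f /= [cf H]; first by [].
by split=> // u; have [df Cf] := H u; split=> //; exact: IH.
Qed.

(** [Ck] speaks of the total function ['D_u f]; since [A] is open, a formula for the derivative that
    is valid on [A] alone is enough. *)
Lemma Ck_intro k A f : open A -> (forall x, A x -> {for x, continuous f}) ->
  (forall u, exists2 g : V -> R^o, Ck k A g & forall x, A x -> is_derive x u f (g x)) ->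
  Ck k.+1 A f.
Proof.
move=> oA cf H; split=> // u; have [g Cg dg] := H u; split=> [x Ax|].
  by case: (dg x Ax).
by apply: Ck_eq_on Cg => // y Ay; have [_ ->] := dg y Ay.
Qed.

Lemma Ck_elim k A f : Ck k.+1 A f ->
  forall u, Ck k A ('D_u f) /\ forall x, A x -> is_derive x u f ('D_u f x).
Proof.
move=> [cf H] u; have [df Cf] := H u; split=> // x Ax.
by apply: DeriveDef => //; exact: df.
Qed.

Lemma Ck_cst k A (c : R) : open A -> Ck k A (fun=> c).
Proof.
elim: k c => [|k IH] c oA.
  by split=> // x Ax; exact: cst_continuous.
apply: Ck_intro => // [x Ax|u]; first exact: cst_continuous.
by exists (fun=> 0); [exact: IH|move=> x Ax; exact: is_derive_cst].
Qed.

Lemma CkD k A f g : open A -> Ck k A f -> Ck k A g -> Ck k A (fun y => f y + g y).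
Proof.
elim: k f g => [|k IH] f g oA Cf Cg.
  by split=> // x Ax; apply: continuousD; [exact: Cf.1|exact: Cg.1].
apply: Ck_intro => // [x Ax|u].
  by apply: continuousD; [exact: (Ck_cont Cf)|exact: (Ck_cont Cg)].
have [Cf' df] := Ck_elim Cf u; have [Cg' dg] := Ck_elim Cg u.
exists (fun x => 'D_u f x + 'D_u g x); first exact: IH.
by move=> x Ax; have := df x Ax; have := dg x Ax => ? ?; exact: is_deriveD.
Qed.

Lemma CkM k A f g : open A -> Ck k A f -> Ck k A g -> Ck k A (fun y => f y * g y).
Proof.
elim: k f g => [|k IH] f g oA Cf Cg.
  by split=> // x Ax; apply: continuousM; [exact: Cf.1|exact: Cg.1].
apply: Ck_intro => // [x Ax|u].
  by apply: continuousM; [exact: (Ck_cont Cf)|exact: (Ck_cont Cg)].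
have [Cf' df] := Ck_elim Cf u; have [Cg' dg] := Ck_elim Cg u.
exists (fun x => f x * 'D_u g x + g x * 'D_u f x).
  by apply: CkD => //; apply: IH => //; exact: CkS.
by move=> x Ax; have := df x Ax; have := dg x Ax => ? ?; exact: is_deriveM.
Qed.

Lemma Ck_sum k A (I : finType) (f : I -> V -> R^o) : open A ->
  (forall i, Ck k A (f i)) -> Ck k A (fun y => \sum_i f i y).
Proof.
move=> oA H; elim: (index_enum I) => [|i s IH].
  by under [X in Ck _ _ X]eq_fun do rewrite big_nil; exact: Ck_cst.
by under [X in Ck _ _ X]eq_fun do rewrite big_cons; exact: CkD.
Qed.

Lemma CkV k A f : open A -> (forall x, A x -> f x != 0) ->
  Ck k A f -> Ck k A (fun y => (f y)^-1).
Proof.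
move=> oA f0; elim: k f f0 => [|k IH] f f0 Cf.
  by split=> // x Ax; apply: continuousV; [exact: f0|exact: Cf.1].
apply: Ck_intro => // [x Ax|u].
  by apply: continuousV; [exact: f0|exact: (Ck_cont Cf)].
have [Cf' df] := Ck_elim Cf u.
exists (fun x => (-1) * ((f x)^-1 * (f x)^-1) * 'D_u f x).
  apply: CkM => //; apply: CkM => //; first exact: Ck_cst.
  by apply: CkM => //; apply: IH => //; exact: CkS.
move=> x Ax; have [dfx _] := df x Ax; apply: DeriveDef.
  by apply: derivableV => //; exact: f0.
by rewrite deriveV ?f0 // -exprVn expr2 mulN1r.
Qed.

End Calculus.

(** [L] is affine with linear part [l], so the difference quotients of [f \o L] along [u] are
    literally those of [f] along [l u]. This is how smoothness on the element passes to lines in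
    it. *)
Lemma Ck_line k (R : realType) (V W : normedModType R) (A : set W) (B : set V) (f : V -> R^o)
    (L : W -> V) (l : W -> V) : open A -> (forall x : W, A x -> B (L x)) ->
  (forall (x u : W) (h : R), L (h *: u + x) = h *: l u + L x) ->
  continuous L -> Ck k B f -> Ck k A (fun x : W => f (L x)).
Proof.
move=> oA AB LE cL; elim: k f => [|k IH] f Cf.
  split=> // x Ax; apply: continuous_comp; first exact: cL.
  by apply: Cf.1; exact: AB.
apply: Ck_intro => // [x Ax|u].
  by apply: continuous_comp; [exact: cL|apply: (Ck_cont Cf); exact: AB].
have [Cf' df] := Ck_elim Cf (l u).
exists (fun x : W => 'D_(l u) f (L x)); first exact: (IH _ Cf').
move=> x Ax; have [dx _] := df (L x) (AB x Ax).
have E : (fun h : R => h^-1 *: (((fun x : W => f (L x)) \o shift x) (h *: u) - f (L x))) =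
   (fun h : R => h^-1 *: ((f \o shift (L x)) (h *: l u) - f (L x))).
  by apply/funext => h /=; rewrite LE.
by split; [rewrite /derivable E|rewrite /derive E].
Qed.

(** * Univariate splines *)

Section TruncatedPower.
Variable R : realType.
Implicit Types (k x : R) (n j m : nat).

Definition tp k n x : R := if k < x then (x - k) ^+ n else 0.

Lemma tp_gt k n x : k < x -> tp k n x = (x - k) ^+ n.
Proof. by rewrite /tp => ->. Qed.

Lemma tp_le k n x : x <= k -> tp k n x = 0.
Proof. by rewrite /tp ltNge => ->. Qed.

Lemma tp_ge k n x : (0 < n)%N -> k <= x -> tp k n x = (x - k) ^+ n.
Proof.
move=> n0; rewrite le_eqVlt => /predU1P[->|]; last exact: tp_gt.
by rewrite tp_le // subrr expr0n eqn0Ngt n0.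
Qed.

Lemma tpS k n x : tp k n.+1 x = (x - k) * tp k n x.
Proof. by rewrite /tp; case: ifP; rewrite ?mulr0 // exprS. Qed.

Lemma is_derive_continuous (f : R^o -> R^o) (x : R^o) (d : R) :
  is_derive x 1 f d -> {for x, continuous f}.
Proof. by case=> /derivable1_diffP /differentiable_continuous. Qed.

Lemma is_derive_tp0 k x : k != x -> is_derive (x : R^o) 1 (tp k 0 : R^o -> R^o) 0.
Proof.
rewrite neq_lt => /orP[kx|xk].
- have D : is_derive (x : R^o) 1 (cst (1 : R^o) : R^o -> R^o) 0 by exact: is_derive_cst.
  apply: near_eq_is_derive D.
  by near=> y; rewrite /= tp_gt ?expr0 //; near: y; exact: lt_nbhsr.
- have D : is_derive (x : R^o) 1 (cst (0 : R^o) : R^o -> R^o) 0 by exact: is_derive_cst.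
  apply: near_eq_is_derive D.
  by near=> y; rewrite /= tp_le // ltW //; near: y; exact: lt_nbhsl.
Unshelve. all: by end_near. Qed.

Lemma tp1_continuous k : continuous (tp k 1 : R^o -> R^o).
Proof.
have -> : tp k 1 = fun x => Num.max (x - k) 0.
  apply/funext => x; rewrite /tp expr1.
  by case: ltP => H; [rewrite max_l ?subr_ge0 ?ltW|rewrite max_r ?subr_le0].
move=> x; apply: (@continuous_max _ _ (fun x => x - k : R^o) (cst 0)).
  by apply: continuousB; [exact: cvg_id|exact: cst_continuous].
exact: cst_continuous.
Qed.

Lemma is_derive_tp k n x : k != x \/ (1 < n)%N ->
  is_derive (x : R^o) 1 (tp k n : R^o -> R^o) (n%:R * tp k n.-1 x).
Proof.
have [<-{x}|kx _] := eqVneq k x.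
  case=> //; elim: n => // -[//|n] IH _.
  (* At its knot the slope function of a truncated power is the truncated power of one degree less,
     which is continuous and vanishes there. *)
  apply/is_derive1_caratheodory; exists (tp k n.+1); split.
  - by move=> z; rewrite [tp _ _ k]tp_le // subr0 tpS mulrC.
  - have : continuous (tp k n.+1).
      elim: (n) => [|j cj]; first exact: tp1_continuous.
      have -> : tp k j.+2 = fun x => (x - k) * tp k j.+1 x by apply/funext => x; rewrite tpS.
      move=> x; apply: (@continuousM _ _ (fun x : R => x - k)); last exact: cj.
      by apply: continuousB; [exact: cvg_id|exact: cst_continuous].
    exact.
  - by rewrite !tp_le // mulr0.
elim: n => [|n IH]; first by rewrite mul0r; exact: is_derive_tp0.
have -> : tp k n.+1 = (fun x : R => x - k) * tp k n by apply/funext => y; rewrite tpS.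
have D : is_derive (x : R^o) 1 (fun x : R^o => x - k : R^o) (1 - 0).
  by apply: is_deriveB.
apply: is_derive_eq; rewrite subr0 /=.
rewrite -[_ *: _]/(_ * _) -[tp k n x *: _]/(_ * _) mulr1.
case: n {IH} => [|n] /=; first by rewrite mul0r mulr0 add0r mul1r.
by rewrite [tp k n.+1 x]tpS; ring.
Qed.

Lemma tp_continuous k n x : k != x \/ (0 < n)%N -> {for x, continuous (tp k n : R^o -> R^o)}.
Proof.
move=> H; have [n1|] := leqP n 1.
  case: n n1 H => [|[|//]] _; last by move=> _; exact: tp1_continuous.
  by case=> // kx; apply: is_derive_continuous (is_derive_tp0 kx).
by move=> n1; apply: is_derive_continuous (is_derive_tp _); right.
Qed.

(** Off its knot a truncated power is smooth, at the knot only of class C^(n-1). The source is a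
    general space because [g] is the identity of the line in one use and a coordinate of the inverse
    parametrization in another. *)
Lemma Ck_tp m (V : normedModType R) (A : set V) (g : V -> R^o) k n : open A ->
  (forall y : V, A y -> k != g y) \/ (m < n)%N -> Ck m A g ->
  Ck m A (fun y => tp k n (g y)).
Proof.
move=> oA; elim: m n => [|m IH] n H Cg.
  split=> // x Ax; apply: (@continuous_comp _ _ _ g (tp k n)); first exact: Cg.1.
  by apply: tp_continuous; case: H => [H|H]; [left; exact: H|right].
have D (x u : V) : A x -> is_derive x u (fun y => tp k n (g y) : R^o) (n%:R * tp k n.-1 (g x) * 'D_u g x).
  move=> Ax; have [_ dg] := Ck_elim Cg u.
  apply: (@wder_is_derive _ _ setT); first exact: filterT.
  apply: (@wder_comp _ _ setT g x u _ (tp k n)); first by apply: is_derive_wder; exact: dg.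
  apply: is_derive_tp; case: H => H; [left; exact: H|right].
  exact: leq_ltn_trans H.
apply: Ck_intro => // [x Ax|u].
  apply: (@continuous_comp _ _ _ g (tp k n)); first exact: (Ck_cont Cg).
  by apply: tp_continuous; case: H => [H|H]; [left; exact: H|right; exact: leq_ltn_trans H].
exists (fun y => n%:R * tp k n.-1 (g y) * 'D_u g y); last by move=> x; exact: D.
apply: CkM => //; last by case: (Ck_elim Cg u).
apply: CkM => //; first exact: Ck_cst.
apply: IH; last exact: CkS.
by case: H => H; [left|right; rewrite -ltnS prednK // (leq_ltn_trans _ H)].
Qed.

(* [j]-th derivative of the truncated power with knot [b.1] and degree [b.2]. *)
Definition dtp j (b : R * nat) x : R := (b.2 ^_ j)%:R * tp b.1 (b.2 - j) x.

Lemma is_derive_dtp j b x : b.1 != x \/ (j.+1 < b.2)%N ->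
  is_derive (x : R^o) 1 (dtp j b : R^o -> R^o) (dtp j.+1 b x).
Proof.
move=> H; have D : is_derive (x : R^o) 1 (tp b.1 (b.2 - j) : R^o -> R^o) ((b.2 - j)%:R * tp b.1 (b.2 - j).-1 x).
  by apply: is_derive_tp; case: H => H; [left|right; rewrite ltn_subRL addn1].
have := @is_deriveZ _ _ _ _ (b.2 ^_ j)%:R _ _ _ D.
move=> /is_derive_eq; apply.
by rewrite /dtp -[_ *: _]/(_ * _) mulrA -natrM -ffactnSr subnS.
Qed.

Lemma Ck_id m : Ck m (setT : set R^o) id.
Proof.
have oT : open (setT : set R^o) by exact: openT.
elim: m => [|m IH]; first by split=> // x _; exact: cvg_id.
apply: Ck_intro => // [x _|u]; first exact: cvg_id.
by exists (cst u) => [|x _]; [exact: Ck_cst|exact: is_derive_id].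
Qed.

Lemma Ck_poly m (q : {poly R}) : Ck m (setT : set R^o) (fun x => q.[x] : R^o).
Proof.
have oT : open (setT : set R^o) by exact: openT.
elim/poly_ind: q => [|q c IH].
  by under [X in Ck _ _ X]eq_fun do rewrite horner0; exact: Ck_cst.
under [X in Ck _ _ X]eq_fun do rewrite hornerMXaddC.
apply: CkD => //; last exact: Ck_cst.
by apply: CkM => //; exact: Ck_id.
Qed.

Lemma Ck_sub m (V : normedModType R) (A B : set V) (f : V -> R^o) :
  A `<=` B -> Ck m B f -> Ck m A f.
Proof.
move=> AB; elim: m f => [|m IH] f /= [cf H].
  by split=> // x /AB; exact: cf.
split=> [x /AB|u]; first exact: cf.
by have [df Cf] := H u; split=> [x /AB|]; [exact: df|exact: IH].
Qed.

(** Continuity at [k] equates the left limit 0 with the right limit [d.[k]]. The derivative of [h]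
    satisfies the same hypotheses with the derivative of [d] and with [m - 1], so induction yields
    the higher orders. *)
Lemma jump_vanish m (d : {poly R}) (h : R^o -> R^o) l k r : l < k -> k < r ->
  (forall x, l < x -> x < k -> h x = 0) ->
  (forall x, k < x -> x < r -> h x = d.[x]) ->
  Ck m `]l, r[%classic h -> forall j, (j <= m)%N -> d^`(j).[k] = 0.
Proof.
move=> lk kr; elim: m d h => [|m IH] d h h0 hd Ch j.
all: have ck : {for k, continuous h} by apply: (Ck_cont Ch); rewrite /= in_itv /= lk kr.
all: have E : d.[k] = 0.
1,3: have L : h x @[x --> k^'-] --> h k by apply: cvg_at_left_filter.
1,2: have L0 : h x @[x --> k^'-] --> (0 : R^o).
1,3: apply: cvg_ext (cvg_cst (0 : R^o)); near=> x; rewrite h0 //; near: x; by [exact: nbhs_left_lt|exact: nbhs_left_gt].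
1,2: have Rr : h x @[x --> k^'+] --> h k by apply: cvg_at_right_filter.
1,2: have Rd : h x @[x --> k^'+] --> (d.[k] : R^o).
1,3: have Rd : d.[x] @[x --> k^'+] --> d.[k] by apply: cvg_at_right_filter; exact: continuous_horner.
1,2: apply: cvg_ext Rd; near=> x; rewrite hd //; near: x; by [exact: nbhs_right_gt|exact: nbhs_right_lt].
1,2: by rewrite -(cvg_unique _ Rr Rd) // (cvg_unique _ L L0).
  by rewrite leqn0 => /eqP ->.
case: j => [//|j]; rewrite ltnS derivSn.
have [C D] := Ck_elim Ch 1.
apply: (IH _ ('D_1 h)) => // x a b.
  have oA : open `]l, k[%classic by exact: itv_open.
  have Ax : `]l, k[%classic x by rewrite /= in_itv /= a b.
  have F : is_derive (x : R^o) 1 h (0 : R^o).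
    apply: (is_derive_eq_on (f := cst 0) oA _ Ax) => y /=; rewrite in_itv /= => /andP[? ?].
    by rewrite h0.
  by case: F.
have oA : open `]k, r[%classic by exact: itv_open.
have Ax : `]k, r[%classic x by rewrite /= in_itv /= a b.
have F : is_derive (x : R^o) 1 h (d^`().[x] : R^o).
  have Fp : is_derive (x : R^o) 1 (horner d : R^o -> R^o) (d^`().[x]) by exact: is_derive_poly.
  apply: (is_derive_eq_on oA _ Ax Fp) => y /=; rewrite in_itv /= => /andP[? ?].
  by rewrite hd.
by case: F.
Unshelve. all: by end_near. Qed.

End TruncatedPower.

Section Splines.
Variables (R : realType) (p : nat).
Hypothesis hp : p \in [:: 3; 4; 5]%N.
Implicit Types (t x : R).

Let ps : [\/ p = 3, p = 4 | p = 5]%N.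
Proof. by move: hp; rewrite !inE => /or3P[] /eqP ->; [constructor 1|constructor 2|constructor 3]. Qed.

Lemma segment01P t : `[0, 1]%classic t <-> 0 <= t <= 1.
Proof. by rewrite /= in_itv. Qed.

Lemma segment01o t : `]0, 1[%classic t <-> 0 < t < 1.
Proof. by rewrite /= in_itv. Qed.

Lemma itv01W t : 0 < t < 1 -> 0 <= t <= 1.
Proof. by case/andP => ? ?; rewrite !ltW. Qed.

Definition knots : seq R := [seq i.+1%:R / (6 - p)%:R | i <- iota 0 (5 - p)].

(* On [0, 1] the knot [-1] lies to the left of every point, so that the entries
   [(-1, n)] stand for the polynomials [(x + 1) ^ n]. *)
Definition bas : seq (R * nat) :=
  [seq (-1, n) | n <- iota 0 p.+1] ++ [seq (k, p.-1) | k <- knots]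
  ++ [seq (k, p) | k <- knots].

Definition basi (i : 'I_(11 - p)) : R * nat := nth (0, 0%N) bas i.

Definition lin j (c : 'rV[R]_(11 - p)) x : R := \sum_i c 0 i * dtp j (basi i) x.

Lemma size_bas : size bas = (11 - p)%N.
Proof. by rewrite !size_cat !size_map !size_iota; case: ps => ->. Qed.

Lemma knotsP (k : R) : k \in knots ->
  exists2 j : nat, (j.+1 < 6 - p)%N & k = j.+1%:R / (6 - p)%:R.
Proof.
move=> /mapP[j]; rewrite mem_iota add0n => /andP[_ H] ->; exists j => //.
by case: ps H => ->; lia.
Qed.

Lemma pieces_gt0 : 0 < (6 - p)%:R :> R.
Proof. by rewrite ltr0n; case: ps => ->. Qed.

Lemma knots01 (k : R) : k \in knots -> 0 < k < 1.
Proof.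
move=> /knotsP[j jp ->]; have H := pieces_gt0.
by rewrite divr_gt0 //= ltr_pdivrMr // mul1r ltr_nat.
Qed.

Lemma basiP i : ((basi i).1 = -1 /\ ((basi i).2 <= p)%N) \/
  ((basi i).1 \in knots /\ ((basi i).2 == p.-1) || ((basi i).2 == p)).
Proof.
have : basi i \in bas by rewrite mem_nth // size_bas.
rewrite /bas !mem_cat => /or3P[] /mapP[y].
- by rewrite mem_iota add0n ltnS => /andP[_ H] ->; left.
- by move=> H ->; right; rewrite /= eqxx.
- by move=> H ->; right; rewrite /= eqxx orbT.
Qed.

Lemma knot_in_bas (k : R) n : k \in knots -> (n == p.-1) || (n == p) ->
  exists i, basi i = (k, n).
Proof.
move=> kk nn; have : (k, n) \in bas.
  rewrite !mem_cat; case/orP: nn => /eqP ->; [apply/orP; right; apply/orP; left|apply/orP; right; apply/orP; right]; exact: map_f.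
move=> /(nthP (0, 0%N)) [j]; rewrite size_bas => jl E.
by exists (Ordinal jl).
Qed.

Lemma mono_in_bas n : (n <= p)%N -> exists i, basi i = (-1, n).
Proof.
move=> np; have : (-1, n) \in bas.
  by rewrite mem_cat map_f // mem_iota.
move=> /(nthP (0, 0%N)) [j]; rewrite size_bas => jl E.
by exists (Ordinal jl).
Qed.

(** A basis function with a knot in the interval has degree at least [p - 1], hence at least 2, and
    is differentiable everywhere once; further derivatives require avoiding the knots. *)
Lemma is_derive_dbasi j i x : 0 <= x -> (j = 0%N) \/ x \notin knots ->
  is_derive (x : R^o) 1 (dtp j (basi i) : R^o -> R^o) (dtp j.+1 (basi i) x).
Proof.
move=> x0 H; apply: is_derive_dtp; case: (basiP i) => [[-> _]|[bk bn]].
  by left; apply/eqP => E; move: x0; rewrite -E; lra.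
case: H => [->|xk]; first by right; case: ps bn => -> /orP[] /eqP ->.
by left; apply: contraNneq xk => <-.
Qed.

Lemma is_derive_lin j (c : 'rV[R]_(11 - p)) x : 0 <= x ->
  (j = 0%N) \/ x \notin knots ->
  is_derive (x : R^o) 1 (lin j c : R^o -> R^o) (lin j.+1 c x).
Proof.
move=> x0 H; have D i : is_derive (x : R^o) 1 (fun x => c 0 i * dtp j (basi i) x : R^o)
    (c 0 i * dtp j.+1 (basi i) x) by apply: is_deriveZ; exact: is_derive_dbasi.
have := is_derive_sum (h := fun i x => c 0 i * dtp j (basi i) x : R^o) D.
by rewrite fct_sumE.
Qed.

Lemma linD j c d x : lin j (c + d) x = lin j c x + lin j d x.
Proof. by rewrite -big_split; apply: eq_bigr => i _; rewrite mxE mulrDl. Qed.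

Lemma linZ j a c x : lin j (a *: c) x = a * lin j c x.
Proof. by rewrite mulr_sumr; apply: eq_bigr => i _; rewrite mxE mulrA. Qed.

Lemma linB j c d x : lin j (c - d) x = lin j c x - lin j d x.
Proof. by rewrite linD -scaleN1r linZ mulN1r. Qed.

Lemma lin0 j x : lin j 0 x = 0.
Proof. by rewrite /lin big1 // => i _; rewrite mxE mul0r. Qed.

Lemma lin_sum j (I : finType) (F : I -> 'rV[R]_(11 - p)) x :
  lin j (\sum_k F k) x = \sum_k lin j (F k) x.
Proof. by elim/big_rec2: _ => [|k y1 y2 _ IH]; rewrite ?lin0 // linD IH. Qed.

(* [Q] selects which basis functions may be used. *)
Definition inspan (Q : pred (R * nat)) (A : set R) (h : R -> R) : Prop :=
  exists2 c : 'rV[R]_(11 - p), (forall i, ~~ Q (basi i) -> c 0 i = 0) &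
    forall t, A t -> h t = lin 0 c t.

Lemma inspan_eq Q A g h : (forall t, A t -> g t = h t) -> inspan Q A g -> inspan Q A h.
Proof. by move=> gh [c cQ cE]; exists c => // t At; rewrite -gh ?cE. Qed.

Lemma inspanD Q A g h : inspan Q A g -> inspan Q A h -> inspan Q A (fun t => g t + h t).
Proof.
move=> [c cQ cE] [d dQ dE]; exists (c + d) => [i Qi|t At].
  by rewrite mxE cQ ?dQ ?addr0.
by rewrite linD cE ?dE.
Qed.

Lemma inspanZ Q A a h : inspan Q A h -> inspan Q A (fun t => a * h t).
Proof.
move=> [c cQ cE]; exists (a *: c) => [i Qi|t At].
  by rewrite mxE cQ ?mulr0.
by rewrite linZ cE.
Qed.

Lemma inspan0 Q A : inspan Q A (fun=> 0).
Proof. by exists 0 => [i _|t _]; rewrite ?mxE ?lin0. Qed.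

Lemma inspan_sum Q A (I : eqType) (s : seq I) (h : I -> R -> R) :
  (forall j, j \in s -> inspan Q A (h j)) -> inspan Q A (fun t => \sum_(j <- s) h j t).
Proof.
elim: s => [|j s IH] H.
  by under [X in inspan _ _ X]eq_fun do rewrite big_nil; exact: inspan0.
under [X in inspan _ _ X]eq_fun do rewrite big_cons.
apply: inspanD; first by apply: H; rewrite inE eqxx.
by apply: IH => k ks; apply: H; rewrite inE ks orbT.
Qed.

Lemma inspan_basi (Q : pred (R * nat)) A i : Q (basi i) -> inspan Q A (tp (basi i).1 (basi i).2).
Proof.
move=> Qi; exists (delta_mx 0 i) => [j|t _].
  by rewrite mxE eqxx /=; have [->|//] := eqVneq j i; rewrite Qi.
rewrite /lin (bigD1 i) //= big1 => [|j ji]; last first.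
  by rewrite mxE eqxx /= (negbTE ji) mul0r.
by rewrite mxE !eqxx mul1r addr0 /dtp ffactn0 mul1r subn0.
Qed.

Lemma inspan_poly (Q : pred (R * nat)) d (q : {poly R}) : (d <= p)%N -> (size q <= d.+1)%N ->
  (forall n, (n <= d)%N -> Q (-1, n)) ->
  inspan Q `[0, 1]%classic (fun t => q.[t]).
Proof.
move=> dp sq HQ; apply: (@inspan_eq _ _
   (fun t => \sum_(n <- iota 0 d.+1) (q \Po ('X - 1%:P))`_n * tp (-1) n t)).
  move=> t /segment01P /andP[t0 _].
  have -> : q.[t] = (q \Po ('X - 1%:P)).[t + 1].
    by rewrite horner_comp !hornerE addrK.
  rewrite (@horner_coef_wide _ d.+1); last first.
    by rewrite size_comp_poly2 ?size_XsubC.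
  rewrite -{1}[d.+1]subn0 -/(index_iota 0 d.+1) big_mkord; apply: eq_bigr => j _.
  by rewrite tp_gt ?opprK //; lra.
apply: inspan_sum => n; rewrite mem_iota add0n ltnS => /andP[_ nd].
apply: inspanZ; have [i Ei] := mono_in_bas (leq_trans nd dp).
by have := @inspan_basi Q `[0,1]%classic i; rewrite Ei /=; apply; exact: HQ.
Qed.

Definition breakpt j : R := j%:R / (6 - p)%:R.

Definition piece j : set R := `[breakpt j, breakpt j.+1]%classic.

Lemma ler_breakpt i j : (i <= j)%N -> breakpt i <= breakpt j.
Proof. by move=> ij; rewrite ler_pM2r ?invr_gt0 ?pieces_gt0 // ler_nat. Qed.

Lemma ltr_breakpt i j : (i < j)%N -> breakpt i < breakpt j.
Proof. by move=> ij; rewrite ltr_pM2r ?invr_gt0 ?pieces_gt0 // ltr_nat. Qed.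

Lemma breakpt0 : breakpt 0 = 0.
Proof. by rewrite /breakpt mul0r. Qed.

Lemma breakpt_last : breakpt (6 - p) = 1.
Proof. by rewrite /breakpt divff // gt_eqF // pieces_gt0. Qed.

Lemma piece_exists t : 0 <= t <= 1 -> exists2 j, (j < 6 - p)%N & piece j t.
Proof.
move=> /andP[t0 t1].
suff H m : t <= breakpt m.+1 -> exists2 j, (j < m.+1)%N & piece j t.
  have := H (5 - p)%N; have -> : (5 - p).+1 = (6 - p)%N by case: ps => ->.
  by rewrite breakpt_last => /(_ t1).
elim: m => [|m IH] tm.
  by exists 0%N => //; rewrite /piece /= in_itv /= tm breakpt0 t0.
have [/IH[j jm jt]|mt] := leP t (breakpt m.+1); first by exists j => //; exact: ltnW.
by exists m.+1 => //; rewrite /piece /= in_itv /= tm ltW.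
Qed.

(** The jump between consecutive polynomials, expanded at their common breakpoint, has no terms of
    order up to [m] by [jump_vanish]. Since [p <= m.+2] and [d <= p], the remaining orders are
    [p - 1] and [p], for which the truncated powers belong to [bas]. For [p = 5] there is no
    interior breakpoint and no smoothness is required. The set [A] lies between the open and the
    closed interval because normal derivatives are first controlled on open sides only. *)
Lemma pieces_inspan (A : set R) d m (h : R^o -> R^o) :
  (d <= p)%N -> (p <= m.+2)%N ->
  (`]0, 1[%classic : set R) `<=` A -> A `<=` `[0, 1]%classic ->
  (forall j, (j < 6 - p)%N -> poly_on d (A `&` piece j) h) ->
  ((p < 5)%N -> Ck m (`]0, 1[%classic : set R^o) h) ->
  inspan (fun b => (b.2 <= d)%N && ((b.1 == -1) || (m < b.2)%N)) A h.
Proof.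
move=> dp pm A0 A1 Hq Ch.
have /choice[q Eq] : forall j : nat, exists q : {poly R}, (j < 6 - p)%N ->
    (size q <= d.+1)%N /\ forall t, (A `&` piece j) t -> h t = q.[t].
  move=> j; have [jp|jp] := ltnP j (6 - p); last by exists 0.
  by have [q qE] := Hq j jp; exists q.
pose D i := q i.+1 - q i.
pose e i n := (D i)^`N(n).[breakpt i.+1].
have e0 i n : (i < 5 - p)%N -> (n <= m)%N -> e i n = 0.
  move=> ip nm.
  have i6 : (i.+1 < 6 - p)%N by case: ps ip => ->; lia.
  have [_ E1] := Eq i (ltnW i6); have [_ E2] := Eq i.+1 i6.
  have b0 : 0 <= breakpt i by rewrite -breakpt0 ler_breakpt.
  have b1 : breakpt i.+2 <= 1 by rewrite -breakpt_last ler_breakpt.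
  have l1 : breakpt i < breakpt i.+1 by exact: ltr_breakpt.
  have l2 : breakpt i.+1 < breakpt i.+2 by exact: ltr_breakpt.
  have J : (D i)^`(n).[breakpt i.+1] = 0.
    apply: (@jump_vanish _ m (D i) (fun x => h x - (q i).[x]) _ _ _ l1 l2) => //.
    - move=> x a b; rewrite E1 ?subrr //; split; last by rewrite /piece /= in_itv /= !ltW.
      by apply: A0; rewrite /= in_itv /=; apply/andP; split; lra.
    - move=> x a b; rewrite /D hornerD hornerN E2 //; split; last by rewrite /piece /= in_itv /= !ltW.
      by apply: A0; rewrite /= in_itv /=; apply/andP; split; lra.
    - have oI : open (`]breakpt i, breakpt i.+2[%classic : set R^o) by exact: itv_open.
      have S : `]breakpt i, breakpt i.+2[%classic `<=` `]0, 1[%classic.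
        by move=> x /=; rewrite !in_itv /= => /andP[? ?]; apply/andP; split; lra.
      apply: (CkD (f := h) (g := fun x => - (q i).[x])) => //.
        by apply: (Ck_sub S); apply: Ch; case: ps ip => ->; lia.
      have := @Ck_poly R m (- q i); under eq_fun do rewrite hornerN.
      by move=> C; apply: (Ck_sub _ C).
  move: J; rewrite nderivn_def hornerMn => /eqP; rewrite mulrn_eq0.
  by rewrite -leqn0 leqNgt fact_gt0 /= => /eqP.
have DE i t : (i < 5 - p)%N -> (D i).[t] = \sum_(n <- iota 0 d.+1) e i n * (t - breakpt i.+1) ^+ n.
  move=> ip; have i6 : (i.+1 < 6 - p)%N by case: ps ip => ->; lia.
  have [s1 _] := Eq i (ltnW i6); have [s2 _] := Eq i.+1 i6.
  have sD : (size (D i) <= d.+1)%N.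
    by apply: leq_trans (size_polyD _ _) _; rewrite size_polyN geq_max s2.
  rewrite -{1}(subrK (breakpt i.+1) t) addrC nderiv_taylor; last exact: mulrC.
  rewrite -{1}[d.+1]subn0 -/(index_iota 0 d.+1) big_mkord.
  rewrite (big_ord_widen _ (fun n => e i n * (t - breakpt i.+1) ^+ n) sD) big_mkcond.
  apply: eq_bigr => n _; case: ltnP => // sn.
  rewrite [e i n](_ : _ = 0) ?mul0r // /e.
  have -> : (D i)^`N(n) = 0.
    by apply/polyP => l; rewrite coef_nderivn coef0 nth_default ?mul0rn // (leq_trans sn) // leq_addr.
  by rewrite horner0.
have q0s : (size (q 0%N) <= d.+1)%N by apply: (Eq 0%N _).1; case: ps => ->.
apply: (@inspan_eq _ _ (fun t => (q 0%N).[t] +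
    \sum_(i <- iota 0 (5 - p)) \sum_(n <- iota 0 d.+1) e i n * tp (breakpt i.+1) n t)).
  move=> t At; have t01 : 0 <= t <= 1 by have := A1 t At; rewrite /= in_itv.
  have [j j6 jt] := piece_exists t01.
  have [_ ->] := Eq j j6; last by [].
  move: jt; rewrite /piece /= in_itv /= => /andP[jt tj].
  have j5 : (j <= 5 - p)%N by case: ps j6 => ->; lia.
  have -> : iota 0 (5 - p) = index_iota 0 (5 - p) by rewrite /index_iota subn0.
  (* On piece [j] the truncated powers at later breakpoints vanish, and the earlier jumps telescope
     to [q j - q 0]. *)
  rewrite (big_cat_nat (n := j)) //=.
  rewrite [X in _ + (_ + X)]big_nat_cond [X in _ + (_ + X)]big1 ?addr0; last first.
    move=> i /andP[/andP[ji _] _]; rewrite big1 // => n _.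
    by rewrite tp_le ?mulr0 // (le_trans tj) // ler_breakpt.
  rewrite big_nat_cond (eq_bigr (fun i => (q i.+1).[t] - (q i).[t])); last first.
    move=> i /andP[/andP[_ ij] _].
    have i5 : (i < 5 - p)%N by exact: leq_trans ij j5.
    rewrite -hornerN -hornerD -/(D i) DE //; apply: eq_bigr => n _.
    (* At its knot the truncated power of degree 0 is 0 whereas the ordinary power is 1; the
       coefficient of order 0 vanishes, so this does not matter. *)
    case: n => [|n]; first by rewrite e0 // !mul0r.
    by rewrite tp_ge // (le_trans _ jt) // ler_breakpt.
  by rewrite -big_nat_cond telescope_sumr // addrC subrK.
apply: inspanD.
  have [c cQ cE] := @inspan_poly (fun b => (b.2 <= d)%N && ((b.1 == -1) || (m < b.2)%N)) d (q 0%N)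
     dp q0s (fun n nd => ltac:(by rewrite /= nd eqxx)).
  by exists c => // t /A1 /cE.
apply: inspan_sum => i; rewrite mem_iota add0n => /andP[_ ip].
apply: inspan_sum => n; rewrite mem_iota add0n ltnS => /andP[_ nd].
have [nm|mn] := leqP n m.
  by rewrite e0 //; under [X in inspan _ _ X]eq_fun do rewrite mul0r; exact: inspan0.
apply: inspanZ.
have kk : breakpt i.+1 \in knots by apply: map_f; rewrite mem_iota.
have nn : (n == p.-1) || (n == p) by lia.
have [l El] := knot_in_bas kk nn.
have := @inspan_basi (fun b => (b.2 <= d)%N && ((b.1 == -1) || (m < b.2)%N)) A l.
by rewrite El /= nd mn orbT; apply.
Qed.

Lemma lin_piece (Q : pred (R * nat)) d (c : 'rV[R]_(11 - p)) j : (forall i, ~~ Q (basi i) -> c 0 i = 0) ->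
  (forall b, Q b -> (b.2 <= d)%N) -> (j < 6 - p)%N -> poly_on d (piece j) (lin 0 c).
Proof.
move=> cQ Qd jp.
have /choice[q Hq] : forall i, exists q : {poly R}, (size q <= (basi i).2.+1)%N /\
    forall t, piece j t -> tp (basi i).1 (basi i).2 t = q.[t].
  move=> i; have sz (k : R) n : (size (('X - k%:P) ^+ n : {poly R})%R <= n.+1)%N.
    by rewrite size_exp_XsubC.
  case: (basiP i) => [[-> _]|[/knotsP[l lp El] bn]].
    exists (('X - (-1)%:P) ^+ (basi i).2); split => // t; rewrite /piece /= in_itv /= => /andP[jt _].
    rewrite tp_gt ?hornerE_comm ?horner_exp ?hornerXsubC //.
    by have : 0 <= breakpt j; [rewrite -breakpt0 ler_breakpt|lra].
  have b0 : (0 < (basi i).2)%N by case: ps bn => -> /orP[] /eqP ->.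
  have [lj|jl] := ltnP l j.
    exists (('X - ((basi i).1)%:P) ^+ (basi i).2); split => // t; rewrite /piece /= in_itv /= => /andP[jt _].
    rewrite tp_ge ?horner_exp ?hornerXsubC // El (le_trans _ jt) //; exact: ler_breakpt.
  exists 0; split; first by rewrite size_poly0.
  move=> t; rewrite /piece /= in_itv /= => /andP[_ tj].
  by rewrite tp_le ?horner0 // El (le_trans tj) //; exact: ler_breakpt.
exists (\sum_i c 0 i *: q i); split.
  apply: (leq_trans (size_sum _ _ _)); apply/bigmax_leqP => i _.
  have [Qi|/cQ ->] := boolP (Q (basi i)); last by rewrite scale0r size_poly0.
  apply: (leq_trans (size_scale_leq _ _)); apply: leq_trans (Hq i).1 _.
  by rewrite ltnS Qd.
move=> t jt; rewrite horner_sum; apply: eq_bigr => i _.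
by rewrite hornerZ /dtp ffactn0 mul1r subn0 (Hq i).2.
Qed.

Lemma Ck_lin (Q : pred (R * nat)) m (c : 'rV[R]_(11 - p)) : (forall i, ~~ Q (basi i) -> c 0 i = 0) ->
  (forall b, Q b -> (b.1 == -1) || (m < b.2)%N) ->
  Ck m (`]0, 1[%classic : set R^o) (lin 0 c : R^o -> R^o).
Proof.
move=> cQ Qm; have oI : open (`]0, 1[%classic : set R^o) by exact: itv_open.
apply: Ck_sum => // i; have [Qi|/cQ ->] := boolP (Q (basi i)); last first.
  by under [X in Ck _ _ X]eq_fun do rewrite mul0r; exact: Ck_cst.
apply: CkM => //; first exact: Ck_cst.
rewrite /dtp; apply: CkM => //; first exact: Ck_cst.
rewrite subn0; apply: (Ck_tp (g := id)) => //.
  case/orP: (Qm _ Qi) => [/eqP ->|]; [left|by right].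
  by move=> y; rewrite /= in_itv /= => /andP[? _]; apply/eqP => E; lra.
by apply: (Ck_sub _ (@Ck_id R m)).
Qed.

End Splines.

(** * Unisolvence of the univariate interpolation problems *)

Section Unisolvence.
Variables (R : realType).

(** Indexing by plain numbers lets the sum in [lin] unfold, for a concrete [p], into explicit terms
    that [lra] can treat. *)
Definition cof p (c : 'rV[R]_(11 - p)) (n : nat) : R :=
  if insub n is Some k then c 0 k else 0.

Lemma cofE p (c : 'rV[R]_(11 - p)) (i : 'I_(11 - p)) : cof c i = c 0 i.
Proof. by rewrite /cof valK. Qed.

Lemma lin_cof p (j : nat) (c : 'rV[R]_(11 - p)) x :
  lin j c x = \sum_(0 <= n < 11 - p) cof c n * dtp j (nth (0, 0%N) (bas R p) n) x.
Proof. by rewrite big_mkord; apply: eq_bigr => i _; rewrite cofE. Qed.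

Lemma dtp0E k n (x : R) : dtp 0 (k, n) x = tp k n x.
Proof. by rewrite /dtp ffactn0 mul1r subn0. Qed.

Lemma dtp1E k n (x : R) : dtp 1 (k, n) x = n%:R * tp k n.-1 x.
Proof. by rewrite /dtp ffactn1 subn1. Qed.

Lemma dtp2E k n (x : R) : dtp 2 (k, n) x = n%:R * n.-1%:R * tp k n.-2 x.
Proof. by rewrite /dtp ffactnS ffactn1 subn2 natrM. Qed.

Lemma cof_eq0 p (c : 'rV[R]_(11 - p)) :
  (forall n, (n < 11 - p)%N -> cof c n = 0) -> c = 0.
Proof. by move=> H; apply/rowP => i; rewrite mxE -cofE H. Qed.

Lemma cofQ p (c : 'rV[R]_(11 - p)) (Q : pred (R * nat)) n :
  (forall i : 'I_(11 - p), ~~ Q (basi R i) -> c 0 i = 0) -> (n < 11 - p)%N ->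
  ~~ Q (nth (0, 0%N) (bas R p) n) -> cof c n = 0.
Proof. by move=> cQ np; rewrite -[n]/(val (Ordinal np)) cofE; exact: cQ. Qed.

Ltac num_lra :=
  repeat match goal with H : _ = _ |- _ => clear H | H : forall _, _ |- _ => clear H end; lra.

Ltac eval_tp := rewrite ?dtp0E ?dtp1E ?dtp2E /=;
  repeat match goal with |- context [@tp _ ?k ?n ?x] =>
    first [ rewrite (@tp_gt _ k n x); last by num_lra
          | rewrite (@tp_le _ k n x); last by num_lra ] end.

Ltac eval_lin p n k H := move: H;
  rewrite lin_cof -[(11 - p)%N]/n !big_nat_recr ?big_geq //=;
  try rewrite -[(6 - p)%N]/k; eval_tp; move=> H.

(** As many equidistant interior points as the dimension of the spline space. They carry no degree
    of freedom; they serve to recognise equal splines and to build cardinal splines. *)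
Lemma points_unisolvent p (c : 'rV[R]_(11 - p)) : p \in [:: 3; 4; 5]%N ->
  (forall j, (j < 11 - p)%N -> lin 0 c (j.+1%:R / (12 - p)%:R) = 0) -> c = 0.
Proof.
rewrite !inE => /or3P[] /eqP E; subst p => H; apply: cof_eq0 => n.
- have := (H 0%N isT, H 1%N isT, H 2%N isT, H 3%N isT, H 4%N isT, H 5%N isT, H 6%N isT, H 7%N isT).
  rewrite -[(12 - 3)%N]/9%N => {H} [[[[[[[[h0 h1] h2] h3] h4] h5] h6] h7]].
  eval_lin 3%N 8%N 3%N h0. eval_lin 3%N 8%N 3%N h1. eval_lin 3%N 8%N 3%N h2.
  eval_lin 3%N 8%N 3%N h3. eval_lin 3%N 8%N 3%N h4. eval_lin 3%N 8%N 3%N h5.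
  eval_lin 3%N 8%N 3%N h6. eval_lin 3%N 8%N 3%N h7.
  by do 8 (case: n => [_|n]; first by lra).
- have := (H 0%N isT, H 1%N isT, H 2%N isT, H 3%N isT, H 4%N isT, H 5%N isT, H 6%N isT).
  rewrite -[(12 - 4)%N]/8%N => {H} [[[[[[[h0 h1] h2] h3] h4] h5] h6]].
  eval_lin 4%N 7%N 2%N h0. eval_lin 4%N 7%N 2%N h1. eval_lin 4%N 7%N 2%N h2.
  eval_lin 4%N 7%N 2%N h3. eval_lin 4%N 7%N 2%N h4. eval_lin 4%N 7%N 2%N h5.
  eval_lin 4%N 7%N 2%N h6.
  by do 7 (case: n => [_|n]; first by lra).
- have := (H 0%N isT, H 1%N isT, H 2%N isT, H 3%N isT, H 4%N isT, H 5%N isT).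
  rewrite -[(12 - 5)%N]/7%N => {H} [[[[[[h0 h1] h2] h3] h4] h5]].
  eval_lin 5%N 6%N 1%N h0. eval_lin 5%N 6%N 1%N h1. eval_lin 5%N 6%N 1%N h2.
  eval_lin 5%N 6%N 1%N h3. eval_lin 5%N 6%N 1%N h4. eval_lin 5%N 6%N 1%N h5.
  by do 6 (case: n => [_|n]; first by lra).
Qed.

(** Four conditions at the ends and [7 - p] at the points of E_p form a square system, written out
    numerically for each [p] and solved by linear arithmetic. *)
Lemma hermite_unisolvent p (c : 'rV[R]_(11 - p)) : p \in [:: 3; 4; 5]%N ->
  lin 0 c 0 = 0 -> lin 1 c 0 = 0 -> lin 0 c 1 = 0 -> lin 1 c 1 = 0 ->
  (forall x, x \in eta_points R p -> lin 0 c x = 0) -> c = 0.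
Proof.
rewrite !inE => /or3P[] /eqP E; subst p.
all: move=> e1 e2 e3 e4 e5; apply: cof_eq0 => n.
- have f1 := e5 (2 / 9); have f2 := e5 (4 / 9); have f3 := e5 (5 / 9); have f4 := e5 (7 / 9).
  move: f1 f2 f3 f4 {e5}; rewrite !inE !eqxx ?orbT /= => /(_ isT) f1 /(_ isT) f2 /(_ isT) f3 /(_ isT) f4.
  eval_lin 3%N 8%N 3%N e1. eval_lin 3%N 8%N 3%N e2. eval_lin 3%N 8%N 3%N e3. eval_lin 3%N 8%N 3%N e4.
  eval_lin 3%N 8%N 3%N f1. eval_lin 3%N 8%N 3%N f2. eval_lin 3%N 8%N 3%N f3. eval_lin 3%N 8%N 3%N f4.
  by do 8 (case: n => [_|n]; first by lra).
- have f1 := e5 (1 / 4); have f2 := e5 (2 / 4); have f3 := e5 (3 / 4).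
  move: f1 f2 f3 {e5}; rewrite !inE !eqxx ?orbT /= => /(_ isT) f1 /(_ isT) f2 /(_ isT) f3.
  eval_lin 4%N 7%N 2%N e1. eval_lin 4%N 7%N 2%N e2. eval_lin 4%N 7%N 2%N e3. eval_lin 4%N 7%N 2%N e4.
  eval_lin 4%N 7%N 2%N f1. eval_lin 4%N 7%N 2%N f2. eval_lin 4%N 7%N 2%N f3.
  by do 7 (case: n => [_|n]; first by lra).
- have f1 := e5 (2 / 5); have f2 := e5 (3 / 5).
  move: f1 f2 {e5}; rewrite !inE !eqxx ?orbT /= => /(_ isT) f1 /(_ isT) f2.
  eval_lin 5%N 6%N 1%N e1. eval_lin 5%N 6%N 1%N e2. eval_lin 5%N 6%N 1%N e3. eval_lin 5%N 6%N 1%N e4.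
  eval_lin 5%N 6%N 1%N f1. eval_lin 5%N 6%N 1%N f2.
  by do 6 (case: n => [_|n]; first by lra).
Qed.

(* Selects the splines of degree [d] and of class [C^m]. *)
Definition smooth_span (d m : nat) (b : R * nat) : bool :=
  (b.2 <= d)%N && ((b.1 == -1) || (m < b.2)%N).

Lemma knot_neq (x : R) : 0 <= x -> (x == -1) = false.
Proof. by move=> x0; apply/eqP; lra. Qed.

(** For every [p] there are six free coefficients, [p + 1] of polynomials and [5 - p] of truncated
    powers of degree [p], against the six entries of two 2-jets. *)
Lemma trace_unisolvent p (c : 'rV[R]_(11 - p)) : p \in [:: 3; 4; 5]%N ->
  (forall i, ~~ smooth_span p p.-1 (basi R i) -> c 0 i = 0) ->
  lin 0 c 0 = 0 -> lin 1 c 0 = 0 -> lin 2 c 0 = 0 ->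
  lin 0 c 1 = 0 -> lin 1 c 1 = 0 -> lin 2 c 1 = 0 -> c = 0.
Proof.
rewrite !inE => /or3P[] /eqP E; subst p.
all: move=> cQ e1 e2 e3 e4 e5 e6; apply: cof_eq0 => n.
(* Positions 4 and 5 of [bas] hold the truncated powers of degree 2, which are not of class C^2. *)
- have q1 : cof c 4 = 0 by apply: (cofQ cQ) => //; rewrite /smooth_span /= orbF knot_neq //; lra.
  have q2 : cof c 5 = 0 by apply: (cofQ cQ) => //; rewrite /smooth_span /= orbF knot_neq //; lra.
  eval_lin 3%N 8%N 3%N e1. eval_lin 3%N 8%N 3%N e2. eval_lin 3%N 8%N 3%N e3.
  eval_lin 3%N 8%N 3%N e4. eval_lin 3%N 8%N 3%N e5. eval_lin 3%N 8%N 3%N e6.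
  by do 8 (case: n => [_|n]; first by lra).
- have q1 : cof c 5 = 0 by apply: (cofQ cQ) => //; rewrite /smooth_span /= orbF knot_neq //; lra.
  eval_lin 4%N 7%N 2%N e1. eval_lin 4%N 7%N 2%N e2. eval_lin 4%N 7%N 2%N e3.
  eval_lin 4%N 7%N 2%N e4. eval_lin 4%N 7%N 2%N e5. eval_lin 4%N 7%N 2%N e6.
  by do 7 (case: n => [_|n]; first by lra).
- eval_lin 5%N 6%N 1%N e1. eval_lin 5%N 6%N 1%N e2. eval_lin 5%N 6%N 1%N e3.
  eval_lin 5%N 6%N 1%N e4. eval_lin 5%N 6%N 1%N e5. eval_lin 5%N 6%N 1%N e6.
  by do 6 (case: n => [_|n]; first by lra).
Qed.

(** Five free coefficients for every [p]: [p] of polynomials of degree at most [p - 1], and [5 - p]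
    of truncated powers of degree [p - 1]. *)
Lemma normal_unisolvent p (c : 'rV[R]_(11 - p)) : p \in [:: 3; 4; 5]%N ->
  (forall i, ~~ smooth_span p.-1 p.-2 (basi R i) -> c 0 i = 0) ->
  lin 0 c 0 = 0 -> lin 1 c 0 = 0 -> lin 0 c 1 = 0 -> lin 1 c 1 = 0 ->
  lin 0 c (1 / 2) = 0 -> c = 0.
Proof.
rewrite !inE => /or3P[] /eqP E; subst p.
all: move=> cQ e1 e2 e3 e4 e5; apply: cof_eq0 => n.
- have q1 : cof c 3 = 0 by apply: (cofQ cQ).
  have q2 : cof c 6 = 0 by apply: (cofQ cQ).
  have q3 : cof c 7 = 0 by apply: (cofQ cQ).
  eval_lin 3%N 8%N 3%N e1. eval_lin 3%N 8%N 3%N e2. eval_lin 3%N 8%N 3%N e3.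
  eval_lin 3%N 8%N 3%N e4. eval_lin 3%N 8%N 3%N e5.
  by do 8 (case: n => [_|n]; first by lra).
- have q1 : cof c 4 = 0 by apply: (cofQ cQ).
  have q2 : cof c 6 = 0 by apply: (cofQ cQ).
  eval_lin 4%N 7%N 2%N e1. eval_lin 4%N 7%N 2%N e2. eval_lin 4%N 7%N 2%N e3.
  eval_lin 4%N 7%N 2%N e4. eval_lin 4%N 7%N 2%N e5.
  by do 7 (case: n => [_|n]; first by lra).
- have q1 : cof c 5 = 0 by apply: (cofQ cQ).
  eval_lin 5%N 6%N 1%N e1. eval_lin 5%N 6%N 1%N e2. eval_lin 5%N 6%N 1%N e3.
  eval_lin 5%N 6%N 1%N e4. eval_lin 5%N 6%N 1%N e5.
  by do 6 (case: n => [_|n]; first by lra).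
Qed.

End Unisolvence.

(** * Square linear systems *)

Section LinearSystems.
Variable R : realType.

Lemma square_system n (F : 'I_n -> 'rV[R]_n -> R) (d : 'I_n -> R) :
  (forall i a u v, F i (a *: u + v) = a * F i u + F i v) ->
  (forall c, (forall i, F i c = 0) -> c = 0) -> exists c, forall i, F i c = d i.
Proof.
move=> lF F0.
have F00 i : F i 0 = 0.
  by have := lF i (-1) 0 0; rewrite scaler0 addr0 mulN1r addNr.
have Fsum i (u : 'I_n -> 'rV[R]_n) (a : 'I_n -> R) :
    F i (\sum_k a k *: u k) = \sum_k a k * F i (u k).
  elim/big_rec2: _ => [//|k y1 y2 _ IH]; by rewrite lF IH.
pose A : 'M[R]_n := \matrix_(k, i) F i (delta_mx 0 k).
have AE (c : 'rV[R]_n) i : (c *m A) 0 i = F i c.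
  rewrite {2}(row_sum_delta c) Fsum mxE; apply: eq_bigr => k _; by rewrite mxE.
have Au : A \in unitmx.
  rewrite -row_free_unit -kermx_eq0; apply/eqP/row_matrixP => k.
  rewrite row0; apply: F0 => i; rewrite -AE -row_mul mulmx_ker row0 mxE //.
exists ((\row_i d i) *m invmx A) => i.
by rewrite -AE -mulmxA mulVmx // mulmx1 mxE.
Qed.

(** An equation is a pair of a functional and its right-hand side; a list of such pairs lets
    conditions of different kinds be concatenated. *)
Lemma seq_system n (fs : seq (('rV[R]_n -> R) * R)) :
  (forall k : 'I_n, linear_for *%R (nth (fun=> 0, 0) fs k).1) ->
  (forall c, (forall k, (k < n)%N -> (nth (fun=> 0, 0) fs k).1 c = 0) -> c = 0) ->
  exists c, forall k, (k < n)%N ->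
    (nth (fun=> 0, 0) fs k).1 c = (nth (fun=> 0, 0) fs k).2.
Proof.
move=> lf f0.
have [|c|c cE] := @square_system n (fun i => (nth (fun=> 0, 0) fs i).1)
    (fun i => (nth (fun=> 0, 0) fs i).2).
- by move=> i a u v; exact: lf.
- by move=> H; apply: f0 => k kn; exact: (H (Ordinal kn)).
- by exists c => k kn; exact: (cE (Ordinal kn)).
Qed.

End LinearSystems.

(** * Existence of interpolating splines *)

Section Interpolation.
Variables (R : realType) (p : nat).
Hypothesis hp : p \in [:: 3; 4; 5]%N.
Local Notation rV := 'rV[R]_(11 - p).

Let ps : [\/ p = 3, p = 4 | p = 5]%N.
Proof. by move: hp; rewrite !inE => /or3P[] /eqP ->; [constructor 1|constructor 2|constructor 3]. Qed.

Let pb : (2 < p < 6)%N.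
Proof. by case: ps => ->. Qed.

Lemma lin_linear j x : linear_for *%R (fun c : rV => lin j c x).
Proof. by move=> a u v; rewrite linD linZ. Qed.

Lemma cof_linear n : (n < 11 - p)%N -> linear_for *%R (fun c : rV => cof c n).
Proof.
by move=> np a u v; rewrite -[n]/(val (Ordinal np)) !cofE !mxE.
Qed.

Lemma size_eta : size (eta_points R p) = (7 - p)%N.
Proof. by case: ps => ->. Qed.

Lemma eta_in01 x : x \in eta_points R p -> 0 <= x <= 1.
Proof.
by case: ps => ->; rewrite /= !inE => H; repeat case/orP: H => H; (try move/eqP: H => ->);
  apply/andP; split; lra.
Qed.

Let low k : (k < 6)%N -> (k < 11 - p)%N.
Proof. by have := pb; lia. Qed.

Lemma hermite_interpolation (v0 d0 v1 d1 : R) (w : R -> R) :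
  exists c : rV, [/\ lin 0 c 0 = v0, lin 1 c 0 = d0, lin 0 c 1 = v1, lin 1 c 1 = d1 &
    forall x, x \in eta_points R p -> lin 0 c x = w x].
Proof.
pose fs := [:: (fun c : rV => lin 0 c 0, v0); (fun c => lin 1 c 0, d0);
  (fun c => lin 0 c 1, v1); (fun c => lin 1 c 1, d1)] ++
  [seq (fun c : rV => lin 0 c x, w x) | x <- eta_points R p].
have nE k : nth (fun=> 0, 0) fs k.+4 =
    nth (fun=> 0, 0) [seq (fun c : rV => lin 0 c x, w x) | x <- eta_points R p] k by [].
have [||c cE] := @seq_system _ (11 - p) fs.
- case=> [] [|[|[|[|k]]]] kp; try exact: lin_linear.
  rewrite [val _]/= nE (nth_map 0); first exact: lin_linear.
  by move: kp; rewrite size_eta; case: ps => ->; lia.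
- move=> c H; apply: hermite_unisolvent => //.
  + by apply: (H 0%N); exact: low.
  + by apply: (H 1%N); exact: low.
  + by apply: (H 2%N); exact: low.
  + by apply: (H 3%N); exact: low.
  + move=> x xe; have xi : (index x (eta_points R p) < 7 - p)%N by rewrite -size_eta index_mem.
    have := H (index x (eta_points R p)).+4; rewrite nE (nth_map 0) ?index_mem // nth_index //=.
    by apply; move: xi; case: ps => ->; lia.
- exists c; split.
  + by apply: (cE 0%N); exact: low.
  + by apply: (cE 1%N); exact: low.
  + by apply: (cE 2%N); exact: low.
  + by apply: (cE 3%N); exact: low.
  + move=> x xe; have xi : (index x (eta_points R p) < 7 - p)%N by rewrite -size_eta index_mem.
    have := cE (index x (eta_points R p)).+4; rewrite nE (nth_map 0) ?index_mem // nth_index //=.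
    by apply; move: xi; case: ps => ->; lia.
Qed.

(** These [5 - p] positions carry the truncated powers of degree [p - 1]. *)
Lemma trace_forbidden n : (n < 11 - p)%N ->
  ~~ smooth_span p p.-1 (nth (0, 0%N) (bas R p) n) -> n \in iota p.+1 (5 - p).
Proof.
case: ps => ->; rewrite /smooth_span.
- by do 8 (case: n => [|n]; first by rewrite //= ?eqxx ?orbT).
- by do 7 (case: n => [|n]; first by rewrite //= ?eqxx ?orbT).
- by do 6 (case: n => [|n]; first by rewrite //= ?eqxx ?orbT).
Qed.

(** Position [p] carries the monomial of degree [p]; the positions from 6 on carry the truncated
    powers of degree [p]. *)
Lemma normal_forbidden n : (n < 11 - p)%N ->
  ~~ smooth_span p.-1 p.-2 (nth (0, 0%N) (bas R p) n) -> n \in p :: iota 6 (5 - p).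
Proof.
case: ps => ->; rewrite /smooth_span.
- by do 8 (case: n => [|n]; first by rewrite //= ?eqxx ?orbT).
- by do 7 (case: n => [|n]; first by rewrite //= ?eqxx ?orbT).
- by do 6 (case: n => [|n]; first by rewrite //= ?eqxx ?orbT).
Qed.

Lemma trace_interpolation (v0 d0 s0 v1 d1 s1 : R) :
  exists2 c : rV, (forall i, ~~ smooth_span p p.-1 (basi R i) -> c 0 i = 0) &
   [/\ lin 0 c 0 = v0, lin 1 c 0 = d0 & lin 2 c 0 = s0] /\
   [/\ lin 0 c 1 = v1, lin 1 c 1 = d1 & lin 2 c 1 = s1].
Proof.
(* Equations that annihilate the [5 - p] forbidden coefficients complete the six conditions to a
   system of size [11 - p]. *)
pose fs := [:: (fun c : rV => lin 0 c 0, v0); (fun c => lin 1 c 0, d0); (fun c => lin 2 c 0, s0);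
  (fun c => lin 0 c 1, v1); (fun c => lin 1 c 1, d1); (fun c => lin 2 c 1, s1)] ++
  [seq (fun c : rV => cof c n, 0) | n <- iota p.+1 (5 - p)].
have nE k : (k < 5 - p)%N -> nth (fun=> 0, 0) fs (6 + k) = (fun c : rV => cof c (p.+1 + k), 0).
  by move=> kp; rewrite -[LHS]/(nth _ [seq _ | n <- _] k) (nth_map 0%N) ?size_iota // nth_iota.
have vanish (c : rV) : (forall k, (6 <= k < 11 - p)%N -> (nth (fun=> 0, 0) fs k).1 c = 0) ->
    forall i, ~~ smooth_span p p.-1 (basi R i) -> c 0 i = 0.
  move=> H i /(trace_forbidden (ltn_ord i)); rewrite mem_iota => /andP[pi ip].
  have kp : (i - p.+1 < 5 - p)%N by have := pb; lia.
  have := H (6 + (i - p.+1))%N; rewrite nE //= subnKC // cofE; apply.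
  by have := pb; lia.
have [||c cE] := @seq_system _ (11 - p) fs.
- case=> [] [|[|[|[|[|[|k]]]]]] kp; try exact: lin_linear.
  rewrite [val _]/= -[k.+4.+2]/(6 + k)%N nE; last by case: ps kp => ->; lia.
  by apply: cof_linear; case: ps kp => ->; lia.
- move=> c H; apply: trace_unisolvent => //.
  + by apply: vanish => k /andP[_ kp]; exact: H.
  + by apply: (H 0%N); exact: low.
  + by apply: (H 1%N); exact: low.
  + by apply: (H 2%N); exact: low.
  + by apply: (H 3%N); exact: low.
  + by apply: (H 4%N); exact: low.
  + by apply: (H 5%N); exact: low.
- exists c.
    apply: vanish => k /andP[k6 kp]; rewrite cE // -(subnKC k6) nE //.
    by have := pb; lia.
  split; split.
  + by apply: (cE 0%N); exact: low.
  + by apply: (cE 1%N); exact: low.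
  + by apply: (cE 2%N); exact: low.
  + by apply: (cE 3%N); exact: low.
  + by apply: (cE 4%N); exact: low.
  + by apply: (cE 5%N); exact: low.
Qed.

Lemma normal_interpolation (v0 d0 v1 d1 m : R) :
  exists2 c : rV, (forall i, ~~ smooth_span p.-1 p.-2 (basi R i) -> c 0 i = 0) &
   [/\ lin 0 c 0 = v0, lin 1 c 0 = d0, lin 0 c 1 = v1, lin 1 c 1 = d1 & lin 0 c (1 / 2) = m].
Proof.
(* Five interpolation conditions and [6 - p] annihilated coefficients: again [11 - p] equations. *)
pose fs := [:: (fun c : rV => lin 0 c 0, v0); (fun c => lin 1 c 0, d0); (fun c => lin 0 c 1, v1);
  (fun c => lin 1 c 1, d1); (fun c => lin 0 c (1 / 2), m); (fun c => cof c p, 0)] ++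
  [seq (fun c : rV => cof c n, 0) | n <- iota 6 (5 - p)].
have nE k : (k < 5 - p)%N -> nth (fun=> 0, 0) fs (6 + k) = (fun c : rV => cof c (6 + k), 0).
  by move=> kp; rewrite -[LHS]/(nth _ [seq _ | n <- _] k) (nth_map 0%N) ?size_iota // nth_iota.
have vanish (c : rV) : cof c p = 0 ->
    (forall k, (6 <= k < 11 - p)%N -> (nth (fun=> 0, 0) fs k).1 c = 0) ->
    forall i, ~~ smooth_span p.-1 p.-2 (basi R i) -> c 0 i = 0.
  move=> H0 H i /(normal_forbidden (ltn_ord i)); rewrite inE mem_iota => /predU1P[ip|/andP[pi ip]].
    by rewrite -cofE ip.
  have kp : (i - 6 < 5 - p)%N by have := pb; lia.
  have := H (6 + (i - 6))%N; rewrite nE //= subnKC // cofE; apply.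
  exact: ltn_ord.
have [||c cE] := @seq_system _ (11 - p) fs.
- case=> [] [|[|[|[|[|[|k]]]]]] kp; try exact: lin_linear.
    by apply: cof_linear; case: ps => ->.
  rewrite [val _]/= -[k.+4.+2]/(6 + k)%N nE; last by case: ps kp => ->; lia.
  by apply: cof_linear.
- move=> c H; apply: normal_unisolvent => //.
  + apply: vanish; first by apply: (H 5%N); exact: low.
    by move=> k /andP[_ kp]; exact: H.
  + by apply: (H 0%N); exact: low.
  + by apply: (H 1%N); exact: low.
  + by apply: (H 2%N); exact: low.
  + by apply: (H 3%N); exact: low.
  + by apply: (H 4%N); exact: low.
- exists c.
    apply: vanish; first by apply: (cE 5%N); exact: low.
    move=> k /andP[k6 kp]; rewrite cE // -(subnKC k6) nE //.
    by case: ps kp k6 => ->; lia.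
  split.
  + by apply: (cE 0%N); exact: low.
  + by apply: (cE 1%N); exact: low.
  + by apply: (cE 2%N); exact: low.
  + by apply: (cE 3%N); exact: low.
  + by apply: (cE 4%N); exact: low.
Qed.

End Interpolation.

(** * Operations on splines: differentiation, reflection, affine factors *)

Section SplineClosure.
Variables (R : realType) (p : nat).
Hypothesis hp : p \in [:: 3; 4; 5]%N.
Local Notation rV := 'rV[R]_(11 - p).
Local Notation I01 := (`[0, 1]%classic : set R).

Let pb : (2 < p < 6)%N.
Proof. by move: hp; rewrite !inE => /or3P[] /eqP ->. Qed.

Lemma wder_unique (f : R^o -> R^o) (x l l' : R) : 0 <= x <= 1 ->
  wder I01 f x 1 l -> wder I01 f x 1 l' -> l = l'.
Proof.
move=> x01 W W0.
have PF : ProperFilter (within (fun h : R => I01 (h *: (1 : R^o) + x)) (0 : R)^').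
  have H (e : R) : 0 < e -> exists2 h : R, h != 0 & `|h| < e /\ 0 <= h + x <= 1.
    move=> e0; have [x2|x2] := leP x (1 / 2).
      exists (Num.min (e / 2) (1 / 2)).
        by rewrite gt_eqF // lt_min; apply/andP; split; lra.
      rewrite gtr0_norm; last by rewrite lt_min; apply/andP; split; lra.
      move: (ge_min (e/2) (e / 2) (1 / 2)) (ge_min (1/2) (e / 2) (1 / 2)).
      rewrite !lexx /= orbT => a b; split; first by lra.
      have : 0 < Num.min (e / 2) (1 / 2) by rewrite lt_min; apply/andP; split; lra.
      by move=> c; apply/andP; split; lra.
    exists (- Num.min (e / 2) (1 / 2)).
      by rewrite oppr_eq0 gt_eqF // lt_min; apply/andP; split; lra.
    have c : 0 < Num.min (e / 2) (1 / 2) by rewrite lt_min; apply/andP; split; lra.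
    rewrite normrN gtr0_norm //.
    move: (ge_min (e/2) (e / 2) (1 / 2)) (ge_min (1/2) (e / 2) (1 / 2)).
    rewrite !lexx /= orbT => a b; split; first by lra.
    by apply/andP; split; lra.
  apply: Build_ProperFilter_ex => P; rewrite /within /= /dnbhs /within /= => /nbhs_ballP[e /= e0 B].
  have [h h0 [he hx]] := H e e0; exists h; apply: (B h) => //.
    by rewrite /ball /= sub0r normrN.
  by apply/segment01P; rewrite /= [h *: _]mulr1.
by apply: (cvg_unique _ W W0); exact: norm_hausdorff.
Qed.

(** Even at an end the derivative is determined by the values on the inner side. Identities known
    only on [0, 1] can therefore be differentiated there, ends included. *)
Lemma derive_vanish (f : R^o -> R^o) (x d : R) : 0 <= x <= 1 ->
  (forall y : R, 0 <= y <= 1 -> f y = 0) -> is_derive (x : R^o) 1 f d -> d = 0.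
Proof.
move=> x01 f0 df; apply: (@wder_unique f x) => //; first exact: is_derive_wder.
apply: (@wder_eq _ _ _ (fun=> 0)); last exact: wder_cst.
  by move=> y /segment01P /f0 ->.
exact/segment01P.
Qed.

Lemma sample_in01 j : (j < 11 - p)%N -> 0 < (j.+1%:R / (12 - p)%:R : R) < 1.
Proof.
move=> jp; rewrite divr_gt0 ?ltr0n //=; last by lia.
by rewrite ltr_pdivrMr ?mul1r ?ltr_nat ?ltr0n; lia.
Qed.

Lemma lin_inj (c c' : rV) : (forall y, 0 < y < 1 -> lin 0 c y = lin 0 c' y) -> c = c'.
Proof.
move=> H; apply/eqP; rewrite -subr_eq0; apply/eqP.
apply: points_unisolvent => // j jp.
by rewrite linB H ?subrr //; exact: sample_in01.
Qed.

Lemma end_notin_knots (x : R) : x = 0 \/ x = 1 -> x \notin knots R p.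
Proof.
by move=> [] ->; apply/negP => /(knots01 hp) /andP[]; rewrite ltxx.
Qed.

Lemma breakpt_rev j : (j <= 6 - p)%N -> breakpt R p (6 - p - j) = 1 - breakpt R p j.
Proof.
move=> jp; rewrite /breakpt natrB // mulrBl divff // gt_eqF //.
by rewrite ltr0n; have := pb; lia.
Qed.

(** A reflected truncated power is not a truncated power, so the coefficients are not computed: the
    breakpoints are symmetric about 1/2 and [pieces_inspan] applies to the reflected function. *)
Lemma inspan_reflect d m (h : R -> R) : (d <= p)%N -> (p <= m.+2)%N ->
  inspan p (smooth_span d m) I01 h -> inspan p (smooth_span d m) I01 (fun t => h (1 - t)).
Proof.
move=> dp pm [c cQ cE].
have rev01 t : I01 t -> I01 (1 - t).
  by move=> /segment01P H; apply/segment01P; move/andP: H => [? ?]; apply/andP; split; lra.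
apply: (@inspan_eq _ _ _ _ (fun t => lin 0 c (1 - t))) => [t /rev01 /cE //|].
apply: pieces_inspan => //.
- by move=> t /segment01o /andP[? ?]; apply/segment01P; apply/andP; split; lra.
- move=> j jp.
  have [||q [sq qE]] := @lin_piece R p hp (smooth_span d m) d c (6 - p - j.+1) cQ _ _.
  + by move=> b /andP[].
  + by have := pb; lia.
  exists (q \Po (1%:P - 'X)); split.
    have s2 : size (1%:P - 'X : {poly R}) = 2%N.
      by rewrite -opprB size_polyN size_XsubC.
    by rewrite size_comp_poly2.
  move=> t [_]; rewrite /piece /= in_itv /= => /andP[jt tj].
  rewrite horner_comp !hornerE -qE // /piece /= in_itv /=.
  rewrite -subSn // subSS !breakpt_rev //; last exact: ltnW.
  by apply/andP; split; lra.
- move=> _; have oI : open (`]0, 1[%classic : set R^o) by exact: itv_open.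
  have C : Ck m (`]0, 1[%classic : set R^o) (lin 0 c : R^o -> R^o).
    by apply: (@Ck_lin R p (smooth_span d m)) => // b /andP[].
  apply: (@Ck_line m R R^o R^o _ _ _ (fun t => 1 - t) (fun t => - t) oI _ _ _ C).
  + by move=> t /segment01o /andP[? ?]; apply/segment01o; apply/andP; split; lra.
  + by move=> x u h0 /=; rewrite -![_ *: _]/(_ * _); ring.
  + by move=> t; apply: continuousB; [exact: cst_continuous|exact: cvg_id].
Qed.

(** Along a side the Jacobian and the coefficients of direction fields are affine; such a factor
    raises the degree by one and keeps the class. *)
Lemma inspan_affine (a b : R) (h : R -> R) :
  inspan p (smooth_span p.-1 p.-2) I01 h ->
  inspan p (smooth_span p p.-2) I01 (fun t => (a * t + b) * h t).
Proof.
move=> [c cQ cE].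
apply: (@inspan_eq _ _ _ _ (fun t => (a * t + b) * lin 0 c t)) => [t /cE -> //|].
apply: pieces_inspan => //; try lia.
- by move=> t /segment01o /andP[? ?]; apply/segment01P; apply/andP; split; lra.
- move=> j jp.
  have [|q [sq qE]] := @lin_piece R p hp _ p.-1 c j cQ _ jp; first by move=> ? /andP[].
  exists ((a *: 'X + b%:P) * q); split; last first.
    by move=> t [_ jt]; rewrite !hornerE qE.
  have s2 : (size ((a *: 'X + b%:P)%R : {poly R}) <= 2)%N.
    apply: leq_trans (size_polyD _ _) _; rewrite geq_max; apply/andP; split.
      by apply: leq_trans (size_scale_leq _ _) _; rewrite size_polyX.
    by apply: leq_trans (size_polyC_leq1 _) _.
  apply: leq_trans (size_polyMleq _ _) _; lia.
- move=> _; have oI : open (`]0, 1[%classic : set R^o) by exact: itv_open.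
  apply: CkM => //; last first.
    by apply: (@Ck_lin R p (smooth_span p.-1 p.-2)) => // ? /andP[].
  apply: CkD => //; last exact: Ck_cst.
  apply: CkM => //; first exact: Ck_cst.
  exact: (Ck_sub _ (@Ck_id R _)).
Qed.

(** Tangential derivatives of traces thus lie in the same spline space as normal derivatives.
    Termwise, degree and smoothness both drop by one. *)
Lemma inspan_derive (c : rV) : (forall i, ~~ smooth_span p p.-1 (basi R i) -> c 0 i = 0) ->
  inspan p (smooth_span p.-1 p.-2) I01 (lin 1 c).
Proof.
move=> cQ; rewrite /lin.
suff H i : inspan p (smooth_span p.-1 p.-2) I01 (fun t => c 0 i * dtp 1 (basi R i) t).
  have := @inspan_sum R p (smooth_span p.-1 p.-2) I01 _ (index_enum 'I_(11 - p)) _ (fun i _ => H i).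
  by [].
have [Qi|/cQ ->] := boolP (smooth_span p p.-1 (basi R i)); last first.
  by under [X in inspan _ _ _ X]eq_fun do rewrite mul0r; exact: inspan0.
apply: inspanZ; rewrite /dtp; apply: inspanZ.
move: Qi; rewrite /smooth_span.
case E : (basi R i) => [k n] /= /andP[np H].
have [l El] : exists l, basi R (p := p) l = (k, n - 1)%N.
  case: (basiP R hp i); rewrite E /=; first by move=> [-> _]; apply: mono_in_bas => //; lia.
  move=> [kk nn]; apply: (knot_in_bas hp kk).
  case/orP: H => [/eqP k1|]; last by lia.
  by have := knots01 hp kk; rewrite k1; lra.
have := @inspan_basi R p (smooth_span p.-1 p.-2) I01 l; rewrite El /=; apply.
rewrite /smooth_span /=; apply/andP; split; first by lia.
by case/orP: H => [->//|H]; apply/orP; right; lia.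
Qed.

End SplineClosure.

(** * Geometry of the bilinear parametrization *)

Section Geometry.
Variable R : realType.
Implicit Types (u v w x y : plane R) (s t : R).

Definition crs u v : R := u 0 0 * v 0 1 - u 0 1 * v 0 0.

Lemma plane_eqP x y : x 0 0 = y 0 0 -> x 0 1 = y 0 1 -> x = y.
Proof.
move=> H0 H1; apply/rowP => -[[|[|//]] k].
- by rewrite (_ : Ordinal k = 0) //; exact: val_inj.
- by rewrite (_ : Ordinal k = 1) //; exact: val_inj.
Qed.

Lemma crsDl u v w : crs (u + v) w = crs u w + crs v w.
Proof. by rewrite /crs !mxE; ring. Qed.

Lemma crsDr u v w : crs w (u + v) = crs w u + crs w v.
Proof. by rewrite /crs !mxE; ring. Qed.

Lemma crsZl a u w : crs (a *: u) w = a * crs u w.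
Proof. by rewrite /crs !mxE; ring. Qed.

Lemma crsZr a u w : crs w (a *: u) = a * crs w u.
Proof. by rewrite /crs !mxE; ring. Qed.

Lemma crsvv u : crs u u = 0.
Proof. by rewrite /crs; ring. Qed.

Lemma coord_continuous (i : 'I_2) : continuous (fun x : plane R => x 0 i : R^o).
Proof. exact: coord_continuous. Qed.

Lemma parallelE u v w : crs u v = 0 -> crs u w != 0 -> v = (crs v w / crs u w) *: u.
Proof.
move=> uv uw; apply: plane_eqP; rewrite [RHS]mxE; apply: (mulIf uw).
  rewrite mulrAC divfK //; apply/eqP; rewrite -subr_eq0.
  have -> : v 0 0 * crs u w - crs v w * u 0 0 = w 0 0 * crs u v by rewrite /crs; ring.
  by rewrite uv mulr0.
rewrite mulrAC divfK //; apply/eqP; rewrite -subr_eq0.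
have -> : v 0 1 * crs u w - crs v w * u 0 1 = w 0 1 * crs u v by rewrite /crs; ring.
by rewrite uv mulr0.
Qed.

Variable c : 'I_4 -> plane R.

(** [e1] and [e2] are the partial derivatives of [bilin c], each a function of the other coordinate
    only, and [jac] is the Jacobian determinant. *)
Definition e1 t : plane R := (1 - t) *: (c 1 - c 0) + t *: (c 2 - c 3).
Definition e2 s : plane R := (1 - s) *: (c 3 - c 0) + s *: (c 2 - c 1).
Definition jac s t : R := crs (e1 t) (e2 s).

(** An increment without remainder: move along the first coordinate at height [xi.2], then along the
    second at abscissa [eta.1]. *)
Lemma bilinB (xi eta : R * R) : bilin c eta - bilin c xi =
  (eta.1 - xi.1) *: e1 xi.2 + (eta.2 - xi.2) *: e2 eta.1.
Proof. by apply: plane_eqP; rewrite /bilin /e1 /e2 !mxE; ring. Qed.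

Lemma crs_e2 u s : crs u (e2 s) = (1 - s) * crs u (e2 0) + s * crs u (e2 1).
Proof. by rewrite /e2 /crs !mxE; ring. Qed.

Lemma crs_e1 u t : crs (e1 t) u = (1 - t) * crs (e1 0) u + t * crs (e1 1) u.
Proof. by rewrite /e1 /crs !mxE; ring. Qed.

Lemma jacE s t : jac s t = (1 - t) * ((1 - s) * jac 0 0 + s * jac 1 0)
  + t * ((1 - s) * jac 0 1 + s * jac 1 1).
Proof. by rewrite /jac /e1 /e2 /crs !mxE; ring. Qed.

Lemma orient_continuous a b : continuous (orient a b : plane R -> R^o).
Proof.
move=> y; have X j : {for y, continuous (fun z : plane R => z 0 j - a 0 j : R)}.
  exact: (continuousB (@coord_continuous j y) (@cst_continuous _ _ (a 0 j) y)).
have K r : {for y, continuous (fun=> r : R)} by exact: cst_continuous.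
exact: (continuousB (continuousM (K _) (X 1)) (continuousM (K _) (X 0))).
Qed.

Lemma orient_crs a b x : orient a b x = crs (b - a) (x - a).
Proof. by rewrite /orient /crs !mxE. Qed.

Definition unit_square (xi : R * R) : Prop := 0 <= xi.1 <= 1 /\ 0 <= xi.2 <= 1.
Definition open_square (xi : R * R) : Prop := 0 < xi.1 < 1 /\ 0 < xi.2 < 1.

Lemma open_squareW xi : open_square xi -> unit_square xi.
Proof. by move=> [/andP[? ?] /andP[? ?]]; split; apply/andP; split; exact: ltW. Qed.

Lemma ord4 (P : 'I_4 -> Prop) : P 0 -> P 1 -> P 2 -> P 3 -> forall i, P i.
Proof.
move=> p0 p1 p2 p3 [[|[|[|[|//]]]] k].
- by rewrite (_ : Ordinal k = 0) //; exact: val_inj.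
- by rewrite (_ : Ordinal k = 1) //; exact: val_inj.
- by rewrite (_ : Ordinal k = 2) //; exact: val_inj.
- by rewrite (_ : Ordinal k = 3) //; exact: val_inj.
Qed.

Lemma ord4_next : [/\ 0 + 1 = 1 :> 'I_4, 1 + 1 = 2 :> 'I_4, 2 + 1 = 3 :> 'I_4 & 3 + 1 = 0 :> 'I_4].
Proof. by split; apply: val_inj. Qed.

(** Each half-plane condition splits off one reference coordinate (or its complement to 1) times a
    Jacobian value on a side of the square; for a point of the square its sign is that of the
    coordinate factor. *)
Lemma orient_bilin (xi : R * R) :
  [/\ orient (c 0) (c (0 + 1)) (bilin c xi) = xi.2 * jac xi.1 0,
      orient (c 1) (c (1 + 1)) (bilin c xi) = (1 - xi.1) * jac 1 xi.2,
      orient (c 2) (c (2 + 1)) (bilin c xi) = (1 - xi.2) * jac xi.1 1 &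
      orient (c 3) (c (3 + 1)) (bilin c xi) = xi.1 * jac 0 xi.2].
Proof.
have [-> -> -> ->] := ord4_next.
by split; rewrite /orient /jac /bilin /e1 /e2 /crs !mxE; ring.
Qed.

Hypothesis hc : ccw_convex c.

Lemma jac_corner : [/\ 0 < jac 0 0, 0 < jac 1 0, 0 < jac 0 1 & 0 < jac 1 1].
Proof.
have [n0 n1 n2 n3] := ord4_next.
have h0 := hc (i := 0) (k := 3) isT isT; have h1 := hc (i := 0) (k := 2) isT isT.
have h2 := hc (i := 2) (k := 0) isT isT; have h3 := hc (i := 1) (k := 3) isT isT.
rewrite n0 /orient in h0; rewrite n0 /orient in h1; rewrite n2 /orient in h2; rewrite n1 /orient in h3.
split; rewrite /jac /e1 /e2 /crs !mxE ?subr0 ?subrr; lra.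
Qed.

Definition jac_min : R := Num.min (Num.min (jac 0 0) (jac 1 0)) (Num.min (jac 0 1) (jac 1 1)).

Lemma jac_min_gt0 : 0 < jac_min.
Proof. by have [? ? ? ?] := jac_corner; rewrite /jac_min !lt_min; apply/andP; split; apply/andP. Qed.

(** The Jacobian is affine in each variable, so on the square it is bounded below by its corner
    values, which are twice the areas of triangles of consecutive vertices. *)
Lemma jac_ge s t : 0 <= s <= 1 -> 0 <= t <= 1 -> jac_min <= jac s t.
Proof.
move=> /andP[s0 s1] /andP[t0 t1]; rewrite jacE.
have [m0 m1 m2 m3] : [/\ jac_min <= jac 0 0, jac_min <= jac 1 0, jac_min <= jac 0 1 & jac_min <= jac 1 1].
  by rewrite /jac_min !ge_min !lexx !orbT.
have H (a b r : R) : 0 <= r -> r <= 1 -> jac_min <= a -> jac_min <= b -> jac_min <= (1 - r) * a + r * b.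
  by move=> *; nra.
by apply: (H) => //; apply: (H).
Qed.

Lemma jac_gt0 s t : 0 <= s <= 1 -> 0 <= t <= 1 -> 0 < jac s t.
Proof. by move=> hs ht; apply: lt_le_trans jac_min_gt0 _; exact: jac_ge. Qed.

Lemma bilin_inj xi eta : unit_square xi -> unit_square eta ->
  bilin c xi = bilin c eta -> xi = eta.
Proof.
move=> [x1 x2] [y1 y2] E; have := bilinB xi eta; rewrite E subrr => D.
have j0 := jac_gt0 y1 x2.
have D1 : (eta.1 - xi.1) * jac eta.1 xi.2 = 0.
  by have := congr1 (fun w => crs w (e2 eta.1)) D; rewrite crsDl !crsZl crsvv mulr0 addr0 {1}/crs !mxE !mul0r subrr.
have D2 : (eta.2 - xi.2) * jac eta.1 xi.2 = 0.
  by have := congr1 (fun w => crs (e1 xi.2) w) D; rewrite crsDr !crsZr crsvv mulr0 add0r {1}/crs !mxE !mulr0 subrr.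
move/eqP: D1; move/eqP: D2; rewrite !mulf_eq0 !(gt_eqF j0) !orbF !subr_eq0.
by case: xi {E D x1 x2 j0} => a b; case: eta {y1 y2} => a' b' /= /eqP -> /eqP ->.
Qed.

(** Sweep the quadrilateral by the segments from [A s] in direction [e1 s]. The quadratic [q], which
    measures on which side of the swept line [x] lies, changes sign between 0 and 1, so some line
    contains [x]; the two remaining half-plane conditions place [x] between the ends of its
    segment. *)
Lemma bilin_surj x : (forall i, 0 <= orient (c i) (c (i + 1)) x) ->
  exists2 xi, unit_square xi & bilin c xi = x.
Proof.
move=> H; have [n0 n1 n2 n3] := ord4_next.
have h0 := H 0; have h1 := H 1; have h2 := H 2; have h3 := H 3.
rewrite n0 in h0; rewrite n1 in h1; rewrite n2 in h2; rewrite n3 in h3.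
pose A s := (1 - s) *: c 0 + s *: c 3.
pose q : {poly R} := (crs (e1 0) (x - c 0))%:P
  + (crs (e1 1 - e1 0) (x - c 0) - crs (e1 0) (c 3 - c 0)) *: 'X
  - (crs (e1 1 - e1 0) (c 3 - c 0)) *: 'X^2.
have qE s : q.[s] = crs (e1 s) (x - A s).
  rewrite /q hornerD hornerN hornerD hornerC !hornerZ hornerXn hornerX.
  by rewrite /A /e1 /crs !mxE; ring.
have [|s s01'] := @poly_ivt R (- q) 0 1 ler01.
  rewrite !hornerN !qE; apply/andP; split.
    have -> : crs (e1 0) (x - A 0) = orient (c 0) (c 1) x by rewrite orient_crs /A /e1 /crs !mxE; ring.
    by rewrite oppr_le0.
  have -> : crs (e1 1) (x - A 1) = - orient (c 2) (c 3) x by rewrite orient_crs /A /e1 /crs !mxE; ring.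
  by rewrite opprK.
rewrite rootN => /eqP; rewrite qE => rt.
have j0 : 0 < jac 0 s by apply: jac_gt0; rewrite // lexx ler01.
have j1 : 0 < jac 1 s by apply: jac_gt0; rewrite // lexx ler01.
pose t := crs (x - A s) (e2 0) / jac 0 s.
have xE : x - A s = t *: e1 s by apply: parallelE => //; rewrite gt_eqF.
have E3 : orient (c 3) (c 0) x = t * jac 0 s.
  rewrite orient_crs -[x](subrK (A s)) xE /jac /A /e1 /e2 /crs !mxE; ring.
have E1 : orient (c 1) (c 2) x = (1 - t) * jac 1 s.
  rewrite orient_crs -[x](subrK (A s)) xE /jac /A /e1 /e2 /crs !mxE; ring.
exists (t, s); last first.
  by rewrite -[x](subrK (A s)) xE; apply: plane_eqP; rewrite /bilin /A /e1 !mxE /=; ring.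
split=> //=; apply/andP; split.
  by rewrite -(pmulr_lge0 _ j0) -E3.
by rewrite -subr_ge0 -(pmulr_lge0 _ j1) -E1.
Qed.

Lemma open_quadP x : open_quad c x <-> exists2 xi, open_square xi & bilin c xi = x.
Proof.
have I01 : (0 <= (0 : R) <= 1) /\ (0 <= (1 : R) <= 1) by rewrite !lexx ler01.
split=> [H|[xi o <-]].
  have [i|xi [x1 x2] E] := @bilin_surj x; first exact: ltW.
  exists xi => //; have [r0 r1 r2 r3] := orient_bilin xi.
  have := H 3; have := H 2; have := H 1; have := H 0.
  rewrite -E r0 r1 r2 r3.
  rewrite !pmulr_lgt0 ?jac_gt0 ?I01.1 ?I01.2 // !subr_gt0 => ? ? ? ?.
  by split; apply/andP.
have [[x1 x2] [/andP[? ?] /andP[? ?]]] := (open_squareW o, o).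
have [r0 r1 r2 r3] := orient_bilin xi.
have [i01 i11] := I01.
rewrite /open_quad /=; apply: ord4; rewrite ?r0 ?r1 ?r2 ?r3.
all: apply: mulr_gt0; by [|rewrite subr_gt0|exact: jac_gt0].
Qed.

Lemma bilin_continuous : continuous (bilin c : R * R -> plane R).
Proof.
move=> xi; rewrite /bilin.
have f1 : {for xi, continuous (fst : R * R -> R)} by exact: cvg_fst.
have f2 : {for xi, continuous (snd : R * R -> R)} by exact: cvg_snd.
have k : {for xi, continuous (fun=> 1 : R)} by exact: cst_continuous.
have k1 := continuousB k f1; have k2 := continuousB k f2.
have Z (f : R * R -> R) (v : plane R) : {for xi, continuous f} ->
    {for xi, continuous (fun z : R * R => f z *: v)}.
  by move=> cf; apply: cvgZr_tmp.
exact: (continuousD (continuousD (continuousD (Z _ (c 0) (continuousM k1 k2))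
  (Z _ (c 1) (continuousM f1 k2))) (Z _ (c 2) (continuousM f1 f2))) (Z _ (c 3) (continuousM k1 f2))).
Qed.

Lemma closure_quad : closure (open_quad c) = [set bilin c xi | xi in unit_square].
Proof.
apply/seteqP; split=> [x cx|_ [xi hxi <-]].
  have cl : closed [set y : plane R | forall i, 0 <= orient (c i) (c (i + 1)) y].
    have -> : [set y : plane R | forall i, 0 <= orient (c i) (c (i + 1)) y] =
       \bigcap_(i in [set: 'I_4]) [set y | 0 <= orient (c i) (c (i + 1)) y].
      by apply/seteqP; split=> y /= H i; [move=> _; exact: H|exact: H].
    apply: closed_bigI => i _.
    exact: (closed_comp (fun y _ => @orient_continuous (c i) (c (i + 1)) y) (@closed_ge R 0)).
  have /bilin_surj[xi hxi E] : [set y | forall i, 0 <= orient (c i) (c (i + 1)) y] x.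
    move: cx; rewrite closureE; apply; split=> // y H i /=; exact/ltW/H.
  by exists xi.
move=> U nU.
(* [g] moves [xi] towards the centre of the square, into its interior as soon as [0 < t <= 1]. *)
pose g (t : R) : R * R := (xi.1 + t * (1 / 2 - xi.1), xi.2 + t * (1 / 2 - xi.2)).
have cg : {for 0, continuous g}.
  have cf (a b : R) : {for 0, continuous (fun t : R => a + t * b : R)}.
    exact: (continuousD (@cst_continuous _ _ a 0)
      (continuousM (@cvg_id _ (nbhs 0)) (@cst_continuous _ _ b 0))).
  exact: (cvg_pair (cf _ _) (cf _ _)).
have : {for 0, continuous (bilin c \o g)} by apply: continuous_comp => //; exact: bilin_continuous.
have g0 : g 0 = xi by rewrite /g !mul0r !addr0 -surjective_pairing.
move=> cbg; have N : nbhs (0 : R) ((bilin c \o g) @^-1` U) by apply: cbg; rewrite /= g0.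
have [t [Ut t0 t1]] : exists t : R, [/\ U (bilin c (g t)), 0 < t & t <= 1].
  have := @nbhs_right_gt R 0; have := @nbhs_right_le R 0 1 ltr01 => a b.
  near (0 : R)^'+ => t; exists t; split; near: t => //.
  exact: (cvg_at_right_filter (f := id) _ N).
exists (bilin c (g t)); split => //; apply/open_quadP; exists (g t) => //.
have [/andP[? ?] /andP[? ?]] := hxi.
by split; apply/andP; split; rewrite /g /=; nra.
Unshelve. all: by end_near. Qed.

End Geometry.

(** * The inverse of the bilinear parametrization *)

Section InverseMap.
Variables (R : realType) (c : 'I_4 -> plane R).
Hypothesis hc : ccw_convex c.
Local Notation cl := (closure (open_quad c)).

Definition inv_map (x : plane R) : R * R :=
  xget (0, 0) [set xi | unit_square xi /\ bilin c xi = x].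
Local Notation G := inv_map.

Lemma inv_mapP x : cl x -> unit_square (G x) /\ bilin c (G x) = x.
Proof.
rewrite closure_quad // => -[xi hxi E]; rewrite /G.
by case: xgetP => [y -> //|/(_ xi)] /=; case.
Qed.

Lemma bilin_closure xi : unit_square xi -> cl (bilin c xi).
Proof. by move=> hxi; rewrite closure_quad //; exists xi. Qed.

Lemma inv_mapK xi : unit_square xi -> G (bilin c xi) = xi.
Proof.
by move=> hxi; have [u E] := inv_mapP (bilin_closure hxi); exact: (bilin_inj hc).
Qed.

Lemma open_inv_map x : open_quad c x -> open_square (G x).
Proof.
move=> /(open_quadP hc)[xi o <-]; rewrite inv_mapK //; exact: open_squareW.
Qed.

Lemma open_open_quad : open (open_quad c).
Proof.
pose A i := [set y : plane R | 0 < orient (c i) (c (i + 1)) y].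
have oA i : open (A i).
  exact: (open_comp (fun y _ => @orient_continuous _ (c i) (c (i + 1)) y) (@open_gt R 0)).
have -> : open_quad c = A 0 `&` A 1 `&` A 2 `&` A 3.
  apply/seteqP; split=> [y H|y [[[a0 a1] a2] a3]]; first by do ![split]; exact: H.
  by rewrite /open_quad /=; apply: ord4.
by do ![apply: openI].
Qed.

(** The cross product of [bilinB] with [e2] removes one of its two terms. The Jacobian appears at
    the mixed point [((G y).1, (G x).2)], still in the square and so positive there. *)
Lemma inv_map_sub1 x y : cl x -> cl y ->
  (G y).1 - (G x).1 = crs (y - x) (e2 c (G y).1) / jac c (G y).1 (G x).2.
Proof.
move=> /inv_mapP[[x1 x2] Ex] /inv_mapP[[y1 y2] Ey].
have -> : y - x = bilin c (G y) - bilin c (G x) by rewrite Ex Ey.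
rewrite bilinB crsDl !crsZl crsvv mulr0 addr0 mulfK //.
by rewrite gt_eqF //; apply: jac_gt0.
Qed.

Lemma inv_map_sub2 x y : cl x -> cl y ->
  (G y).2 - (G x).2 = crs (e1 c (G x).2) (y - x) / jac c (G y).1 (G x).2.
Proof.
move=> /inv_mapP[[x1 x2] Ex] /inv_mapP[[y1 y2] Ey].
have -> : y - x = bilin c (G y) - bilin c (G x) by rewrite Ex Ey.
rewrite bilinB crsDr !crsZr crsvv mulr0 add0r mulfK //.
by rewrite gt_eqF //; apply: jac_gt0.
Qed.

(** Shaped for the coordinates of the inverse map: the numerators of their increments are convex
    combinations of two cross products with [y - x], and their denominators are at least
    [jac_min c]. *)
Lemma cvg_crs_bound (f : plane R -> R) (x a b : plane R) :
  (forall y, cl y -> `|f y - f x| <= (`|crs (y - x) a| + `|crs (y - x) b|) / jac_min c) ->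
  f y @[y --> within cl (nbhs x)] --> f x.
Proof.
move=> H; have m0 := jac_min_gt0 hc.
have ccrs u : (fun y => crs (y - x) u) @ nbhs x --> (0 : R).
  have X j : {for x, continuous (fun z : plane R => z 0 j - x 0 j : R)}.
    exact: (continuousB (@coord_continuous _ j x) (@cst_continuous _ _ (x 0 j) x)).
  have K (r : R) : {for x, continuous (fun z : plane R => r)} by exact: cst_continuous.
  have W : {for x, continuous (fun z : plane R => (z 0 0 - x 0 0) * u 0 1 - (z 0 1 - x 0 1) * u 0 0 : R)}.
    exact: (continuousB (continuousM (X 0) (K _)) (continuousM (X 1) (K _))).
  have : (fun z : plane R => (z 0 0 - x 0 0) * u 0 1 - (z 0 1 - x 0 1) * u 0 0) @ nbhs x --> (0 : R).
    by have : (x 0 0 - x 0 0) * u 0 1 - (x 0 1 - x 0 1) * u 0 0 = 0 :> R;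
      [rewrite !subrr !mul0r subrr|move=> <-; exact: W].
  by apply: cvg_ext; near=> y; rewrite /crs !mxE.
pose g y := (`|crs (y - x) a| + `|crs (y - x) b|) / jac_min c.
have cb : g y @[y --> within cl (nbhs x)] --> (0 : R).
  apply: cvg_within_filter.
  have : g y @[y --> nbhs x] --> (`|0 : R| + `|0 : R|) / jac_min c.
    by apply: cvgMr_tmp; apply: cvgD; apply: cvg_norm.
  by rewrite !normr0 addr0 mul0r.
apply/cvgrPdist_lt => e e0; move/cvgrPdist_lt: cb => /(_ e e0).
rewrite /= !near_withinE; apply: filterS => y Hy cly; have := Hy cly.
rewrite sub0r normrN distrC; apply: le_lt_trans.
by apply: le_trans (H y cly) _; exact: ler_norm.
Unshelve. all: by end_near. Qed.

Lemma convex_norm_le (t a b m j : R) : 0 <= t <= 1 -> 0 < m -> m <= j ->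
  `|((1 - t) * a + t * b) / j| <= (`|a| + `|b|) / m.
Proof.
move=> /andP[t0 t1] m0 mj; rewrite normrM ler_pM //.
  apply: le_trans (ler_normD _ _) _; rewrite !normrM.
  rewrite (@ger0_norm _ (1 - t)) ?subr_ge0 // (@ger0_norm _ t) //.
  by apply: lerD; apply: ler_piMl => //; lra.
have j0 : 0 < j by exact: lt_le_trans m0 mj.
by rewrite ger0_norm; [rewrite lef_pV2 // posrE|rewrite invr_ge0 ltW].
Qed.

Lemma inv_map_cvg1 x : cl x -> (G y).1 @[y --> within cl (nbhs x)] --> (G x).1.
Proof.
move=> clx; apply: (@cvg_crs_bound (fun y => (G y).1) x (e2 c 0) (e2 c 1)) => y cly.
rewrite inv_map_sub1 // crs_e2.
have [[y1 y2] Ey] := inv_mapP cly; have [[x1 x2] Ex] := inv_mapP clx.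
by apply: convex_norm_le => //; [exact: jac_min_gt0|exact: jac_ge].
Qed.

Lemma inv_map_cvg2 x : cl x -> (G y).2 @[y --> within cl (nbhs x)] --> (G x).2.
Proof.
move=> clx; apply: (@cvg_crs_bound (fun y => (G y).2) x (e1 c 0) (e1 c 1)) => y cly.
rewrite inv_map_sub2 // crs_e1.
have [[y1 y2] Ey] := inv_mapP cly; have [[x1 x2] Ex] := inv_mapP clx.
have N u v : `|crs u v| = `|crs v u|.
  by rewrite -normrN; congr `|_|; rewrite /crs; ring.
rewrite (N R (y - x) (e1 c 0)) (N R (y - x) (e1 c 1)).
by apply: convex_norm_le => //; [exact: jac_min_gt0|exact: jac_ge].
Qed.

Lemma within_line x u :
  (fun h : R => h *: u + x) @ within (fun h => cl (h *: u + x)) (0:R)^' --> within cl (nbhs x).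
Proof.
move=> P nP; exact: (@line_cvg _ _ x u _ nP).
Qed.

Lemma crs_e2_cvg (T : Type) (F : set_system T) {FF : Filter F} (f : T -> R) s v :
  f @ F --> s -> crs v (e2 c (f h)) @[h --> F] --> crs v (e2 c s).
Proof.
move=> fs; rewrite crs_e2.
apply: (cvg_ext (f := fun h => (1 - f h) * crs v (e2 c 0) + f h * crs v (e2 c 1))).
  by near=> h; rewrite [RHS]crs_e2.
by apply: cvgD; apply: cvgM => //; try exact: cvg_cst; apply: cvgB => //; exact: cvg_cst.
Unshelve. all: by end_near. Qed.

Lemma crs_e1_cvg (T : Type) (F : set_system T) {FF : Filter F} (f : T -> R) s v :
  f @ F --> s -> crs (e1 c (f h)) v @[h --> F] --> crs (e1 c s) v.
Proof.
move=> fs; rewrite crs_e1.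
apply: (cvg_ext (f := fun h => (1 - f h) * crs (e1 c 0) v + f h * crs (e1 c 1) v)).
  by near=> h; rewrite [RHS]crs_e1.
by apply: cvgD; apply: cvgM => //; try exact: cvg_cst; apply: cvgB => //; exact: cvg_cst.
Unshelve. all: by end_near. Qed.

(** The difference quotients are exact expressions in [(G (h *: u + x)).1] alone, so continuity of
    the first coordinate gives both limits, at boundary points too. *)
Lemma wder_inv_map x u : cl x ->
  wder cl (fun y => (G y).1) x u (crs u (e2 c (G x).1) / jac c (G x).1 (G x).2) /\
  wder cl (fun y => (G y).2) x u (crs (e1 c (G x).2) u / jac c (G x).1 (G x).2).
Proof.
move=> clx; have [[x1 x2] Ex] := inv_mapP clx.
have L1 := cvg_comp _ _ (@within_line x u) (inv_map_cvg1 clx).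
have J0 : jac c (G x).1 (G x).2 != 0 by rewrite gt_eqF // jac_gt0.
have CJ : (fun h : R => (crs (e1 c (G x).2) (e2 c (G (h *: u + x)).1))^-1)
    @ within (fun h => cl (h *: u + x)) (0 : R)^' --> (jac c (G x).1 (G x).2)^-1.
  by apply: cvgV => //; exact: crs_e2_cvg L1.
have nz (h : R) : cl (h *: u + x) -> h != 0 ->
    (h != 0) && (crs (e1 c (G x).2) (e2 c (G (h *: u + x)).1) != 0).
  move=> hc' ->; rewrite gt_eqF //; have [[y1 y2] _] := inv_mapP hc'.
  exact: (jac_gt0 hc y1 x2).
split; rewrite /wder.
  have C1 : (fun h : R => crs u (e2 c (G (h *: u + x)).1) * (crs (e1 c (G x).2) (e2 c (G (h *: u + x)).1))^-1)
      @ within (fun h => cl (h *: u + x)) (0 : R)^' --> crs u (e2 c (G x).1) / jac c (G x).1 (G x).2.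
    by apply: cvgM => //; exact: crs_e2_cvg L1.
  apply: cvg_ext C1; near=> h.
  have hc' : cl (h *: u + x) by near: h; exact: withinT.
  have h0 : h != 0 by near: h; rewrite near_withinE; near=> k => _; near: k; exact: nbhs_dnbhs_neq.
  rewrite inv_map_sub1 // addrK crsZl; rewrite -[LHS]/(_ * _^-1) /jac; field.
  by have /andP[-> ->] := nz h hc' h0.
have C2 : (fun h : R => crs (e1 c (G x).2) u * (crs (e1 c (G x).2) (e2 c (G (h *: u + x)).1))^-1)
    @ within (fun h => cl (h *: u + x)) (0 : R)^' --> crs (e1 c (G x).2) u / jac c (G x).1 (G x).2.
  by apply: cvgM => //; exact: cvg_cst.
apply: cvg_ext C2; near=> h.
have hc' : cl (h *: u + x) by near: h; exact: withinT.
have h0 : h != 0 by near: h; rewrite near_withinE; near=> k => _; near: k; exact: nbhs_dnbhs_neq.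
rewrite inv_map_sub2 // addrK crsZr; rewrite -[LHS]/(_ * _^-1) /jac; field.
by have /andP[-> ->] := nz h hc' h0.
Unshelve. all: by end_near. Qed.

End InverseMap.

Lemma cvg_fin_sum (R : realType) (T : Type) (F : set_system T) {FF : Filter F} (I : finType)
    (f : I -> T -> R) (l : I -> R) :
  (forall i, f i @ F --> l i) -> (fun x => \sum_i f i x) @ F --> \sum_i l i.
Proof.
move=> H; elim: (index_enum I) => [|i s IH].
  by under eq_fun do rewrite big_nil; rewrite big_nil; exact: cvg_cst.
under eq_fun do rewrite big_cons; rewrite big_cons; exact: (cvgD (H i) IH).
Qed.

(** * Tensor splines and their jets at the corners *)

Section TensorSplines.
Variables (R : realType) (p : nat).
Hypothesis hp : p \in [:: 3; 4; 5]%N.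
Local Notation rV := 'rV[R]_(11 - p).
Local Notation mx := 'M[R]_(11 - p).

Let pb : (2 < p < 6)%N.
Proof. by move: hp; rewrite !inE => /or3P[] /eqP ->. Qed.

(* Partial derivative of order [(a, b)] of the tensor spline with coefficients [C]. *)
Definition fd (a b : nat) (C : mx) (s t : R) : R :=
  \sum_i \sum_j C i j * (dtp a (basi R i) s * dtp b (basi R j) t).

Definition slice2 b (C : mx) t : rV := \row_i \sum_j C i j * dtp b (basi R j) t.
Definition slice1 a (C : mx) s : rV := \row_j \sum_i C i j * dtp a (basi R i) s.

Lemma fd_slice2 a b C s t : fd a b C s t = lin a (slice2 b C t) s.
Proof.
by apply: eq_bigr => i _; rewrite mxE mulr_suml; apply: eq_bigr => j _; ring.
Qed.

Lemma fd_slice1 a b C s t : fd a b C s t = lin b (slice1 a C s) t.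
Proof.
rewrite /fd exchange_big; apply: eq_bigr => j _; rewrite mxE mulr_suml.
by apply: eq_bigr => i _; ring.
Qed.

(** First derivatives still have positive degree at the knots and stay continuous; the second
    derivative of a quadratic truncated power, present for [p = 3], jumps there. *)
Lemma dbasi_continuous j i (x : R) : 0 <= x -> (j <= 1)%N \/ x \notin knots R p ->
  {for x, continuous (dtp j (basi R (p := p) i) : R^o -> R^o)}.
Proof.
move=> x0 H; have T : {for x, continuous (tp (basi R i).1 ((basi R (p := p) i).2 - j) : R^o -> R^o)}.
  apply: tp_continuous; case: (basiP R hp i) => [[-> _]|[bk bn]].
    by left; apply/eqP => E; move: x0; rewrite -E; lra.
  case: H => [j1|xk]; first by right; move: bn; move: (basi R i).2 => n; lia.
  by left; apply: contraNneq xk => <-.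
exact: (continuousM (@cst_continuous _ _ _ _) T).
Qed.

Lemma fd_cvg (T : Type) (F : set_system T) {FF : Filter F} (f g : T -> R) a b C s t :
  0 <= s -> 0 <= t -> (a <= 1)%N \/ s \notin knots R p -> (b <= 1)%N \/ t \notin knots R p ->
  f @ F --> s -> g @ F --> t -> fd a b C (f h) (g h) @[h --> F] --> fd a b C s t.
Proof.
move=> s0 t0 Ha Hb fs gt.
have D i : dtp a (basi R i) (f h) @[h --> F] --> dtp a (basi R (p := p) i) s.
  by apply: (@cvg_comp _ _ _ f (dtp a (basi R i)) F (nbhs s)) => //; exact: dbasi_continuous.
have D' i : dtp b (basi R i) (g h) @[h --> F] --> dtp b (basi R (p := p) i) t.
  by apply: (@cvg_comp _ _ _ g (dtp b (basi R i)) F (nbhs t)) => //; exact: dbasi_continuous.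
rewrite /fd; apply: cvg_fin_sum => i; apply: cvg_fin_sum => j.
by apply: cvgM; [exact: cvg_cst|apply: cvgM].
Qed.

Lemma fdD a b C D s t : fd a b (C + D) s t = fd a b C s t + fd a b D s t.
Proof.
rewrite -big_split; apply: eq_bigr => i _; rewrite -big_split; apply: eq_bigr => j _.
by rewrite mxE mulrDl.
Qed.

Lemma fdZ a b k C s t : fd a b (k *: C) s t = k * fd a b C s t.
Proof.
rewrite mulr_sumr; apply: eq_bigr => i _; rewrite mulr_sumr; apply: eq_bigr => j _.
by rewrite mxE; ring.
Qed.

Variable c : 'I_4 -> plane R.
Hypothesis hc : ccw_convex c.
Local Notation cl := (closure (open_quad c)).
Local Notation G := (inv_map c).

(** The mixed second derivative of [bilin c]: a constant vector, and the rate at which both [e1] and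
    [e2] vary. *)
Definition e12 : plane R := c 0 - c 1 + c 2 - c 3.

(* [grad_dir u] is the derivative along [u] of the tensor spline transported to
   the element (Cramer's rule for the Jacobian of [bilin c]); [grad_ds] and
   [grad_dt] are its partial derivatives in the reference coordinates. *)
Definition grad_num u C s t : R :=
  crs u (e2 c s) * fd 1 0 C s t + crs (e1 c t) u * fd 0 1 C s t.

Definition grad_dir u C s t : R := grad_num u C s t / jac c s t.

Definition grad_ds u C s t : R :=
  ((crs u e12 * fd 1 0 C s t + crs u (e2 c s) * fd 2 0 C s t + crs (e1 c t) u * fd 1 1 C s t)
     * jac c s t - grad_num u C s t * crs (e1 c t) e12) / jac c s t ^+ 2.

Definition grad_dt u C s t : R :=
  ((crs u (e2 c s) * fd 1 1 C s t + crs e12 u * fd 0 1 C s t + crs (e1 c t) u * fd 0 2 C s t)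
     * jac c s t - grad_num u C s t * crs e12 (e2 c s)) / jac c s t ^+ 2.

(** The chain rule a second time: the derivative along [v] of [grad_dir u]. *)
Definition hess_dir v u C s t : R :=
  (crs v (e2 c s) * grad_ds u C s t + crs (e1 c t) v * grad_dt u C s t) / jac c s t.

Definition tensor_rep (phi : plane R -> R^o) (C : mx) : Prop :=
  forall xi, unit_square xi -> phi (bilin c xi) = fd 0 0 C xi.1 xi.2.

Lemma wder_val A (f : plane R -> R^o) x u (l l' : R) : wder A f x u l -> l = l' -> wder A f x u l'.
Proof. by move=> H <-. Qed.

Lemma wder_fd a b C x u : cl x -> a = 0%N \/ (G x).1 \notin knots R p ->
  b = 0%N \/ (G x).2 \notin knots R p ->
  wder cl (fun y => fd a b C (G y).1 (G y).2) x u
    (crs u (e2 c (G x).1) / jac c (G x).1 (G x).2 * fd a.+1 b C (G x).1 (G x).2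
     + crs (e1 c (G x).2) u / jac c (G x).1 (G x).2 * fd a b.+1 C (G x).1 (G x).2).
Proof.
move=> clx Ha Hb; have [w1 w2] := wder_inv_map hc u clx.
have [[/andP[x1 _] /andP[x2 _]] _] := inv_mapP hc clx.
apply: wder_val.
  apply: wder_sum => i; apply: wder_sum => j.
  apply: wderM; first exact: wder_cst.
  apply: wderM.
    exact: (@wder_comp _ _ _ (fun y => (G y).1) _ _ _ (dtp a (basi R i)) _ w1 (is_derive_dbasi hp i x1 Ha)).
  exact: (@wder_comp _ _ _ (fun y => (G y).2) _ _ _ (dtp b (basi R j)) _ w2 (is_derive_dbasi hp j x2 Hb)).
rewrite /fd !mulr_sumr -big_split; apply: eq_bigr => i _ /=.
by rewrite !mulr_sumr -big_split; apply: eq_bigr => j _ /=; ring.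
Qed.

Lemma wder_rep phi C x u : tensor_rep phi C -> cl x ->
  wder cl phi x u (grad_dir u C (G x).1 (G x).2).
Proof.
move=> rC clx; apply: (@wder_eq _ _ _ (fun y => fd 0 0 C (G y).1 (G y).2)) => //.
  by move=> y cly; have [uy E] := inv_mapP hc cly; rewrite -{3}E rC.
apply: wder_val; first by apply: wder_fd => //; left.
by rewrite /grad_dir /grad_num; ring.
Qed.

Lemma nbhs_closure_quad x : open_quad c x -> nbhs x cl.
Proof.
move=> Qx; apply: (filterS (@subset_closure _ (open_quad c))).
by apply: open_nbhs_nbhs; split => //; exact: open_open_quad.
Qed.

Lemma is_derive_rep phi C x u : tensor_rep phi C -> open_quad c x ->
  is_derive x u phi (grad_dir u C (G x).1 (G x).2).
Proof.
move=> rC Qx; apply: (wder_is_derive (nbhs_closure_quad Qx)).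
by apply: wder_rep => //; exact: subset_closure.
Qed.

Lemma jacM x : cl x -> 0 < jac c (G x).1 (G x).2.
Proof. by move=> /(inv_mapP hc)[[x1 x2] _]; exact: jac_gt0. Qed.

(** Besides the partials of the spline, every ingredient of [grad_dir] is affine in the reference
    coordinates, the Jacobian included, because [crs e12 e12] vanishes. *)
Lemma wder_grad u v C x : cl x -> (G x).1 \notin knots R p -> (G x).2 \notin knots R p ->
  wder cl (fun y => grad_dir u C (G y).1 (G y).2) x v (hess_dir v u C (G x).1 (G x).2).
Proof.
move=> clx k1 k2; have [w1 w2] := wder_inv_map hc v clx.
have j0 := jacM clx.
have K r : wder cl (fun=> r) x v 0 by exact: wder_cst.
set l1 := _ / _ in w1; set l2 := _ / _ in w2.
have we2 w : wder cl (fun y => crs w (e2 c (G y).1)) x v (l1 * crs w e12).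
  apply: (@wder_eq _ _ _ (fun y => crs w (e2 c 0) + (G y).1 * crs w e12)) => //.
    by move=> y _; rewrite /crs /e2 /e12 !mxE; ring.
  apply: wder_val; first exact: (wderD (K _) (wderM w1 (K _))).
  by rewrite /=; ring.
have we1 w : wder cl (fun y => crs (e1 c (G y).2) w) x v (l2 * crs e12 w).
  apply: (@wder_eq _ _ _ (fun y => crs (e1 c 0) w + (G y).2 * crs e12 w)) => //.
    by move=> y _; rewrite /crs /e1 /e12 !mxE; ring.
  apply: wder_val; first exact: (wderD (K _) (wderM w2 (K _))).
  by rewrite /=; ring.
have wj : wder cl (fun y => jac c (G y).1 (G y).2) x v (l1 * crs (e1 c 0) e12 + l2 * crs e12 (e2 c 0)).
  apply: (@wder_eq _ _ _ (fun y => jac c 0 0 + ((G y).1 * crs (e1 c 0) e12 + (G y).2 * crs e12 (e2 c 0)))) => //.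
    by move=> y _; rewrite /jac /crs /e1 /e2 /e12 !mxE; ring.
  apply: wder_val; first exact: (wderD (K _) (wderD (wderM w1 (K _)) (wderM w2 (K _)))).
  by rewrite /=; ring.
have wV := @wder_comp _ _ _ _ _ _ _ (fun z : R^o => z^-1 : R^o) (- (jac c (G x).1 (G x).2) ^- 2) wj _.
have {}wV : wder cl (fun y => (jac c (G y).1 (G y).2)^-1) x v
    (- (jac c (G x).1 (G x).2) ^- 2 * (l1 * crs (e1 c 0) e12 + l2 * crs e12 (e2 c 0))).
  apply: wV; have D : is_derive (jac c (G x).1 (G x).2 : R^o) 1 (id : R^o -> R^o) 1 by exact: is_derive_id.
  apply: DeriveDef; first by apply: derivableV; [rewrite gt_eqF|case: D].
  by rewrite (@deriveV _ _ id) ?gt_eqF //; case: D => _ ->; rewrite -[_ *: _]/(_ * _) mulr1.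
have f10 := @wder_fd 1 0 C x v clx (or_intror k1) (or_introl erefl).
have f01 := @wder_fd 0 1 C x v clx (or_introl erefl) (or_intror k2).
apply: wder_val; first exact: (wderM (wderD (wderM (we2 u) f10) (wderM (we1 u) f01)) wV).
rewrite /hess_dir /grad_ds /grad_dt /grad_num.
have E1 : crs (e1 c (G x).2) e12 = crs (e1 c 0) e12 by rewrite /crs /e1 /e12 !mxE; ring.
have E2 : crs e12 (e2 c (G x).1) = crs e12 (e2 c 0) by rewrite /crs /e2 /e12 !mxE; ring.
rewrite E1 E2 /l1 /l2; field; rewrite gt_eqF //.
Qed.

End TensorSplines.

(** * Limits from inside an element *)

Section ClosureLimits.
Variable R : realType.

Lemma cvg_within_sub (T U : Type) (F : set_system T) {FF : Filter F} (A B : set T)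
    (f : T -> U) (L : set_system U) :
  A `<=` B -> f @ within B F --> L -> f @ within A F --> L.
Proof.
move=> AB H P /H; rewrite /within /= !nbhs_simpl /=; apply: filterS => x W /AB; exact: W.
Qed.

(** Membership of [x] in the closure makes the filter proper, so that the limit is unique. *)
Lemma cl_ext_lim (Q : set (plane R)) (f g : plane R -> R^o) x (l : R) :
  closure Q x -> (forall y, Q y -> f y = g y) ->
  f y @[y --> within Q (nbhs x)] --> l -> cl_ext Q g x = l.
Proof.
move=> clx fg H; have PF : ProperFilter (within Q (nbhs x)).
  apply: Build_ProperFilter_ex => P; rewrite /within /= => nP.
  by have [y [Qy /(_ Qy) Py]] := clx _ nP; exists y.
apply: cvg_lim; first exact: norm_hausdorff.
apply: cvg_ext H; near=> y; apply: fg; near: y; exact: withinT.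
Unshelve. all: by end_near. Qed.

End ClosureLimits.

(** * Gradients on the closed element and 2-jets at a corner *)

Section CornerJets.
Variables (R : realType) (p : nat).
Hypothesis hp : p \in [:: 3; 4; 5]%N.
Local Notation rV := 'rV[R]_(11 - p).
Local Notation mx := 'M[R]_(11 - p).
Variable c : 'I_4 -> plane R.
Hypothesis hc : ccw_convex c.
Local Notation Q := (open_quad c).
Local Notation cl := (closure (open_quad c)).
Local Notation G := (inv_map c).
Implicit Types (u v n : plane R) (C : mx) (phi : plane R -> R^o).

Lemma crs_e2_inv u x : cl x -> crs u (e2 c (G y).1) @[y --> within cl (nbhs x)] --> crs u (e2 c (G x).1).
Proof. by move=> clx; apply: crs_e2_cvg; exact: inv_map_cvg1. Qed.

Lemma crs_e1_inv u x : cl x -> crs (e1 c (G y).2) u @[y --> within cl (nbhs x)] --> crs (e1 c (G x).2) u.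
Proof. by move=> clx; apply: crs_e1_cvg; exact: inv_map_cvg2. Qed.

Lemma jac_inv x : cl x -> jac c (G y).1 (G y).2 @[y --> within cl (nbhs x)] --> jac c (G x).1 (G x).2.
Proof.
move=> clx; have E1 := inv_map_cvg1 hc clx; have E2 := inv_map_cvg2 hc clx.
have H s t : jac c 0 0 + (s * crs (e1 c 0) (e12 c) + t * crs (e12 c) (e2 c 0)) = jac c s t.
  by rewrite /jac /crs /e1 /e2 /e12 !mxE; ring.
rewrite -H; apply: (cvg_ext (f := fun y => jac c 0 0 +
  ((G y).1 * crs (e1 c 0) (e12 c) + (G y).2 * crs (e12 c) (e2 c 0)))).
  by near=> y; exact: H.
apply: cvgD; first exact: cvg_cst.
by apply: cvgD; apply: cvgM => //; exact: cvg_cst.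
Unshelve. all: by end_near. Qed.

Lemma fd_inv a b C x : cl x -> (a <= 1)%N \/ (G x).1 \notin knots R p ->
  (b <= 1)%N \/ (G x).2 \notin knots R p ->
  fd a b C (G y).1 (G y).2 @[y --> within cl (nbhs x)] --> fd a b C (G x).1 (G x).2.
Proof.
move=> clx Ha Hb; have [[/andP[x1 _] /andP[x2 _]] _] := inv_mapP hc clx.
by apply: fd_cvg => //; [exact: inv_map_cvg1|exact: inv_map_cvg2].
Qed.

Lemma grad_num_inv u C x : cl x ->
  grad_num c u C (G y).1 (G y).2 @[y --> within cl (nbhs x)] --> grad_num c u C (G x).1 (G x).2.
Proof.
move=> clx; apply: cvgD; apply: cvgM.
- exact: crs_e2_inv.
- by apply: fd_inv => //; left.
- exact: crs_e1_inv.
- by apply: fd_inv => //; left.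
Qed.

Lemma grad_dir_inv u C x : cl x ->
  grad_dir c u C (G y).1 (G y).2 @[y --> within cl (nbhs x)] --> grad_dir c u C (G x).1 (G x).2.
Proof.
move=> clx; apply: cvgM; first exact: grad_num_inv.
by apply: cvgV; [rewrite gt_eqF // jacM|exact: jac_inv].
Qed.

Lemma hess_dir_inv v u C x : cl x -> (G x).1 \notin knots R p -> (G x).2 \notin knots R p ->
  hess_dir c v u C (G y).1 (G y).2 @[y --> within cl (nbhs x)] --> hess_dir c v u C (G x).1 (G x).2.
Proof.
move=> clx k1 k2.
have J2 : (jac c (G y).1 (G y).2 ^+ 2)^-1 @[y --> within cl (nbhs x)] --> (jac c (G x).1 (G x).2 ^+ 2)^-1.
  apply: cvgV; first by rewrite gt_eqF // exprn_gt0 // jacM.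
  by apply: cvgM; exact: jac_inv.
have F a b : fd a b C (G y).1 (G y).2 @[y --> within cl (nbhs x)] --> fd a b C (G x).1 (G x).2.
  by apply: fd_inv => //; right.
apply: cvgM; last by apply: cvgV; [rewrite gt_eqF // jacM|exact: jac_inv].
apply: cvgD; apply: cvgM.
- exact: crs_e2_inv.
- apply: cvgM => //; apply: cvgB; last first.
    by apply: cvgM; [exact: grad_num_inv|exact: crs_e1_inv].
  apply: cvgM; last exact: jac_inv.
  apply: cvgD; first apply: cvgD; apply: cvgM; try exact: F.
  + exact: cvg_cst.
  + exact: crs_e2_inv.
  + exact: crs_e1_inv.
- exact: crs_e1_inv.
- apply: cvgM => //; apply: cvgB; last first.
    by apply: cvgM; [exact: grad_num_inv|exact: crs_e2_inv].
  apply: cvgM; last exact: jac_inv.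
  apply: cvgD; first apply: cvgD; apply: cvgM; try exact: F.
  + exact: crs_e2_inv.
  + exact: cvg_cst.
  + exact: crs_e1_inv.
Qed.

(** In the open element the derivative is given by [grad_dir], and this formula is continuous on the
    whole closed element. *)
Lemma cl_ext_grad phi C u x : tensor_rep c phi C -> cl x ->
  cl_ext Q ('D_u phi) x = grad_dir c u C (G x).1 (G x).2.
Proof.
move=> rC clx; apply: (cl_ext_lim (f := fun y => grad_dir c u C (G y).1 (G y).2)) => //.
  by move=> y Qy; have [_ ->] := is_derive_rep hp hc u rC Qy.
apply: (cvg_within_sub (@subset_closure _ Q)); exact: grad_dir_inv.
Qed.

Lemma near_notin_knots x (f : plane R -> R) : f y @[y --> within cl (nbhs x)] --> f x ->
  f x \notin knots R p -> \forall y \near within cl (nbhs x), f y \notin knots R p.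
Proof.
move=> cf; elim: (knots R p) => [|k s IH]; first by move=> _; near=> y; rewrite in_nil.
rewrite inE negb_or => /andP[fk /IH H].
have N : \forall y \near within cl (nbhs x), f y != k.
  by apply: (cf (fun z => z != k)); apply: open_nbhs_nbhs; split => //; exact: open_neq.
near=> y; rewrite inE negb_or; apply/andP; split; near: y => //.
Unshelve. all: by end_near. Qed.

Lemma cl_ext_hess phi C u v x : tensor_rep c phi C -> cl x ->
  (G x).1 \notin knots R p -> (G x).2 \notin knots R p ->
  cl_ext Q ('D_v ('D_u phi)) x = hess_dir c v u C (G x).1 (G x).2.
Proof.
move=> rC clx k1 k2.
(* On the knot lines the formula need not hold, so [g] keeps the value of the derivative there; it
   then agrees with it on all of the element, and near [x] only the first branch occurs. *)
pose g y : R := if ((G y).1 \notin knots R p) && ((G y).2 \notin knots R p) then hess_dir c v u C (G y).1 (G y).2 else 'D_v ('D_u phi) y.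
apply: (cl_ext_lim (f := g)) => //.
  move=> y Qy; rewrite /g; case: ifP => // /andP[a1 a2].
  have W : is_derive y v (fun z => grad_dir c u C (G z).1 (G z).2 : R^o) (hess_dir c v u C (G y).1 (G y).2).
    apply: (@wder_is_derive _ _ cl); first exact: nbhs_closure_quad.
    by apply: wder_grad => //; exact: subset_closure.
  have W' : is_derive y v ('D_u phi) (hess_dir c v u C (G y).1 (G y).2).
    apply: (is_derive_eq_on (open_open_quad (c := c)) _ Qy W) => z Qz.
    by have [_ ->] := is_derive_rep hp hc u rC Qz.
  by case: W' => _ ->.
apply: (cvg_within_sub (@subset_closure _ Q)).
apply: cvg_ext (@hess_dir_inv v u C x clx k1 k2).
have N1 := near_notin_knots (inv_map_cvg1 hc clx) k1.
have N2 := near_notin_knots (inv_map_cvg2 hc clx) k2.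
near=> y; rewrite /g ifT //; apply/andP; split; near: y => //.
Unshelve. all: by end_near. Qed.

Lemma inv_map_corner : G (c 0) = (0, 0).
Proof.
have E : bilin c (0, 0) = c 0 by apply: plane_eqP; rewrite /bilin !mxE /=; ring.
by rewrite -E inv_mapK // /unit_square /= !lexx ler01.
Qed.

Lemma corner_closure : cl (c 0).
Proof.
have E : bilin c (0, 0) = c 0 by apply: plane_eqP; rewrite /bilin !mxE /=; ring.
by rewrite -E; apply: bilin_closure => //; rewrite /unit_square /= !lexx ler01.
Qed.

Lemma zero_notin_knots : (0 : R) \notin knots R p.
Proof. by apply: end_notin_knots => //; left. Qed.

(** Corner 0 suffices: cyclic renumbering of the vertices ([rotn]) brings every corner there. *)
Lemma vertex_dof_corner phi C : tensor_rep c phi C ->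
  [/\ vertex_dof Q (c 0) 0 phi = fd 0 0 C 0 0,
      vertex_dof Q (c 0) 1 phi = grad_dir c (dir1 R) C 0 0 &
      vertex_dof Q (c 0) 2 phi = grad_dir c (dir2 R) C 0 0] /\
  [/\ vertex_dof Q (c 0) 3 phi = hess_dir c (dir1 R) (dir1 R) C 0 0,
      vertex_dof Q (c 0) 4 phi = hess_dir c (dir1 R) (dir2 R) C 0 0 &
      vertex_dof Q (c 0) 5 phi = hess_dir c (dir2 R) (dir2 R) C 0 0].
Proof.
move=> rC; have K := zero_notin_knots; have cl0 := corner_closure.
split; split; rewrite /vertex_dof /=.
- have E : bilin c (0, 0) = c 0 by apply: plane_eqP; rewrite /bilin !mxE /=; ring.
  by rewrite -E rC // /unit_square /= !lexx ler01.
- by rewrite (cl_ext_grad _ rC) // inv_map_corner.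
- by rewrite (cl_ext_grad _ rC) // inv_map_corner.
- by rewrite (cl_ext_hess _ _ rC) ?inv_map_corner.
- by rewrite (cl_ext_hess _ _ rC) ?inv_map_corner.
- by rewrite (cl_ext_hess _ _ rC) ?inv_map_corner.
Qed.

Lemma jac_corner_neq0 : jac c 0 0 != 0.
Proof. by rewrite gt_eqF // jac_gt0 // lexx ler01. Qed.

Lemma grad_dirE u C s t :
  grad_dir c u C s t = u 0 0 * grad_dir c (dir1 R) C s t + u 0 1 * grad_dir c (dir2 R) C s t.
Proof.
by rewrite /grad_dir /grad_num /dir1 /dir2 /crs !mxE /=; ring.
Qed.

(** The pure second partials of [bilin c] vanish, hence [fd 2 0] and [fd 0 2] involve the Hessian
    alone, without a gradient term. *)
Lemma corner_jet C : let d1 := grad_dir c (dir1 R) C 0 0 in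
  let d2 := grad_dir c (dir2 R) C 0 0 in
  let h11 := hess_dir c (dir1 R) (dir1 R) C 0 0 in
  let h12 := hess_dir c (dir1 R) (dir2 R) C 0 0 in
  let h22 := hess_dir c (dir2 R) (dir2 R) C 0 0 in
  let a := e1 c 0 in let b := e2 c 0 in
  [/\ fd 1 0 C 0 0 = a 0 0 * d1 + a 0 1 * d2,
      fd 0 1 C 0 0 = b 0 0 * d1 + b 0 1 * d2,
      fd 2 0 C 0 0 = a 0 0 ^+ 2 * h11 + 2 * a 0 0 * a 0 1 * h12 + a 0 1 ^+ 2 * h22 &
      fd 0 2 C 0 0 = b 0 0 ^+ 2 * h11 + 2 * b 0 0 * b 0 1 * h12 + b 0 1 ^+ 2 * h22] /\
  forall n, grad_ds c n C 0 0 =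
      n 0 0 * a 0 0 * h11 + (n 0 0 * a 0 1 + n 0 1 * a 0 0) * h12 + n 0 1 * a 0 1 * h22 /\
    grad_dt c n C 0 0 =
      n 0 0 * b 0 0 * h11 + (n 0 0 * b 0 1 + n 0 1 * b 0 0) * h12 + n 0 1 * b 0 1 * h22.
Proof.
have J := jac_corner_neq0.
rewrite /hess_dir /grad_ds /grad_dt /grad_dir /grad_num /jac /dir1 /dir2.
move: J; rewrite /jac; move: (e1 c 0) (e2 c 0) (e12 c) => a b e J.
move: (fd 1 0 C 0 0) (fd 0 1 C 0 0) (fd 2 0 C 0 0) (fd 1 1 C 0 0) (fd 0 2 C 0 0) => f1 f2 f11 f12 f22 /=.
move: J; rewrite /crs !mxE /=; move: (a 0 0) (a 0 1) (b 0 0) (b 0 1) (e 0 0) (e 0 1) => a0 a1 b0 b1 x y J.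
by split; [split|move=> n; split]; field.
Qed.

End CornerJets.

(** * Splines with reversed parameter *)

Section Reflection.
Variables (R : realType) (p : nat).
Hypothesis hp : p \in [:: 3; 4; 5]%N.
Local Notation rV := 'rV[R]_(11 - p).

Lemma rev01 (s : R) : 0 <= s <= 1 -> 0 <= 1 - s <= 1.
Proof. by rewrite subr_ge0 lerBlDr lerDl andbC. Qed.

(** For these parameters the selection is void, so that results on selected splines cover all
    splines. *)
Lemma full_span i : smooth_span p p.-2 (basi R (p := p) i).
Proof.
have pb : (2 < p < 6)%N by move: hp; rewrite !inE => /or3P[] /eqP ->.
rewrite /smooth_span; case: (basiP R hp i) => [[-> ->]|[_]]; first by rewrite eqxx.
by move: (basi R i).2 => n H; apply/andP; split; [lia|apply/orP; right; lia].
Qed.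

Lemma lin_reflect d m (c : rV) : (d <= p)%N -> (p <= m.+2)%N ->
  (forall i, ~~ smooth_span d m (basi R i) -> c 0 i = 0) ->
  exists2 c' : rV, (forall i, ~~ smooth_span d m (basi R i) -> c' 0 i = 0) &
    forall t, 0 <= t <= 1 -> lin 0 c' t = lin 0 c (1 - t).
Proof.
move=> dp pm cQ.
have [|c' c'Q E] := @inspan_reflect R p hp d m (lin 0 c) dp pm; first by exists c.
by exists c' => // t /segment01P /E ->.
Qed.

Lemma is_derive_lin_rev j (c : rV) t : 0 <= t <= 1 -> j = 0%N \/ 1 - t \notin knots R p ->
  is_derive (t : R^o) 1 (fun t => lin j c (1 - t) : R^o) (- lin j.+1 c (1 - t)).
Proof.
move=> /andP[t0 t1] H; apply: (@wder_is_derive _ _ setT); first exact: filterT.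
have W : wder (setT : set R^o) (fun t : R^o => 1 - t : R^o) t 1 (0 - 1).
  by apply: is_derive_wder; apply: is_deriveB.
have D : is_derive (1 - t : R^o) 1 (lin j c : R^o -> R^o) (lin j.+1 c (1 - t)).
  by apply: is_derive_lin => //; rewrite subr_ge0.
by have := wder_comp W D; rewrite sub0r mulrN1.
Qed.

(** The identity on [0, 1] is differentiated by [derive_vanish]; second derivatives are compared
    only at ends, which are never knots. *)
Lemma reflect_derive (c c' : rV) :
  (forall t, 0 <= t <= 1 -> lin 0 c' t = lin 0 c (1 - t)) ->
  (forall t, 0 <= t <= 1 -> lin 1 c' t = - lin 1 c (1 - t)) /\
  (lin 2 c' 0 = lin 2 c 1).
Proof.
move=> H.
have H1 t : 0 <= t <= 1 -> lin 1 c' t = - lin 1 c (1 - t).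
  move=> t01; apply/eqP; rewrite -subr_eq0; apply/eqP.
  apply: (@derive_vanish _ (fun t => lin 0 c' t - lin 0 c (1 - t)) t) => //.
    by move=> y /H ->; rewrite subrr.
  apply: is_deriveB; last by apply: is_derive_lin_rev => //; left.
  by apply: is_derive_lin => //; [case/andP: t01|left].
split => //.
have I0 : 0 <= (0 : R) <= 1 by rewrite lexx ler01.
have E : 0 = lin 2 c' 0 + - lin 2 c (1 - 0).
  apply/esym; apply: (@derive_vanish _ (fun t => lin 1 c' t + lin 1 c (1 - t)) 0) => //.
    by move=> y /H1 ->; rewrite addNr.
  apply: is_deriveD.
    by apply: is_derive_lin => //; right; apply: end_notin_knots => //; left.
  by apply: is_derive_lin_rev => //; right; rewrite subr0; apply: end_notin_knots => //; right.
by move: E; rewrite subr0 => /esym/eqP; rewrite subr_eq0 => /eqP.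
Qed.

End Reflection.

(** * Traces on a side and the 2-jets at its ends *)

Section EdgeData.
Variables (R : realType) (p : nat).
Hypothesis hp : p \in [:: 3; 4; 5]%N.
Local Notation rV := 'rV[R]_(11 - p).
Local Notation mx := 'M[R]_(11 - p).
Implicit Types (d : 'I_6 -> R) (u v n : plane R) (c : 'I_4 -> plane R).

Definition dgrad d u : R := u 0 0 * d 1 + u 0 1 * d 2.
Definition dhess d u v : R :=
  u 0 0 * v 0 0 * d 3 + (u 0 0 * v 0 1 + u 0 1 * v 0 0) * d 4 + u 0 1 * v 0 1 * d 5.

(* Hermite data at the point [x] of the traces of a function and of its normal
   derivative along a line with direction [tau], in terms of the 2-jet [d]. *)
Definition jet_match (ca cg : rV) (x : R) d (tau n : plane R) : Prop :=
  [/\ lin 0 ca x = d 0, lin 1 ca x = dgrad d tau & lin 2 ca x = dhess d tau tau] /\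
  (lin 0 cg x = dgrad d n /\ lin 1 cg x = dhess d n tau).

(** A directional derivative relative to the element becomes the one-sided derivative at 0 of the
    function read along a segment from [x]. *)
Lemma wder_along (A : set (plane R)) (f : plane R -> R^o) x v (l : R) (k : R^o -> R^o) :
  (forall h, 0 <= h <= 1 -> A (h *: v + x)) ->
  (forall h, 0 <= h <= 1 -> f (h *: v + x) = k h) ->
  wder A f x v l -> wder (`[0, 1]%classic : set R^o) k 0 1 l.
Proof.
move=> HA Hf W.
have S : (fun h : R => (`[0, 1]%classic : set R) (h *: (1 : R^o) + 0)) `<=` (fun h : R => A (h *: v + x)).
  by move=> h /segment01P; rewrite addr0 -[h *: _]/(h * _) mulr1; exact: HA.
apply: cvg_ext (cvg_within_sub S W).
have f0 : f x = k 0 by rewrite -Hf ?lexx ?ler01 // scale0r add0r.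
near=> h; have : (`[0, 1]%classic : set R) (h *: (1 : R^o) + 0) by near: h; exact: withinT.
move=> /segment01P; rewrite addr0 -[h *: _]/(h * _) mulr1 => h01.
by rewrite Hf // f0.
Unshelve. all: by end_near. Qed.

Let I0 : 0 <= (0 : R) <= 1. Proof. by rewrite lexx ler01. Qed.
Let K0 : (0 : R) \notin knots R p. Proof. by apply: end_notin_knots => //; left. Qed.

Section Corner.
Variables (c : 'I_4 -> plane R) (hc : ccw_convex c) (phi : plane R -> R^o) (C : mx).
Hypothesis rC : tensor_rep c phi C.
Local Notation Q := (open_quad c).
Local Notation dof := (fun k => vertex_dof Q (c 0) k phi).

Lemma e1_0 : e1 c 0 = c 1 - c 0.
Proof. by apply: plane_eqP; rewrite !mxE; ring. Qed.

Lemma e2_0 : e2 c 0 = c 3 - c 0.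
Proof. by apply: plane_eqP; rewrite !mxE; ring. Qed.

(** The trace is a slice of [C], so its derivatives are partials of the tensor spline. The normal
    trace is not a slice: its derivative is obtained as the one-sided derivative of [grad_dir c n]
    from the corner along the side. *)
Lemma start_jet n (ca cg : rV) :
  (forall s, 0 <= s <= 1 -> phi (bilin c (s, 0)) = lin 0 ca s) ->
  (forall s, 0 <= s <= 1 -> cl_ext Q ('D_n phi) (bilin c (s, 0)) = lin 0 cg s) ->
  jet_match ca cg 0 dof (c 1 - c 0) n.
Proof.
move=> Ha Hg; have [[v0 v1 v2] [v3 v4 v5]] := vertex_dof_corner hp hc rC.
have [[j1 _ j2 _] j4] := corner_jet hc C.
have sq s : 0 <= s <= 1 -> unit_square (s, 0 : R) by move=> s01; split.
have Ea : ca = slice2 0 C 0.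
  apply: (lin_inj hp) => y /andP[y0 y1].
  have y01 : 0 <= y <= 1 by rewrite !ltW.
  by rewrite -Ha // rC ?fd_slice2 //; exact: sq.
have Eg s : 0 <= s <= 1 -> lin 0 cg s = grad_dir c n C s 0.
  by move=> s01; rewrite -Hg // (cl_ext_grad hp hc n rC) ?inv_mapK //; try apply: bilin_closure => //; exact: sq.
split; [split|split].
- by rewrite Ea -fd_slice2 v0.
- by rewrite Ea -fd_slice2 j1 e1_0 /dgrad v1 v2.
- by rewrite Ea -fd_slice2 j2 e1_0 /dhess v3 v4 v5; ring.
- by rewrite Eg // grad_dirE /dgrad v1 v2.
- have -> : dhess dof n (c 1 - c 0) = grad_ds c n C 0 0.
    by rewrite (j4 n).1 e1_0 /dhess v3 v4 v5.
  apply: (@wder_unique _ (lin 0 cg) 0) => //.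
    by apply: is_derive_wder; apply: is_derive_lin => //; left.
  have W := @wder_grad R p hp c hc n (e1 c 0) C (c 0) (corner_closure hc).
  rewrite inv_map_corner // in W; have {}W := W K0 K0.
  have E : hess_dir c (e1 c 0) n C 0 0 = grad_ds c n C 0 0.
    by rewrite /hess_dir crsvv mul0r addr0 mulrAC -/(jac c 0 0) divff ?mul1r // jac_corner_neq0.
  rewrite E in W; have L h : h *: e1 c 0 + c 0 = bilin c (h, 0).
    by apply: plane_eqP; rewrite /bilin !mxE /=; ring.
  apply: (wder_along _ _ W) => h h01; rewrite L.
    by apply: bilin_closure => //; exact: sq.
  by rewrite inv_mapK ?Eg //; exact: sq.
Qed.

(** Side 3 runs from [c 3] to [c 0], against the second reference coordinate. Reversing the traces
    reduces its end to a computation starting at corner 0. *)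
Lemma stop_jet n (ca cg : rV) :
  (forall s, 0 <= s <= 1 -> phi (bilin c (0, 1 - s)) = lin 0 ca s) ->
  (forall s, 0 <= s <= 1 -> cl_ext Q ('D_n phi) (bilin c (0, 1 - s)) = lin 0 cg s) ->
  jet_match ca cg 1 dof (c 0 - c 3) n.
Proof.
move=> Ha Hg; have [[v0 v1 v2] [v3 v4 v5]] := vertex_dof_corner hp hc rC.
have [[_ j1 _ j2] j4] := corner_jet hc C.
have pb : (p <= p.-2.+2)%N by lia.
have [|ca' _ Ra] := @lin_reflect R p hp p p.-2 ca (leqnn p) pb; first by move=> i; rewrite full_span.
have [|cg' _ Rg] := @lin_reflect R p hp p p.-2 cg (leqnn p) pb; first by move=> i; rewrite full_span.
have [a1 a2] := reflect_derive hp Ra; have [g1 _] := reflect_derive hp Rg.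
have rev := @rev01 R.
have sq s : 0 <= s <= 1 -> unit_square (0 : R, s) by move=> s01; split.
have Ea : ca' = slice1 0 C 0.
  apply: (lin_inj hp) => y /andP[y0 y1].
  have y01 : 0 <= y <= 1 by rewrite !ltW.
  rewrite Ra // -Ha ?rev // opprB addrCA subrr addr0 rC ?fd_slice1 //; exact: sq.
have Eg s : 0 <= s <= 1 -> lin 0 cg' s = grad_dir c n C 0 s.
  move=> s01; rewrite Rg // -Hg ?rev // opprB addrCA subrr addr0.
  by rewrite (cl_ext_grad hp hc n rC) ?inv_mapK //; try apply: bilin_closure => //; exact: sq.
have b0 := Ra 0 I0; have b1 := a1 0 I0; have h0 := Rg 0 I0; have h1 := g1 0 I0.
rewrite subr0 in b0 b1 h0 h1.
split; [split|split].
- by rewrite -b0 Ea -fd_slice1 v0.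
- rewrite -[LHS]opprK -b1 Ea -fd_slice1 j1 e2_0 /dgrad v1 v2 !mxE; ring.
- rewrite -a2 Ea -fd_slice1 j2 e2_0 /dhess v3 v4 v5 !mxE; ring.
- by rewrite -h0 Eg // grad_dirE /dgrad v1 v2.
- have -> : dhess dof n (c 0 - c 3) = - grad_dt c n C 0 0.
    by rewrite (j4 n).2 e2_0 /dhess v3 v4 v5 !mxE; ring.
  rewrite -[LHS]opprK -h1; congr (- _).
  apply: (@wder_unique _ (lin 0 cg') 0) => //.
    by apply: is_derive_wder; apply: is_derive_lin => //; left.
  have W := @wder_grad R p hp c hc n (e2 c 0) C (c 0) (corner_closure hc).
  rewrite inv_map_corner // in W; have {}W := W K0 K0.
  have E : hess_dir c (e2 c 0) n C 0 0 = grad_dt c n C 0 0.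
    by rewrite /hess_dir crsvv mul0r add0r mulrAC -/(jac c 0 0) divff ?mul1r // jac_corner_neq0.
  rewrite E in W; have L h : h *: e2 c 0 + c 0 = bilin c (0, h).
    by apply: plane_eqP; rewrite /bilin !mxE /=; ring.
  apply: (wder_along _ _ W) => h h01; rewrite L.
    by apply: bilin_closure => //; exact: sq.
  by rewrite inv_mapK ?Eg //; exact: sq.
Qed.

End Corner.

(** A cyclic renumbering, by which any side can be made the bottom one. *)
Definition rotq c : 'I_4 -> plane R := fun i => c (i + 1).

Lemma rotq_convex c : ccw_convex c -> ccw_convex (rotq c).
Proof.
by move=> hc i k ki ki1; apply: hc; rewrite (inj_eq (@addIr _ 1)).
Qed.

Lemma open_rotq c : open_quad (rotq c) = open_quad c.
Proof.
apply/seteqP; split=> x H i; last exact: H.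
by have := H (i - 1); rewrite /rotq subrK.
Qed.

Lemma bilin_rotq c (x y : R) : bilin (rotq c) (x, y) = bilin c (1 - y, x).
Proof.
rewrite /bilin /rotq; have [-> -> -> ->] := ord4_next.
by apply: plane_eqP; rewrite !mxE /=; ring.
Qed.

(** The renumbering exchanges the reference coordinates and reverses one of them; the space of
    univariate splines is invariant under reversal. *)
Lemma tensor_rep_rotq c phi (C : mx) : tensor_rep c phi C ->
  exists C' : mx, tensor_rep (rotq c) phi C'.
Proof.
move=> rC.
have pb : (p <= p.-2.+2)%N by lia.
have /choice[r rE] : forall i, exists r : rV, forall t, 0 <= t <= 1 ->
    lin 0 r t = dtp 0 (basi R (p := p) i) (1 - t).
  move=> i; have [|r _ E] := @lin_reflect R p hp p p.-2 (delta_mx 0 i) (leqnn p) pb.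
    by move=> k; rewrite full_span.
  exists r => t /E ->; rewrite /lin (bigD1 i) //= big1 => [|j ji].
    by rewrite mxE !eqxx mul1r addr0.
  by rewrite mxE (negbTE ji) andbF mul0r.
exists (\matrix_(j, l) \sum_i C i j * r i 0 l) => -[x y] [/= x01 y01].
have xy : unit_square (1 - y, x) by split => //=; case/andP: y01 => ? ?; apply/andP; split; lra.
rewrite bilin_rotq rC //= /fd exchange_big; apply: eq_bigr => j _ /=.
under eq_bigr => i _ do rewrite -rE // /lin mulr_suml mulr_sumr.
rewrite exchange_big; apply: eq_bigr => l _ /=; rewrite mxE mulr_suml.
by apply: eq_bigr => i _; ring.
Qed.

Definition rotn k c := iter k rotq c.

Lemma rotnE k c i : rotn k c i = c (i + k%:R).
Proof.
elim: k i => [|k IH] i /=; first by rewrite addr0.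
by rewrite /rotq IH -addrA mulrS.
Qed.

Lemma rotn_facts k c phi (C : mx) : ccw_convex c -> tensor_rep c phi C ->
  [/\ ccw_convex (rotn k c), open_quad (rotn k c) = open_quad c &
      exists C' : mx, tensor_rep (rotn k c) phi C'].
Proof.
move=> hc rC; elim: k => [|k [h q [C' r]]]; first by split => //; exists C.
split; [exact: rotq_convex|by rewrite /rotn iterS open_rotq|exact: tensor_rep_rotq r].
Qed.

Definition edge_pt c (i : 'I_4) (s : R) : plane R := (1 - s) *: c i + s *: c (i + 1).

Lemma edge_jets c phi (C : mx) (i : 'I_4) n (ca cg : rV) : ccw_convex c -> tensor_rep c phi C ->
  (forall s, 0 <= s <= 1 -> phi (edge_pt c i s) = lin 0 ca s) ->
  (forall s, 0 <= s <= 1 -> cl_ext (open_quad c) ('D_n phi) (edge_pt c i s) = lin 0 cg s) ->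
  jet_match ca cg 0 (fun k => vertex_dof (open_quad c) (c i) k phi) (c (i + 1) - c i) n /\
  jet_match ca cg 1 (fun k => vertex_dof (open_quad c) (c (i + 1)) k phi) (c (i + 1) - c i) n.
Proof.
move=> hc rC Ha Hg; split.
  have [h q [C' r]] := rotn_facts i hc rC.
  have r0 : rotn i c 0 = c i by rewrite rotnE add0r natr_Zp.
  have r1 : rotn i c 1 = c (i + 1) by rewrite rotnE addrC natr_Zp.
  have L s : bilin (rotn i c) (s, 0) = edge_pt c i s.
    by rewrite /bilin /edge_pt r0 r1; apply: plane_eqP; rewrite !mxE /=; ring.
  have := @start_jet _ h phi C' r n ca cg; rewrite q r0 r1; apply => s s01; rewrite L //; first exact: Ha.
  exact: Hg.
(* After [i + 1] rotations the end point of side [i] is corner 0 and the side itself is side 3. *)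
have [h q [C' r]] := rotn_facts i.+1 hc rC.
have r0 : rotn i.+1 c 0 = c (i + 1) by rewrite rotnE add0r mulrSr natr_Zp.
have r3 : rotn i.+1 c 3 = c i.
  rewrite rotnE (mulrSr _ i) natr_Zp; congr (c _); rewrite addrCA.
  by have [_ _ _ ->] := ord4_next; rewrite addr0.
have L s : bilin (rotn i.+1 c) (0, 1 - s) = edge_pt c i s.
  by rewrite /bilin /edge_pt r0 r3; apply: plane_eqP; rewrite !mxE /=; ring.
have := @stop_jet _ h phi C' r n ca cg; rewrite q r0 r3; apply => s s01; rewrite L //; first exact: Ha.
exact: Hg.
Qed.

End EdgeData.

(** * The local space *)

Section LocalSpace.
Variables (R : realType) (p : nat).
Hypothesis hp : p \in [:: 3; 4; 5]%N.
Local Notation rV := 'rV[R]_(11 - p).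
Local Notation mx := 'M[R]_(11 - p).
Variables (c : 'I_4 -> plane R) (n : 'I_4 -> plane R).
Hypothesis hc : ccw_convex c.
Local Notation Q := (open_quad c).
Local Notation cl := (closure (open_quad c)).
Local Notation G := (inv_map c).
Local Notation I01 := (`[0, 1]%classic : set R).
Local Notation Io01 := (`]0, 1[%classic : set R^o).

Let pb : (2 < p < 6)%N.
Proof. by move: hp; rewrite !inE => /or3P[] /eqP ->. Qed.

Let oQ : open Q. Proof. exact: open_open_quad. Qed.
Let oI : open Io01. Proof. exact: itv_open. Qed.

(** One form for the three degrees: for [p = 5] the only subsquare is the whole square and the
    smoothness clauses are void. *)
Definition loc_space (phi : plane R -> R^o) : Prop :=
  [/\ forall x, ~ cl x -> phi x = 0,
      (p < 5)%N -> Ck (p - 2) Q phi,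
      forall a b : 'I_(6 - p), bipoly_on p (@subsquare R _ a b) (phi \o bilin c),
      (p < 5)%N -> forall i : 'I_4, Ck (p - 1) Io01 (phi \o bilin c \o ref_side i) &
      forall (i : 'I_4) (a b : 'I_(6 - p)),
        poly_on (p - 1) (`]0, 1[%classic `&` @ref_side R i @^-1` subsquare a b)
          (cl_ext Q ('D_(n i) phi) \o bilin c \o ref_side i)].

Definition edge_traces (phi : plane R -> R^o) (i : 'I_4) (ca cg : rV) : Prop :=
  [/\ forall k, ~~ smooth_span p p.-1 (basi R k) -> ca 0 k = 0,
      forall k, ~~ smooth_span p.-1 p.-2 (basi R k) -> cg 0 k = 0,
      forall s, 0 <= s <= 1 -> phi (edge_pt c i s) = lin 0 ca s &
      forall s, 0 <= s <= 1 -> cl_ext Q ('D_(n i) phi) (edge_pt c i s) = lin 0 cg s].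

Lemma piece_rev (j : nat) (s : R) : (j < 6 - p)%N -> piece p j s -> piece p (6 - p - j.+1) (1 - s).
Proof.
move=> jp; rewrite /piece /= !in_itv /= => /andP[js sj].
have E : (6 - p - j.+1).+1 = (6 - p - j)%N by lia.
by rewrite E (@breakpt_rev R p hp _ jp) (@breakpt_rev R p hp _ (ltnW jp)) !lerD2l !lerN2 sj js.
Qed.

Lemma bilin_ref_side i (s : R) : bilin c (ref_side i s) = edge_pt c i s.
Proof.
have [n0 n1 n2 n3] := ord4_next; rewrite /edge_pt.
by move: i; apply: ord4; rewrite ?n0 ?n1 ?n2 ?n3; apply: plane_eqP; rewrite /bilin !mxE /=; ring.
Qed.

Lemma poly_eq_itv (q r : {poly R}) (a b : R) : a < b ->
  (forall t, a < t < b -> q.[t] = r.[t]) -> q = r.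
Proof.
move=> ab H; apply/eqP; rewrite -subr_eq0; apply/eqP.
set N := size (q - r).
pose t (i : nat) : R := a + (b - a) * (i.+1%:R / N.+2%:R).
have N0 : 0 < N.+2%:R :> R by rewrite ltr0n.
apply: (@roots_geq_poly_eq0 _ _ [seq t i | i <- iota 0 N]).
- apply/allP => z /mapP[i]; rewrite mem_iota add0n => /andP[_ iN] ->.
  rewrite rootE hornerD hornerN H ?subrr //.
  have f0 : 0 < i.+1%:R / N.+2%:R :> R by rewrite divr_gt0 // ltr0n.
  have f1 : i.+1%:R / N.+2%:R < 1 :> R by rewrite ltr_pdivrMr // mul1r ltr_nat; lia.
  have ba : 0 < b - a by rewrite subr_gt0.
  rewrite /t ltrDl mulr_gt0 //= -ltrBrDl -[X in _ < X]mulr1.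
  by rewrite ltr_pM2l.
- rewrite map_inj_in_uniq ?iota_uniq // => i j _ _ /addrI /(mulfI _) E.
  have /mulIf : N.+2%:R^-1 != 0 :> R by rewrite invr_eq0 gt_eqF.
  move=> /(_ i.+1%:R j.+1%:R) E'; apply/eqP; rewrite -eqSS -(eqr_nat R); apply/eqP.
  by apply: E'; apply: E; rewrite gt_eqF // subr_gt0.
- by rewrite size_map size_iota.
Qed.

Let sample (k : 'I_(11 - p)) : R := k.+1%:R / (12 - p)%:R.

Let sample01 k : 0 < sample k < 1.
Proof. by apply: sample_in01. Qed.

(** The Lagrange basis at the sample points: a spline is recovered linearly from its samples, as the
    passage to tensor products needs. *)
Lemma cardinal_splines : exists l : 'I_(11 - p) -> rV,
  forall c : rV, c = \sum_k lin 0 c (sample k) *: l k.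
Proof.
have uni (d : rV) : (forall k, lin 0 d (sample k) = 0) -> d = 0.
  by move=> H; apply: points_unisolvent => // j jp; exact: (H (Ordinal jp)).
have /choice[l lE] : forall k : 'I_(11 - p), exists d : rV,
    forall i, lin 0 d (sample i) = (i == k)%:R.
  move=> k; apply: (@square_system _ _ (fun i d => lin 0 d (sample i))) => //.
  by move=> i a u v; rewrite linD linZ.
exists l => d; apply/eqP; rewrite -subr_eq0; apply/eqP; apply: uni => i.
rewrite linB lin_sum (bigD1 i) //= big1 => [|k ki].
  by rewrite linZ lE eqxx mulr1 addr0 subrr.
by rewrite linZ lE eq_sym (negbTE ki) mulr0.
Qed.

Section FromLocal.
Variable phi : plane R -> R^o.
Hypothesis Lphi : loc_space phi.

Lemma bipoly_slice (y : R) (j : nat) : 0 <= y <= 1 -> (j < 6 - p)%N ->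
  exists2 q : {poly R}, (size q <= p.+1)%N & forall t, piece p j t -> phi (bilin c (t, y)) = q.[t].
Proof.
case: Lphi => _ _ Hb _ _ y01 jp; have [l lp ly] := piece_exists hp y01.
have [d dE] := Hb (Ordinal jp) (Ordinal lp).
exists (\poly_(i < p.+1) (\sum_(k < p.+1) d (inord i) k * y ^+ k)); first exact: size_poly.
move=> t jt; have := dE (t, y); rewrite /= => -> //.
rewrite horner_poly; apply: eq_bigr => i _; rewrite mulr_suml; apply: eq_bigr => k _.
by rewrite inord_val /=; ring.
Qed.

Lemma bipoly_slice' (x : R) (j : nat) : 0 <= x <= 1 -> (j < 6 - p)%N ->
  exists2 q : {poly R}, (size q <= p.+1)%N & forall t, piece p j t -> phi (bilin c (x, t)) = q.[t].
Proof.
case: Lphi => _ _ Hb _ _ x01 jp; have [l lp lx] := piece_exists hp x01.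
have [d dE] := Hb (Ordinal lp) (Ordinal jp).
exists (\poly_(k < p.+1) (\sum_(i < p.+1) d i (inord k) * x ^+ i)); first exact: size_poly.
move=> t jt; have := dE (x, t); rewrite /= => -> //.
rewrite horner_poly exchange_big; apply: eq_bigr => k _; rewrite mulr_suml; apply: eq_bigr => i _.
by rewrite inord_val /=; ring.
Qed.

(** Only interior lines are treated, because smoothness in the plane is assumed in the open
    element. *)
Lemma slice1_span (y : R) : 0 < y < 1 ->
  exists d : rV, forall x, 0 <= x <= 1 -> phi (bilin c (x, y)) = lin 0 d x.
Proof.
move=> y01; have y01' := itv01W y01.
suff [d _ dE] : inspan p (smooth_span p p.-2) I01 (fun x => phi (bilin c (x, y))).
  by exists d => t t01; apply: dE; exact/segment01P.
apply: pieces_inspan => //; first by lia.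
- by move=> t /segment01o /itv01W /segment01P.
- move=> j jp; have [q sq qE] := bipoly_slice y01' jp.
  by exists q; split => // t [_ /qE].
- move=> p5; case: Lphi => _ /(_ p5) CQ _ _ _; rewrite subn2 in CQ.
  apply: (@Ck_line _ _ _ R^o Io01 Q phi (fun x => bilin c (x, y)) (fun u => u *: e1 c y) oI _ _ _ CQ).
  + move=> x /segment01o x01; apply/(open_quadP hc); exists (x, y) => //.
  + by move=> x u h; apply: plane_eqP; rewrite /bilin !mxE /= -?[h *: u]/(h * u); ring.
  + move=> x; apply: (@continuous_comp _ _ _ (fun x : R => (x, y)) (bilin c)); last exact: bilin_continuous.
    exact: (cvg_pair (@cvg_id _ (nbhs x)) (cvg_cst y)).
Qed.

Lemma slice2_span (x : R) : 0 < x < 1 ->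
  exists d : rV, forall y, 0 <= y <= 1 -> phi (bilin c (x, y)) = lin 0 d y.
Proof.
move=> x01; have x01' := itv01W x01.
suff [d _ dE] : inspan p (smooth_span p p.-2) I01 (fun y => phi (bilin c (x, y))).
  by exists d => t t01; apply: dE; exact/segment01P.
apply: pieces_inspan => //; first by lia.
- by move=> t /segment01o /itv01W /segment01P.
- move=> j jp; have [q sq qE] := bipoly_slice' x01' jp.
  by exists q; split => // t [_ /qE].
- move=> p5; case: Lphi => _ /(_ p5) CQ _ _ _; rewrite subn2 in CQ.
  apply: (@Ck_line _ _ _ R^o Io01 Q phi (fun y => bilin c (x, y)) (fun u => u *: e2 c x) oI _ _ _ CQ).
  + move=> y /segment01o y01; apply/(open_quadP hc); exists (x, y) => //.
  + by move=> y u h; apply: plane_eqP; rewrite /bilin !mxE /= -?[h *: u]/(h * u); ring.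
  + move=> y; apply: (@continuous_comp _ _ _ (fun y : R => (x, y)) (bilin c)); last exact: bilin_continuous.
    exact: (cvg_pair (cvg_cst x) (@cvg_id _ (nbhs y))).
Qed.

(** Cardinal interpolation is applied twice: an interior horizontal slice is recovered from its
    values at the sample abscissae, and each of these, as a function of [y], from its values at the
    sample ordinates. *)
Lemma local_tensor_rep : exists C : mx, tensor_rep c phi C.
Proof.
have [l lE] := cardinal_splines.
exists (\matrix_(i, j) \sum_k \sum_m phi (bilin c (sample k, sample m)) * l k 0 i * l m 0 j).
set C := \matrix_(i, j) _.
have fdC x y : fd 0 0 C x y =
    \sum_k \sum_m phi (bilin c (sample k, sample m)) * lin 0 (l k) x * lin 0 (l m) y.
  rewrite /fd; under eq_bigr => i _ do under eq_bigr => j _ do rewrite mxE mulr_suml.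
  under eq_bigr => i _ do rewrite exchange_big.
  rewrite exchange_big; apply: eq_bigr => k _ /=.
  under eq_bigr => i _ do under eq_bigr => j _ do rewrite mulr_suml.
  under eq_bigr => i _ do rewrite exchange_big.
  rewrite exchange_big; apply: eq_bigr => m _ /=.
  rewrite -mulrA /lin big_distrlr /= mulr_sumr; apply: eq_bigr => i _.
  by rewrite mulr_sumr; apply: eq_bigr => j _; ring.
have inner x y : 0 <= x <= 1 -> 0 < y < 1 -> phi (bilin c (x, y)) = fd 0 0 C x y.
  move=> x01 y01; have [d dE] := slice1_span y01.
  rewrite dE // fdC (lE d) lin_sum; apply: eq_bigr => k _.
  have [k0 k1] := andP (sample01 k).
  have [d' d'E] := slice2_span (sample01 k).
  have y01' := itv01W y01.
  rewrite linZ -dE ?ltW // d'E // (lE d') lin_sum mulr_suml; apply: eq_bigr => m _.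
  have [m0 m1] := andP (sample01 m).
  by rewrite linZ -d'E ?ltW //; ring.
(* To reach [y = 0] and [y = 1], note that on the piece containing [y] both sides are polynomials in
   the second variable that agree in its interior. *)
move=> [x y] [/= x01 y01].
have [j jp jy] := piece_exists hp y01.
have [q sq qE] := bipoly_slice' x01 jp.
have [||r [sr rE]] := @lin_piece R p hp (smooth_span p p.-2) p (slice1 0 C x) j _ _ jp.
- by move=> i; rewrite full_span.
- by move=> b /andP[].
rewrite fd_slice1 rE // qE //; congr (_.[y]).
apply: (@poly_eq_itv _ _ (breakpt R p j) (breakpt R p j.+1)); first by apply: ltr_breakpt.
move=> t /andP[jt tj]; have jt' : piece p j t by rewrite /piece /= in_itv /= !ltW.
rewrite -qE // -rE // -fd_slice1; apply: inner => //; apply/andP; split.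
  by apply: le_lt_trans jt; rewrite -(breakpt0 R p) ler_breakpt.
by apply: lt_le_trans tj _; rewrite -(breakpt_last R hp) ler_breakpt.
Qed.

Lemma ref_side_piece (i : 'I_4) (j : nat) : (j < 6 - p)%N ->
  exists a b : 'I_(6 - p), forall s, 0 < s < 1 -> piece p j s -> subsquare a b (@ref_side R i s).
Proof.
move=> jp; have k0 : (0 < 6 - p)%N by lia.
have kl : (6 - p - 1 < 6 - p)%N by lia.
have kj : (6 - p - j.+1 < 6 - p)%N by lia.
have F0 : piece p (Ordinal k0) (0 : R).
  by rewrite /piece /= in_itv /= breakpt0 lexx -(breakpt0 R p) ler_breakpt.
have F1 : piece p (Ordinal kl) (1 : R).
  have E : (6 - p - 1).+1 = (6 - p)%N by lia.
  by rewrite /piece /= in_itv /= E -(breakpt_last R hp) lexx andbT ler_breakpt //; lia.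
have Frev (s : R) : piece p j s -> piece p (Ordinal kj) (1 - s).
  exact: piece_rev.
have P4 := ord4 (P := fun i => exists a b : 'I_(6 - p), forall s, 0 < s < 1 ->
  piece p j s -> subsquare a b (@ref_side R i s)).
apply: P4.
- by exists (Ordinal jp), (Ordinal k0) => s _ js; split.
- by exists (Ordinal kl), (Ordinal jp) => s _ js; split.
- by exists (Ordinal kj), (Ordinal kl) => s _ js; split => //; exact: Frev.
- by exists (Ordinal k0), (Ordinal kj) => s _ js; split => //; exact: Frev.
Qed.

(** After rotation the normal derivative on the side is [num / ja] with [ja] affine and [num] a
    spline of degree [p]. The assumed C^(p-1) trace is what makes the tangential part of [num] an
    affine factor times a spline of degree [p - 1] and class C^(p-2). *)
Lemma local_edge_traces (C : mx) i : tensor_rep c phi C -> exists ca cg, edge_traces phi i ca cg.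
Proof.
move=> rC; have [h q [C' r]] := rotn_facts hp i hc rC.
set A := rotn i c in h q r.
have sq s : 0 <= s <= 1 -> unit_square (s, 0 : R) by move=> s01; split; rewrite //= lexx ler01.
have LE s : bilin A (s, 0) = edge_pt c i s.
  have r0 : A 0 = c i by rewrite /A rotnE add0r natr_Zp.
  have r1 : A 1 = c (i + 1) by rewrite /A rotnE addrC natr_Zp.
  by rewrite /bilin /edge_pt r0 r1; apply: plane_eqP; rewrite !mxE /=; ring.
have fs b s : lin 0 (slice2 b C' 0) s = fd 0 b C' s 0 by rewrite fd_slice2.
have phiE s : 0 <= s <= 1 -> phi (edge_pt c i s) = lin 0 (slice2 0 C' 0) s.
  by move=> s01; rewrite -LE r ?fs //; exact: sq.
have [ca caQ caE] : inspan p (smooth_span p p.-1) I01 (fun s => phi (edge_pt c i s)).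
  apply: pieces_inspan => //; first by lia.
  - by move=> t /segment01o /itv01W /segment01P.
  - move=> j jp; have [||u [su uE]] := @lin_piece R p hp (smooth_span p p.-2) p (slice2 0 C' 0) j _ _ jp.
    + by move=> k; rewrite full_span.
    + by move=> b /andP[].
    + by exists u; split => // t [/segment01P t01 /uE <-]; exact: phiE.
  - move=> p5; case: Lphi => _ _ _ /(_ p5 i); rewrite subn1 => + _.
    by apply: Ck_eq_on => // s _ /=; rewrite bilin_ref_side.
have caC : ca = slice2 0 C' 0.
  apply: (lin_inj hp) => y /andP[y0 y1].
  by rewrite -phiE -?caE ?ltW //; apply/segment01P; rewrite !ltW.
have gE s : 0 <= s <= 1 -> cl_ext Q ('D_(n i) phi) (edge_pt c i s) = grad_dir A (n i) C' s 0.
  move=> s01; rewrite -LE -q (cl_ext_grad hp h _ r) ?inv_mapK //; try exact: sq.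
  by apply: bilin_closure => //; exact: sq.
pose al s := (crs (n i) (e2 A 1) - crs (n i) (e2 A 0)) * s + crs (n i) (e2 A 0).
have alE s : al s = crs (n i) (e2 A s) by rewrite (crs_e2 A _ s) /al; ring.
pose ja s := (jac A 1 0 - jac A 0 0) * s + jac A 0 0.
have jaE s : ja s = jac A s 0 by rewrite (jacE A s 0) /ja; ring.
have [d1 d1Q d1E] := inspan_derive hp caQ.
pose num s := al s * lin 0 d1 s + crs (e1 A 0) (n i) * lin 0 (slice2 1 C' 0) s.
have numE s : 0 <= s <= 1 -> grad_num A (n i) C' s 0 = num s.
  move=> s01; rewrite /grad_num /num alE fs -d1E; last exact/segment01P.
  by rewrite caC -fd_slice2.
have Caff (a b : R) m : Ck m Io01 (fun s : R^o => a * s + b : R^o).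
  apply: CkD => //; last exact: Ck_cst.
  by apply: CkM => //; [exact: Ck_cst|exact: (Ck_sub _ (@Ck_id R m))].
have Cnum : Ck p.-2 Io01 (num : R^o -> R^o).
  apply: CkD => //; apply: CkM => //.
  - exact: Caff.
  - by apply: (@Ck_lin R p (smooth_span p.-1 p.-2)) => // b /andP[].
  - exact: Ck_cst.
  - apply: (@Ck_lin R p (smooth_span p p.-2)) => [k|b /andP[] //].
    by rewrite full_span.
have ja0 s : 0 <= s <= 1 -> 0 < ja s.
  by move=> s01; rewrite jaE; apply: jac_gt0 => //; rewrite lexx ler01.
(* The pieces are polynomials of degree [p - 1] by the definition of the local space; class C^(p-2)
   comes from the quotient, whose denominator is positive. So far this is on the open side only. *)
have [cg cgQ cgE] : inspan p (smooth_span p.-1 p.-2) (`]0, 1[%classic : set R) (fun s => num s / ja s).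
  apply: pieces_inspan => //; try lia.
  - by move=> t /segment01o /itv01W /segment01P.
  - move=> j jp; have [a [b ab]] := ref_side_piece i jp.
    case: Lphi => _ _ _ _ /(_ i a b)[u]; rewrite subn1 => -[su uE].
    exists u; split => // s [so js]; have s01 := (segment01o s).1 so.
    have s01' := itv01W s01.
    rewrite -uE; last by split => //; exact: ab.
    by rewrite /= bilin_ref_side gE // /grad_dir numE // jaE.
  - move=> _; apply: CkM => //; apply: CkV => //; last exact: Caff.
    by move=> s /segment01o /andP[? ?]; rewrite gt_eqF // ja0 // !ltW.
have [v _ vE] := @inspan_affine R p hp (jac A 1 0 - jac A 0 0) (jac A 0 0) (lin 0 cg)
  (ex_intro2 _ _ cg cgQ (fun t _ => erefl)).
have [w1 _ w1E] := @inspan_affine R p hp (crs (n i) (e2 A 1) - crs (n i) (e2 A 0)) (crs (n i) (e2 A 0)) (lin 0 d1)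
  (ex_intro2 _ _ d1 d1Q (fun t _ => erefl)).
pose w := w1 + crs (e1 A 0) (n i) *: slice2 1 C' 0.
have wE s : 0 <= s <= 1 -> num s = lin 0 w s.
  by move=> s01; rewrite linD linZ -w1E //; exact/segment01P.
(* [v] and [w] are the splines [ja * cg] and [num]. They agree on the open interval, hence have
   equal coefficients, and the quotient formula extends to the ends. *)
have vw : v = w.
  apply: (lin_inj hp) => s s01; have s01' := itv01W s01.
  rewrite -wE // -vE; last exact/segment01P.
  rewrite -/(ja s) -cgE; last exact/segment01o.
  by rewrite mulrCA divff ?mulr1 // gt_eqF // ja0.
exists ca, cg; split => // s s01.
have sI : I01 s by exact/segment01P.
have nE : num s = ja s * lin 0 cg s by rewrite wE // -vw -vE.
by rewrite gE // /grad_dir numE // nE -jaE mulrAC divff ?mul1r // gt_eqF // ja0.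
Qed.

End FromLocal.

(** The first derivatives of the inverse map are rational expressions in the map itself with the
    Jacobian as denominator, so each induction step gains one order. *)
Lemma Ck_inv_map m : Ck m Q (fun x => (G x).1 : R^o) /\ Ck m Q (fun x => (G x).2 : R^o).
Proof.
have ct (f : plane R -> R) x : Q x -> f y @[y --> within cl (nbhs x)] --> f x ->
    {for x, continuous (f : plane R -> R^o)}.
  move=> Qx; have nc := nbhs_closure_quad Qx => H P nP.
  have /= W := H P nP; rewrite nbhs_simpl /= in W; rewrite nbhs_simpl /=.
  near=> y; suff : cl y by near: y; exact: W.
  by near: y; exact: nc.
have c1 x : Q x -> {for x, continuous (fun x => (G x).1 : R^o)}.
  by move=> Qx; apply: (@ct (fun x => (G x).1) x Qx); apply: inv_map_cvg1 => //; exact: subset_closure.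
have c2 x : Q x -> {for x, continuous (fun x => (G x).2 : R^o)}.
  by move=> Qx; apply: (@ct (fun x => (G x).2) x Qx); apply: inv_map_cvg2 => //; exact: subset_closure.
elim: m => [|m [I1 I2]]; first by split; split.
have C1 (f : plane R -> R^o) : Ck m Q f -> Ck m Q (fun x => 1 - f x : R^o).
  move=> Cf; apply: (@Ck_eq_on _ _ _ _ (fun x => 1 + (-1) * f x)) => // [y _|]; first by rewrite mulN1r.
  by apply: CkD => //; [exact: Ck_cst|apply: CkM => //; exact: Ck_cst].
have Ce2 (u : plane R) : Ck m Q (fun x => crs u (e2 c (G x).1) : R^o).
  apply: (@Ck_eq_on _ _ _ _ (fun x => (1 - (G x).1) * crs u (e2 c 0) + (G x).1 * crs u (e2 c 1))) => //.
    by move=> y _; rewrite [RHS]crs_e2.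
  by apply: CkD => //; apply: CkM => //; [exact: C1|exact: Ck_cst|exact: Ck_cst].
have Ce1 (u : plane R) : Ck m Q (fun x => crs (e1 c (G x).2) u : R^o).
  apply: (@Ck_eq_on _ _ _ _ (fun x => (1 - (G x).2) * crs (e1 c 0) u + (G x).2 * crs (e1 c 1) u)) => //.
    by move=> y _; rewrite [RHS]crs_e1.
  by apply: CkD => //; apply: CkM => //; [exact: C1|exact: Ck_cst|exact: Ck_cst].
have CJ : Ck m Q (fun x => (jac c (G x).1 (G x).2)^-1 : R^o).
  apply: CkV => //; first by move=> x Qx; rewrite gt_eqF // jacM //; exact: subset_closure.
  apply: (@Ck_eq_on _ _ _ _ (fun x => (1 - (G x).1) * crs (e1 c (G x).2) (e2 c 0) + (G x).1 * crs (e1 c (G x).2) (e2 c 1))) => //.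
    by move=> y _; rewrite /jac (crs_e2 c _ (G y).1).
  by apply: CkD => //; apply: CkM => //; exact: C1.
have dd x u : Q x -> is_derive x u (fun x => (G x).1 : R^o) (crs u (e2 c (G x).1) / jac c (G x).1 (G x).2) /\
   is_derive x u (fun x => (G x).2 : R^o) (crs (e1 c (G x).2) u / jac c (G x).1 (G x).2).
  move=> Qx; have [w1 w2] := wder_inv_map hc u (@subset_closure _ Q x Qx).
  by split; apply: (@wder_is_derive _ _ cl) => //; exact: nbhs_closure_quad.
split; apply: Ck_intro => // u.
  exists (fun x => crs u (e2 c (G x).1) / jac c (G x).1 (G x).2); last by move=> x /(dd _ u)[].
  exact: CkM.
exists (fun x => crs (e1 c (G x).2) u / jac c (G x).1 (G x).2); last by move=> x /(dd _ u)[].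
exact: CkM.
Unshelve. all: by end_near. Qed.

Lemma Ck_rep phi (C : mx) : tensor_rep c phi C -> Ck p.-2 Q phi.
Proof.
move=> rC; apply: (@Ck_eq_on _ _ _ _ (fun x => fd 0 0 C (G x).1 (G x).2)) => //.
  by move=> y /subset_closure /(inv_mapP hc)[uy E]; rewrite -{3}E rC.
have [C1 C2] := Ck_inv_map p.-2.
have Cb (f : plane R -> R) i : (forall x, Q x -> 0 <= f x) -> Ck p.-2 Q (f : plane R -> R^o) ->
    Ck p.-2 Q (fun x => dtp 0 (basi R (p := p) i) (f x) : R^o).
  move=> f0 Cf; rewrite /dtp; apply: CkM => //; first exact: Ck_cst.
  rewrite subn0; apply: Ck_tp => //; case: (basiP R hp i) => [[-> _]|[_ bn]].
    by left => y /f0 H; apply/eqP => E; move: H; rewrite -E; lra.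
  by right; move: bn; move: (basi R i).2 => k; lia.
apply: Ck_sum => // i; apply: Ck_sum => // j; apply: CkM => //; first exact: Ck_cst.
apply: CkM => //; apply: Cb => // x /(open_inv_map hc)[/andP[? _] /andP[? _]]; exact: ltW.
Qed.

Lemma basis_piece (a : 'I_(6 - p)) i : poly_on p (piece p a) (dtp 0 (basi R (p := p) i)).
Proof.
have [||q [sq qE]] := @lin_piece R p hp (smooth_span p p.-2) p (delta_mx 0 i) a _ _ (ltn_ord a).
- by move=> k; rewrite full_span.
- by move=> ? /andP[].
- exists q; split => // t /qE <-; rewrite /lin (bigD1 i) //= big1 => [|j ji].
    by rewrite mxE !eqxx mul1r addr0.
  by rewrite mxE (negbTE ji) andbF mul0r.
Qed.

(** The converse of [local_tensor_rep] and [local_edge_traces]. Membership is thus equivalent to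
    having a tensor representation and edge traces in the right spline spaces, conditions that are
    easily combined linearly. *)
Lemma loc_space_intro phi (C : mx) : (forall x, ~ cl x -> phi x = 0) ->
  tensor_rep c phi C -> (forall i, exists ca cg, edge_traces phi i ca cg) -> loc_space phi.
Proof.
move=> phi0 rC tr; split => //.
- by move=> _; rewrite subn2; exact: Ck_rep rC.
- move=> a b.
  have /choice[q qE] : forall i, exists q : {poly R}, (size q <= p.+1)%N /\
      forall t, piece p a t -> dtp 0 (basi R (p := p) i) t = q.[t] by exact: basis_piece.
  have /choice[r rE] : forall i, exists r : {poly R}, (size r <= p.+1)%N /\
      forall t, piece p b t -> dtp 0 (basi R (p := p) i) t = r.[t] by exact: basis_piece.
  exists (\matrix_(k, l) \sum_i \sum_j C i j * ((q i)`_k * (r j)`_l)) => -[x y] [/= xa yb].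
  have sqr : unit_square (x, y).
    have in01 (d : 'I_(6 - p)) (z : R) : piece p d z -> 0 <= z <= 1.
      rewrite /piece /= in_itv /= => /andP[dz zd]; apply/andP; split.
        by apply: le_trans dz; rewrite -(breakpt0 R p) ler_breakpt.
      by apply: le_trans zd _; rewrite -(breakpt_last R hp) ler_breakpt.
    by split; [exact: (in01 a)|exact: (in01 b)].
  rewrite rC //= /fd.
  under [RHS]eq_bigr => k _ do under eq_bigr => l _ do rewrite mxE -mulrA mulr_suml.
  under [RHS]eq_bigr => k _ do rewrite exchange_big.
  rewrite [RHS]exchange_big; apply: eq_bigr => i _ /=.
  under [RHS]eq_bigr => k _ do under eq_bigr => l _ do rewrite mulr_suml.
  under [RHS]eq_bigr => k _ do rewrite exchange_big.
  rewrite [RHS]exchange_big; apply: eq_bigr => j _ /=.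
  rewrite ((qE i).2 _ xa) ((rE j).2 _ yb) (horner_coef_wide _ (qE i).1) (horner_coef_wide _ (rE j).1).
  rewrite big_distrlr /= mulr_sumr; apply: eq_bigr => k _.
  by rewrite mulr_sumr; apply: eq_bigr => l _; ring.
- move=> p5 i; have [ca [cg [caQ _ caE _]]] := tr i; rewrite subn1.
  apply: (@Ck_eq_on _ _ _ _ (lin 0 ca)) => //.
    by move=> s /segment01o /andP[? ?]; rewrite /= bilin_ref_side caE // !ltW.
  by apply: (@Ck_lin R p (smooth_span p p.-1)) => // b /andP[].
- move=> i a b; have [ca [cg [_ cgQ _ cgE]]] := tr i; rewrite subn1.
  have [j jp Hj] : exists2 j, (j < 6 - p)%N & forall s, 0 < s < 1 -> subsquare a b (@ref_side R i s) -> piece p j s.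
    have Frev (d : 'I_(6 - p)) (s : R) : piece p d (1 - s) -> piece p (6 - p - d.+1) s.
      by move=> /(piece_rev (ltn_ord d)); rewrite opprB addrC subrK.
    have rl (d : 'I_(6 - p)) : (6 - p - d.+1 < 6 - p)%N by lia.
    have P4 := ord4 (P := fun i => exists2 j, (j < 6 - p)%N & forall s, 0 < s < 1 ->
      subsquare a b (@ref_side R i s) -> piece p j s).
    apply: P4.
    + by exists a => // s _ [].
    + by exists b => // s _ [].
    + by exists (6 - p - a.+1)%N => // s _ [/= sa _]; exact: Frev.
    + by exists (6 - p - b.+1)%N => // s _ [/= _ sb]; exact: Frev.
  have [|q [sq qE]] := @lin_piece R p hp (smooth_span p.-1 p.-2) p.-1 cg j cgQ _ jp.
    by move=> ? /andP[].
  exists q; split => // s [/segment01o s01 sab]; rewrite -qE; last exact: Hj.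
  by rewrite /= bilin_ref_side cgE //; case/andP: s01 => ? ?; rewrite !ltW.
Qed.

End LocalSpace.

(** * Orthogonal decomposition in the frame of a side *)

Section EdgeGradient.
Variable R : realType.
Implicit Types u v n tau : plane R.

Definition dotp u v : R := u 0 0 * v 0 0 + u 0 1 * v 0 1.

Lemma frame_cross n tau : dotp n n = 1 -> dotp n tau = 0 -> tau != 0 -> crs n tau != 0.
Proof.
move=> nn nt t0; apply: contraNneq t0 => E; apply/eqP.
move: nn nt E; rewrite /dotp /crs => nn nt E.
apply: plane_eqP; rewrite !mxE.
  have -> : tau 0 0 = (n 0 0 * n 0 0 + n 0 1 * n 0 1) * tau 0 0 by rewrite nn mul1r.
  have -> : (n 0 0 * n 0 0 + n 0 1 * n 0 1) * tau 0 0 =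
    n 0 0 * (n 0 0 * tau 0 0 + n 0 1 * tau 0 1) - n 0 1 * (n 0 0 * tau 0 1 - n 0 1 * tau 0 0) by ring.
  by rewrite nt E !mulr0 subrr.
have -> : tau 0 1 = (n 0 0 * n 0 0 + n 0 1 * n 0 1) * tau 0 1 by rewrite nn mul1r.
have -> : (n 0 0 * n 0 0 + n 0 1 * n 0 1) * tau 0 1 =
  n 0 1 * (n 0 0 * tau 0 0 + n 0 1 * tau 0 1) + n 0 0 * (n 0 0 * tau 0 1 - n 0 1 * tau 0 0) by ring.
by rewrite nt E !mulr0 addr0.
Qed.

(** In the plane [tau] is [crs n tau] times the quarter turn of [n], so the two vectors form an
    orthogonal frame in which only the length of [tau] needs correcting. *)
Lemma dotp_decomp n tau u v : dotp n n = 1 -> dotp n tau = 0 -> tau != 0 ->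
  dotp u v = dotp u n * dotp v n + dotp u tau / dotp tau tau * dotp v tau.
Proof.
move=> nn nt t0; have l0 := frame_cross nn nt t0.
move: nn nt l0; rewrite /dotp /crs; set l := _ - _ => nn nt l0.
have E0 : tau 0 0 = - l * n 0 1.
  have -> : tau 0 0 = (n 0 0 * n 0 0 + n 0 1 * n 0 1) * tau 0 0 by rewrite nn mul1r.
  have -> : (n 0 0 * n 0 0 + n 0 1 * n 0 1) * tau 0 0 =
    n 0 0 * (n 0 0 * tau 0 0 + n 0 1 * tau 0 1) - n 0 1 * (n 0 0 * tau 0 1 - n 0 1 * tau 0 0) by ring.
  by rewrite nt -/l; ring.
have E1 : tau 0 1 = l * n 0 0.
  have -> : tau 0 1 = (n 0 0 * n 0 0 + n 0 1 * n 0 1) * tau 0 1 by rewrite nn mul1r.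
  have -> : (n 0 0 * n 0 0 + n 0 1 * n 0 1) * tau 0 1 =
    n 0 1 * (n 0 0 * tau 0 0 + n 0 1 * tau 0 1) + n 0 0 * (n 0 0 * tau 0 1 - n 0 1 * tau 0 0) by ring.
  by rewrite nt -/l; ring.
rewrite E0 E1 {E0 E1 nt}; clearbody l.
have -> : - l * n 0 1 * (- l * n 0 1) + l * n 0 0 * (l * n 0 0) = l ^+ 2.
  by rewrite -[RHS]mulr1 -nn; ring.
rewrite -[LHS]mulr1 -nn; field.
by [].
Qed.

End EdgeGradient.

(** * Unisolvence on one element *)

Section LocalUnisolvence.
Variables (R : realType) (p : nat).
Hypothesis hp : p \in [:: 3; 4; 5]%N.
Local Notation rV := 'rV[R]_(11 - p).
Local Notation mx := 'M[R]_(11 - p).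
Variables (c : 'I_4 -> plane R) (n : 'I_4 -> plane R).
Hypothesis hc : ccw_convex c.
Local Notation Q := (open_quad c).
Local Notation cl := (closure (open_quad c)).
Local Notation tau := (fun i => c (i + 1) - c i).
Hypothesis hn1 : forall i, dotp (n i) (n i) = 1.
Hypothesis hn2 : forall i, dotp (n i) (tau i) = 0.

Let pb : (2 < p < 6)%N.
Proof. by move: hp; rewrite !inE => /or3P[] /eqP ->. Qed.

Lemma consecutive_cross i : 0 < crs (c i - c (i - 1)) (c (i + 1) - c i).
Proof.
have H : 0 < orient (c (i - 1)) (c (i - 1 + 1)) (c (i + 1)).
  by apply: hc; move: i; apply: ord4.
rewrite subrK /orient in H; rewrite /crs !mxE; lra.
Qed.

Lemma tau_neq0 i : tau i != 0.
Proof.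
apply/eqP => E; have := consecutive_cross i; rewrite E /crs !mxE !mulr0 subrr ltxx //.
Qed.

(* The derivative along [u] on the side [i], recovered from the traces [ca] of
   the function and [cg] of its normal derivative. *)
Definition egrad i (ca cg : rV) s (u : plane R) : R :=
  dotp u (n i) * lin 0 cg s + dotp u (tau i) / dotp (tau i) (tau i) * lin 1 ca s.

Lemma edge_frame (i : 'I_4) : (rotn i c 0 = c i) /\ (rotn i c 1 = c (i + 1)).
Proof. by split; rewrite rotnE ?add0r 1?addrC natr_Zp. Qed.

Lemma edge_frame_pt (i : 'I_4) s : bilin (rotn i c) (s, 0) = edge_pt c i s.
Proof.
have [r0 r1] := edge_frame i.
by rewrite /bilin /edge_pt r0 r1; apply: plane_eqP; rewrite !mxE /=; ring.
Qed.

(** The tangential derivative on a side is the derivative of the trace, by Cramer's formula with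
    [e1 = tau]; together with the normal derivative it gives every direction. *)
Lemma edge_gradient phi (C : mx) i ca cg : tensor_rep c phi C -> edge_traces c n phi i ca cg ->
  forall s u, 0 <= s <= 1 -> cl_ext Q ('D_u phi) (edge_pt c i s) = egrad i ca cg s u.
Proof.
move=> rC [_ _ caE cgE] s u s01; have [h q [C' r]] := rotn_facts hp i hc rC.
have [r0 r1] := edge_frame i.
have sq t : 0 <= t <= 1 -> unit_square (t, 0 : R) by move=> t01; split; rewrite //= lexx ler01.
have gE v : cl_ext Q ('D_v phi) (edge_pt c i s) = grad_dir (rotn i c) v C' s 0.
  rewrite -edge_frame_pt -q (cl_ext_grad hp h _ r) ?inv_mapK //; try exact: sq.
  by apply: bilin_closure => //; exact: sq.
have caC : ca = slice2 0 C' 0.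
  apply: (lin_inj hp) => y y01; have y01' := itv01W y01.
  by rewrite -caE // -fd_slice2 -edge_frame_pt r //; exact: sq.
have tE : e1 (rotn i c) 0 = tau i by rewrite e1_0 r0 r1.
have j0 : jac (rotn i c) s 0 != 0 by rewrite gt_eqF // jac_gt0 // lexx ler01.
have Gt : grad_dir (rotn i c) (tau i) C' s 0 = lin 1 ca s.
  rewrite -tE /grad_dir /grad_num crsvv mul0r addr0 caC -fd_slice2 mulrAC.
  by rewrite -/(jac _ s 0) divff ?mul1r.
have Gn := cgE s s01; rewrite gE in Gn.
rewrite gE /egrad -Gn -Gt.
have := fun v => grad_dirE (rotn i c) v C' s 0.
set d1 := grad_dir _ (dir1 R) _ _ _; set d2 := grad_dir _ (dir2 R) _ _ _ => gdE.
pose d : plane R := \row_(k < 2) (if k == 0 then d1 else d2).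
have dE (v : plane R) : v 0 0 * d1 + v 0 1 * d2 = dotp d v.
  by rewrite /dotp !mxE /=; ring.
rewrite !gdE !dE [LHS](dotp_decomp d u (hn1 i) (hn2 i) (tau_neq0 i)); ring.
Qed.

(** A converse of the chain rule: if both reference partials come from one vector [(l0, l1)], then
    that vector is the gradient. *)
Lemma grad_dir_span (C : mx) s t l0 l1 u : 0 <= s <= 1 -> 0 <= t <= 1 ->
  fd 1 0 C s t = e1 c t 0 0 * l0 + e1 c t 0 1 * l1 ->
  fd 0 1 C s t = e2 c s 0 0 * l0 + e2 c s 0 1 * l1 ->
  grad_dir c u C s t = u 0 0 * l0 + u 0 1 * l1.
Proof.
move=> s01 t01 E1 E2; have J : jac c s t != 0 by rewrite gt_eqF // jac_gt0.
move: J; rewrite /grad_dir /grad_num E1 E2 /jac /crs => J; field.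
exact: J.
Qed.

Lemma fd_grad_dir (C : mx) s t : 0 <= s <= 1 -> 0 <= t <= 1 ->
  fd 1 0 C s t = grad_dir c (e1 c t) C s t /\ fd 0 1 C s t = grad_dir c (e2 c s) C s t.
Proof.
move=> s01 t01; have J : jac c s t != 0 by rewrite gt_eqF // jac_gt0.
by rewrite /grad_dir /grad_num !crsvv !mul0r addr0 add0r -/(jac c s t); split; rewrite mulrAC divff ?mul1r.
Qed.

Lemma ref_side_sq i (s : R) : 0 <= s <= 1 -> unit_square (ref_side i s).
Proof.
have I0 : 0 <= (0 : R) <= 1 by rewrite lexx ler01.
have I1 : 0 <= (1 : R) <= 1 by rewrite lexx ler01.
move=> s01; have s01' := rev01 s01; move: i.
by apply: (ord4 (P := fun i => unit_square (@ref_side R i s))); split.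
Qed.

Lemma boundary_gradient phi (C : mx) i ca cg : tensor_rep c phi C -> edge_traces c n phi i ca cg ->
  forall s u, 0 <= s <= 1 -> grad_dir c u C (@ref_side R i s).1 (ref_side i s).2 = egrad i ca cg s u.
Proof.
move=> rC tr s u s01; have sq := ref_side_sq i s01.
rewrite -(edge_gradient rC tr) // -bilin_ref_side (cl_ext_grad hp hc _ rC) ?inv_mapK //.
exact: bilin_closure.
Qed.

Lemma jets_determine (ca cg ca' cg' : rV) d d' (t m : plane R) :
  (forall k, ~~ smooth_span p p.-1 (basi R k) -> ca 0 k = 0) ->
  (forall k, ~~ smooth_span p.-1 p.-2 (basi R k) -> cg 0 k = 0) ->
  (forall k, ~~ smooth_span p p.-1 (basi R k) -> ca' 0 k = 0) ->
  (forall k, ~~ smooth_span p.-1 p.-2 (basi R k) -> cg' 0 k = 0) ->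
  jet_match ca cg 0 d t m -> jet_match ca cg 1 d' t m ->
  jet_match ca' cg' 0 d t m -> jet_match ca' cg' 1 d' t m ->
  lin 0 cg (1 / 2) = lin 0 cg' (1 / 2) -> ca = ca' /\ cg = cg'.
Proof.
move=> caQ cgQ caQ' cgQ' [[a0 a1 a2] [g0 g1]] [[b0 b1 b2] [h0 h1]].
move=> [[a0' a1' a2'] [g0' g1']] [[b0' b1' b2'] [h0' h1']] e.
split; apply/eqP; rewrite -subr_eq0; apply/eqP.
  apply: trace_unisolvent => // [k Hk||||||]; first by rewrite !mxE caQ // caQ' // subrr.
  - by rewrite linB a0 a0' subrr.
  - by rewrite linB a1 a1' subrr.
  - by rewrite linB a2 a2' subrr.
  - by rewrite linB b0 b0' subrr.
  - by rewrite linB b1 b1' subrr.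
  - by rewrite linB b2 b2' subrr.
apply: normal_unisolvent => // [k Hk|||||]; first by rewrite !mxE cgQ // cgQ' // subrr.
- by rewrite linB g0 g0' subrr.
- by rewrite linB g1 g1' subrr.
- by rewrite linB h0 h0' subrr.
- by rewrite linB h1 h1' subrr.
- by rewrite linB e subrr.
Qed.

Lemma traces_vanish phi (C : mx) i (ca cg : rV) : tensor_rep c phi C -> edge_traces c n phi i ca cg ->
  (forall j k, vertex_dof Q (c j) k phi = 0) ->
  cl_ext Q ('D_(n i) phi) (edge_pt c i (1 / 2)) = 0 -> ca = 0 /\ cg = 0.
Proof.
move=> rC [caQ cgQ caE cgE] v0 e0.
have [j0 j1] := edge_jets hp hc rC caE cgE.
have Z j : (fun k => vertex_dof Q (c j) k phi) = (fun=> 0) by apply/funext => k; rewrite v0.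
rewrite (Z i) in j0; rewrite (Z (i + 1)) in j1.
have J x t m : jet_match (0 : rV) 0 x (fun=> 0) t m.
  by rewrite /jet_match /dgrad /dhess !lin0 !mulr0 !addr0.
apply: (jets_determine caQ cgQ _ _ j0 j1 (J 0 _ _) (J 1 _ _)) => [k _|k _|]; rewrite ?mxE //.
by rewrite lin0 -cgE //; apply/andP; split; lra.
Qed.

Lemma local_injective phi : loc_space p c n phi ->
  (forall i k, vertex_dof Q (c i) k phi = 0) ->
  (forall i, cl_ext Q ('D_(n i) phi) (edge_pt c i (1 / 2)) = 0) ->
  (forall x y, x \in eta_points R p -> y \in eta_points R p -> phi (bilin c (x, y)) = 0) ->
  forall x, phi x = 0.
Proof.
move=> L v0 e0 q0; have [C rC] := local_tensor_rep hp hc L.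
have I0 : 0 <= (0 : R) <= 1 by rewrite lexx ler01.
have I1 : 0 <= (1 : R) <= 1 by rewrite lexx ler01.
have tr0 i : edge_traces c n phi i (0 : rV) (0 : rV).
  have [ca [cg tr]] := local_edge_traces hp hc L i rC.
  by have [a0 g0] := traces_vanish rC tr v0 (e0 i); rewrite a0 g0 in tr.
have bd i s : 0 <= s <= 1 -> let xi := @ref_side R i s in
    [/\ fd 0 0 C xi.1 xi.2 = 0, fd 1 0 C xi.1 xi.2 = 0 & fd 0 1 C xi.1 xi.2 = 0].
  move=> s01 xi; have sq := ref_side_sq i s01; have [x1 x2] := sq.
  have [E1 E2] := fd_grad_dir C x1 x2.
  rewrite E1 E2 !(boundary_gradient rC (tr0 i)) // /egrad !lin0 !mulr0 addr0; split => //.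
  by rewrite -rC //; have [_ _ /(_ s s01) + _] := tr0 i; rewrite bilin_ref_side lin0.
have W := @itv01W R.
have S00 : slice2 0 C 0 = 0.
  by apply: (lin_inj hp) => s /W s01; rewrite lin0 -fd_slice2; have [] := bd 0 s s01.
have S10 : slice2 1 C 0 = 0.
  by apply: (lin_inj hp) => s /W s01; rewrite lin0 -fd_slice2; have [] := bd 0 s s01.
have S01 : slice2 0 C 1 = 0.
  apply: (lin_inj hp) => s /W s01; rewrite lin0 -fd_slice2.
  by have [] := bd 2 _ (rev01 s01); rewrite /= opprB addrC subrK.
have S11 : slice2 1 C 1 = 0.
  apply: (lin_inj hp) => s /W s01; rewrite lin0 -fd_slice2.
  by have [] := bd 2 _ (rev01 s01); rewrite /= opprB addrC subrK.
(* At such a height the slice has zero values and derivatives at both ends, by sides 3 and 1, and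
   zero values at the points of E_p. *)
have Se x : x \in eta_points R p -> slice2 0 C x = 0.
  move=> xe; have x01 := eta_in01 hp xe; have [l1 l2 _] := bd 3 _ (rev01 x01).
  have [r1 r2 _] := bd 1 _ x01.
  rewrite /= opprB addrCA subrr addr0 in l1 l2; rewrite /= in r1 r2.
  apply: hermite_unisolvent => //; rewrite -?fd_slice2 // => y ye.
  by rewrite -fd_slice2; have := q0 y x ye xe; rewrite rC //; split => //=; exact: (eta_in01 hp).
(* Row [i] of [C] is a spline in the second variable; its Hermite data are the entries with index
   [i] of the slices just shown to vanish. *)
have C0 : C = 0.
  apply/row_matrixP => i; rewrite row0.
  have F b t : lin b (row i C) t = slice2 b C t 0 i.
    by rewrite mxE; apply: eq_bigr => j _; rewrite mxE.
  apply: hermite_unisolvent => //; rewrite ?F ?S00 ?S10 ?S01 ?S11 ?mxE // => x xe.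
  by rewrite F Se // mxE.
move=> x; have [clx|nx] := pselect (cl x); last by case: L => /(_ x nx).
have [sq <-] := inv_mapP hc clx; rewrite rC // C0 /fd big1 // => i _.
by rewrite big1 // => j _; rewrite mxE mul0r.
Qed.

End LocalUnisolvence.

(** * Tensor-product Hermite interpolation of boundary data *)

Section Coons.
Variables (R : realType) (p : nat).
Hypothesis hp : p \in [:: 3; 4; 5]%N.
Local Notation rV := 'rV[R]_(11 - p).
Local Notation mx := 'M[R]_(11 - p).

Lemma hermite_inj (u v : rV) : lin 0 u 0 = lin 0 v 0 -> lin 1 u 0 = lin 1 v 0 ->
  lin 0 u 1 = lin 0 v 1 -> lin 1 u 1 = lin 1 v 1 ->
  (forall x, x \in eta_points R p -> lin 0 u x = lin 0 v x) -> u = v.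
Proof.
move=> h1 h2 h3 h4 h5; apply/eqP; rewrite -subr_eq0; apply/eqP.
apply: hermite_unisolvent => // [||||x xe]; rewrite linB.
- by rewrite h1 subrr.
- by rewrite h2 subrr.
- by rewrite h3 subrr.
- by rewrite h4 subrr.
- by rewrite h5 // subrr.
Qed.

(* [B], [T], [L], [W] list the function and its transversal derivative on the
   bottom, top, left and right sides of the square; the hypothesis is their
   compatibility at the four corners. *)
Lemma tensor_interpolation (B T L W : nat -> rV) (q : R -> R -> R) :
  (forall i j, (i < 2)%N -> (j < 2)%N ->
    [/\ lin i (B j) 0 = lin j (L i) 0, lin i (B j) 1 = lin j (W i) 0,
        lin i (T j) 0 = lin j (L i) 1 & lin i (T j) 1 = lin j (W i) 1]) ->
  exists C : mx,
    (forall j, (j < 2)%N -> [/\ slice2 j C 0 = B j, slice2 j C 1 = T j,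
                             slice1 j C 0 = L j & slice1 j C 1 = W j]) /\
    (forall x y, x \in eta_points R p -> y \in eta_points R p -> fd 0 0 C x y = q x y).
Proof.
move=> H.
(* [X y] solves the problem on the horizontal line at height [y]; only heights in E_p are used. Then
   [r i] interpolates the coefficient with index [i] of [B], [T] and [X] in the vertical
   direction. *)
have /choice[X XE] : forall y, exists X : rV, [/\ lin 0 X 0 = lin 0 (L 0%N) y, lin 1 X 0 = lin 0 (L 1%N) y,
    lin 0 X 1 = lin 0 (W 0%N) y, lin 1 X 1 = lin 0 (W 1%N) y &
    forall x, x \in eta_points R p -> lin 0 X x = q x y].
  by move=> y; exact: hermite_interpolation.
have /choice[r rE] : forall i, exists r : rV, [/\ lin 0 r 0 = B 0%N 0 i, lin 1 r 0 = B 1%N 0 i,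
    lin 0 r 1 = T 0%N 0 i, lin 1 r 1 = T 1%N 0 i &
    forall y, y \in eta_points R p -> lin 0 r y = X y 0 i].
  by move=> i; exact: (hermite_interpolation _ _ _ _ _ (fun y => X y 0 i)).
pose C : mx := \matrix_(i, j) r i 0 j; exists C.
have F b t i : slice2 b C t 0 i = lin b (r i) t.
  by rewrite mxE; apply: eq_bigr => j _; rewrite mxE.
have B0 : slice2 0 C 0 = B 0%N by apply/rowP => i; rewrite F; case: (rE i).
have B1 : slice2 1 C 0 = B 1%N by apply/rowP => i; rewrite F; case: (rE i).
have T0 : slice2 0 C 1 = T 0%N by apply/rowP => i; rewrite F; case: (rE i).
have T1 : slice2 1 C 1 = T 1%N by apply/rowP => i; rewrite F; case: (rE i).
have SX y : y \in eta_points R p -> slice2 0 C y = X y.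
  by move=> ye; apply/rowP => i; rewrite F; case: (rE i) => _ _ _ _ ->.
have E i x t j : slice2 j C t = x -> forall z, lin j (slice1 i C z) t = lin i x z.
  by move=> <- z; rewrite -fd_slice1 fd_slice2.
have [c00 d00 e00 f00] := H 0%N 0%N isT isT; have [c01 d01 e01 f01] := H 0%N 1%N isT isT.
have [c10 d10 e10 f10] := H 1%N 0%N isT isT; have [c11 d11 e11 f11] := H 1%N 1%N isT isT.
(* The left and right sides are recovered rather than imposed: their end data agree by corner
   compatibility, their values at E_p by the choice of [X]. *)
have L0 : slice1 0 C 0 = L 0%N.
  apply: hermite_inj => [||||y ye]; rewrite ?(E _ _ _ _ B0) ?(E _ _ _ _ B1) ?(E _ _ _ _ T0) ?(E _ _ _ _ T1) //.
  by rewrite (E _ _ _ _ (SX y ye)); case: (XE y).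
have L1 : slice1 1 C 0 = L 1%N.
  apply: hermite_inj => [||||y ye]; rewrite ?(E _ _ _ _ B0) ?(E _ _ _ _ B1) ?(E _ _ _ _ T0) ?(E _ _ _ _ T1) //.
  by rewrite (E _ _ _ _ (SX y ye)); case: (XE y).
have W0 : slice1 0 C 1 = W 0%N.
  apply: hermite_inj => [||||y ye]; rewrite ?(E _ _ _ _ B0) ?(E _ _ _ _ B1) ?(E _ _ _ _ T0) ?(E _ _ _ _ T1) //.
  by rewrite (E _ _ _ _ (SX y ye)); case: (XE y).
have W1 : slice1 1 C 1 = W 1%N.
  apply: hermite_inj => [||||y ye]; rewrite ?(E _ _ _ _ B0) ?(E _ _ _ _ B1) ?(E _ _ _ _ T0) ?(E _ _ _ _ T1) //.
  by rewrite (E _ _ _ _ (SX y ye)); case: (XE y).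
split; first by case=> [|[|j]].
by move=> x y xe ye; rewrite fd_slice2 SX //; case: (XE y) => _ _ _ _ ->.
Qed.

End Coons.

Lemma ord6 (P : 'I_6 -> Prop) : P 0 -> P 1 -> P 2 -> P 3 -> P 4 -> P 5 -> forall k, P k.
Proof.
move=> P0 P1 P2 P3 P4 P5 [[|[|[|[|[|[|k]]]]]] lk] //.
- by have -> : Ordinal lk = 0 by apply: val_inj.
- by have -> : Ordinal lk = 1 by apply: val_inj.
- by have -> : Ordinal lk = 2 by apply: val_inj.
- by have -> : Ordinal lk = 3 by apply: val_inj.
- by have -> : Ordinal lk = 4 by apply: val_inj.
- by have -> : Ordinal lk = 5 by apply: val_inj.
Qed.

(** * Existence on one element with prescribed degrees of freedom *)

Section LocalExistence.
Variables (R : realType) (p : nat).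
Hypothesis hp : p \in [:: 3; 4; 5]%N.
Local Notation rV := 'rV[R]_(11 - p).
Local Notation mx := 'M[R]_(11 - p).
Variables (c : 'I_4 -> plane R) (n : 'I_4 -> plane R).
Hypothesis hc : ccw_convex c.
Local Notation Q := (open_quad c).
Local Notation cl := (closure (open_quad c)).
Local Notation tau := (fun i => c (i + 1) - c i).
Hypothesis hn1 : forall i, dotp (n i) (n i) = 1.
Hypothesis hn2 : forall i, dotp (n i) (tau i) = 0.
Implicit Types (d : 'I_6 -> R) (u v : plane R).

Lemma dhessC d u v : dhess d u v = dhess d v u.
Proof. by rewrite /dhess; ring. Qed.

Lemma dgrad_frame d i u : dgrad d u =
  dotp u (n i) * dgrad d (n i) + dotp u (tau i) / dotp (tau i) (tau i) * dgrad d (tau i).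
Proof.
pose g : plane R := \row_(k < 2) (if k == 0 then d 1 else d 2).
have E v : dgrad d v = dotp g v by rewrite /dgrad /dotp !mxE /=; ring.
by rewrite !E [LHS](dotp_decomp g u (hn1 i) (hn2 i) (tau_neq0 hc i)); ring.
Qed.

Lemma dhess_frame d i v u : dhess d v u =
  dotp u (n i) * dhess d v (n i) + dotp u (tau i) / dotp (tau i) (tau i) * dhess d v (tau i).
Proof.
pose g : plane R := \row_(k < 2) (if k == 0 then v 0 0 * d 3 + v 0 1 * d 4 else v 0 0 * d 4 + v 0 1 * d 5).
have E w : dhess d v w = dotp g w by rewrite /dhess /dotp !mxE /=; ring.
by rewrite !E [LHS](dotp_decomp g u (hn1 i) (hn2 i) (tau_neq0 hc i)); ring.
Qed.

(* Values and mixed derivatives, at the end point [x] of a side with tangent [a],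
   of the trace [z0] and of the derivative [z1] along a direction field equal to
   [b] at [x] and varying at the rate [e]. *)
Definition cross_data (z0 z1 : rV) (x : R) d (a b e : plane R) : Prop :=
  [/\ lin 0 z0 x = d 0, lin 1 z0 x = dgrad d a, lin 0 z1 x = dgrad d b &
      lin 1 z1 x = dgrad d e + dhess d a b].

(** The derivative along a direction field that is affine in [s] is a sum of affine factors times
    splines of degree [p - 1], hence a spline of degree [p], as [tensor_interpolation] requires. *)
Lemma transversal_trace (i : 'I_4) (ca cg : rV) (u v : plane R) :
  (forall k, ~~ smooth_span p p.-1 (basi R k) -> ca 0 k = 0) ->
  (forall k, ~~ smooth_span p.-1 p.-2 (basi R k) -> cg 0 k = 0) ->
  exists w : rV, (forall s, 0 <= s <= 1 -> lin 0 w s = egrad c n i ca cg s (u + s *: v)) /\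
    forall x d, x = 0 \/ x = 1 -> jet_match ca cg x d (tau i) (n i) ->
      cross_data ca w x d (tau i) (u + x *: v) v.
Proof.
move=> caQ cgQ; set tt := dotp (tau i) (tau i).
have [w1 _ w1E] := @inspan_affine R p hp (dotp v (n i)) (dotp u (n i)) (lin 0 cg)
  (ex_intro2 _ _ cg cgQ (fun t _ => erefl)).
have [w2 _ w2E] := @inspan_affine R p hp (dotp v (tau i) / tt) (dotp u (tau i) / tt) _ (inspan_derive hp caQ).
have dl (m : plane R) s : dotp (u + s *: v) m = dotp v m * s + dotp u m by rewrite /dotp !mxE; ring.
have wE s : 0 <= s <= 1 -> lin 0 (w1 + w2) s =
    (dotp v (n i) * s + dotp u (n i)) * lin 0 cg s + (dotp v (tau i) / tt * s + dotp u (tau i) / tt) * lin 1 ca s.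
  by move=> /segment01P sI; rewrite linD -w1E // -w2E.
exists (w1 + w2); split => [s s01|x d x01 [[a0 a1 a2] [g0 g1]]].
  by rewrite wE // /egrad !dl -/tt; ring.
have xI : 0 <= x <= 1 by case: x01 => ->; rewrite lexx ler01.
have x0 : 0 <= x by case/andP: xI.
(* The formula for [w1 + w2] is known on [0, 1] only, so its derivative at the end [x] is taken
   through [derive_vanish]. *)
have D : lin 1 (w1 + w2) x - (dotp v (n i) * lin 0 cg x + (dotp v (n i) * x + dotp u (n i)) * lin 1 cg x
   + (dotp v (tau i) / tt * lin 1 ca x + (dotp v (tau i) / tt * x + dotp u (tau i) / tt) * lin 2 ca x)) = 0.
  apply: (@derive_vanish _ (fun s => lin 0 (w1 + w2) s - ((dotp v (n i) * s + dotp u (n i)) * lin 0 cg s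
     + (dotp v (tau i) / tt * s + dotp u (tau i) / tt) * lin 1 ca s)) x) => //.
    by move=> y /wE ->; rewrite subrr.
  have A (a b : R) : is_derive (x : R^o) 1 (fun s : R^o => a * s + b : R^o) a.
    have H := is_deriveD (is_deriveM (is_derive_cst (a : R^o) (x : R^o) 1) (is_derive_id (x : R^o) 1))
      (is_derive_cst (b : R^o) (x : R^o) 1).
    by apply: (is_derive_eq H); rewrite scaler0 !addr0 -[LHS]/(a * 1) mulr1.
  have K : x \notin knots R p by exact: end_notin_knots.
  have D0 := @is_derive_lin R p hp 0 cg x x0 (or_introl erefl).
  have D1 := @is_derive_lin R p hp 1 ca x x0 (or_intror K).
  have D2 := @is_derive_lin R p hp 0 (w1 + w2) x x0 (or_introl erefl).
  apply: (is_derive_eq (is_deriveB D2 (is_deriveD (is_deriveM (A _ _) D0) (is_deriveM (A _ _) D1)))).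
  by rewrite -![_ *: _]/(_ * _); ring.
move/eqP: D; rewrite subr_eq0 => /eqP D.
split => //; first by rewrite wE // g0 a1 [RHS](dgrad_frame _ i) !dl -/tt; ring.
rewrite D g0 g1 a1 a2 (dgrad_frame _ i v) (dhess_frame _ i (tau i) (u + _)) !dl -/tt (dhessC _ (tau i) (n i)).
ring.
Qed.

(** For the top and left sides, which run against the reference coordinates. *)
Lemma reversed_trace (i : 'I_4) (ca cg : rV) (u v : plane R) :
  (forall k, ~~ smooth_span p p.-1 (basi R k) -> ca 0 k = 0) ->
  (forall k, ~~ smooth_span p.-1 p.-2 (basi R k) -> cg 0 k = 0) ->
  exists z0 z1 : rV, [/\ forall s, 0 <= s <= 1 -> lin 0 z0 s = lin 0 ca (1 - s),
    forall s, 0 <= s <= 1 -> lin 0 z1 s = egrad c n i ca cg (1 - s) (u + s *: v) &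
    forall x d, x = 0 \/ x = 1 -> jet_match ca cg (1 - x) d (tau i) (n i) ->
      cross_data z0 z1 x d (- tau i) (u + x *: v) v].
Proof.
move=> caQ cgQ; have [w [wE wD]] := transversal_trace i (u + v) (- v) caQ cgQ.
have E s : u + v + (1 - s) *: - v = u + s *: v by apply: plane_eqP; rewrite !mxE; ring.
have pb : (p <= p.-2.+2)%N by move: hp; rewrite !inE => /or3P[] /eqP ->.
have [|z0 _ R0] := @lin_reflect R p hp p p.-2 ca (leqnn p) pb; first by move=> k; rewrite full_span.
have [|z1 _ R1] := @lin_reflect R p hp p p.-2 w (leqnn p) pb; first by move=> k; rewrite full_span.
exists z0, z1; split => // [s s01|x d x01 J].
  by rewrite R1 // wE ?rev01 // E.
have x01' : 1 - x = 0 \/ 1 - x = 1 by case: x01 => ->; rewrite ?subr0 ?subrr; [right|left].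
have xI : 0 <= x <= 1 by case: x01 => ->; rewrite lexx ler01.
have [h0 h1 h2 h3] := wD _ _ x01' J; have [r0 _] := reflect_derive hp R0; have [r1 _] := reflect_derive hp R1.
rewrite E in h2 h3; split; rewrite ?R0 ?R1 ?r0 ?r1 //.
  by rewrite h1 /dgrad !mxE; ring.
by rewrite h3 /dgrad /dhess !mxE; ring.
Qed.

(** Independence of [a] and [m] settles the gradient. For the Hessian, the conditions on [(a, a)]
    and [(m, a)] say that the difference annihilates [a], and the value on a further independent
    direction [b] makes it zero. *)
Lemma corner_jet_unique (d d' : 'I_6 -> R) (a b m : plane R) : crs m a != 0 -> crs b a != 0 ->
  d 0 = d' 0 -> dgrad d a = dgrad d' a -> dgrad d m = dgrad d' m ->
  dhess d a a = dhess d' a a -> dhess d m a = dhess d' m a -> dhess d b b = dhess d' b b ->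
  forall k, d k = d' k.
Proof.
move=> ma ba e0 ga gm haa hma hbb.
have solve (x y : R) : a 0 0 * x + a 0 1 * y = 0 -> m 0 0 * x + m 0 1 * y = 0 -> x = 0 /\ y = 0.
  move=> E1 E2; split; apply: (mulfI ma); rewrite mulr0.
    transitivity (a 0 1 * (m 0 0 * x + m 0 1 * y) - m 0 1 * (a 0 0 * x + a 0 1 * y)).
      by rewrite /crs; ring.
    by rewrite E1 E2 !mulr0 subrr.
  transitivity (m 0 0 * (a 0 0 * x + a 0 1 * y) - a 0 0 * (m 0 0 * x + m 0 1 * y)).
    by rewrite /crs; ring.
  by rewrite E1 E2 !mulr0 subrr.
have [g1 g2] : d 1 - d' 1 = 0 /\ d 2 - d' 2 = 0.
  apply: solve.
    by rewrite -[RHS](subrr (dgrad d a)) {2}ga /dgrad; ring.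
  by rewrite -[RHS](subrr (dgrad d m)) {2}gm /dgrad; ring.
pose x3 := d 3 - d' 3; pose x4 := d 4 - d' 4; pose x5 := d 5 - d' 5.
have [r1 r2] : x3 * a 0 0 + x4 * a 0 1 = 0 /\ x4 * a 0 0 + x5 * a 0 1 = 0.
  apply: solve.
    by rewrite -[RHS](subrr (dhess d a a)) {2}haa /dhess /x3 /x4 /x5; ring.
  by rewrite -[RHS](subrr (dhess d m a)) {2}hma /dhess /x3 /x4 /x5; ring.
have hb : b 0 0 ^+ 2 * x3 + 2 * b 0 0 * b 0 1 * x4 + b 0 1 ^+ 2 * x5 = 0.
  by rewrite -[RHS](subrr (dhess d b b)) {2}hbb /dhess /x3 /x4 /x5; ring.
have ba2 : crs b a ^+ 2 != 0 by rewrite expf_neq0.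
have z3 : x3 = 0.
  apply: (mulfI ba2); rewrite mulr0.
  transitivity (a 0 1 ^+ 2 * (b 0 0 ^+ 2 * x3 + 2 * b 0 0 * b 0 1 * x4 + b 0 1 ^+ 2 * x5)
    + b 0 1 ^+ 2 * (a 0 0 * (x3 * a 0 0 + x4 * a 0 1) - a 0 1 * (x4 * a 0 0 + x5 * a 0 1))
    - 2 * a 0 1 * b 0 0 * b 0 1 * (x3 * a 0 0 + x4 * a 0 1)); first by rewrite /crs; ring.
  by rewrite hb r1 r2; ring.
have z5 : x5 = 0.
  apply: (mulfI ba2); rewrite mulr0.
  transitivity (a 0 0 ^+ 2 * (b 0 0 ^+ 2 * x3 + 2 * b 0 0 * b 0 1 * x4 + b 0 1 ^+ 2 * x5)
    + b 0 0 ^+ 2 * (a 0 1 * (x4 * a 0 0 + x5 * a 0 1) - a 0 0 * (x3 * a 0 0 + x4 * a 0 1))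
    - 2 * a 0 0 * b 0 0 * b 0 1 * (x4 * a 0 0 + x5 * a 0 1)); first by rewrite /crs; ring.
  by rewrite hb r1 r2; ring.
have z4 : x4 = 0.
  apply: (mulfI ba); rewrite mulr0.
  transitivity (b 0 0 * (x3 * a 0 0 + x4 * a 0 1) - b 0 1 * (x4 * a 0 0 + x5 * a 0 1)).
    by rewrite z3 z5 /crs; ring.
  by rewrite r1 r2 !mulr0 subrr.
have F (k : 'I_6) : d k - d' k = 0 -> d k = d' k by move/eqP; rewrite subr_eq0 => /eqP.
by apply: ord6 => //; apply: F.
Qed.

Definition sel (T : Type) (x y : T) (j : nat) : T := if j is 0%N then x else y.

(** The only nontrivial equality is that of the mixed derivatives: both sides have the same rate
    [e], and the Hessian is symmetric. *)
Lemma cross_data_compat (z0 z1 w0 w1 : rV) x y d (a b e : plane R) :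
  cross_data z0 z1 x d a b e -> cross_data w0 w1 y d b a e ->
  forall i j, (i < 2)%N -> (j < 2)%N -> lin i (sel z0 z1 j) x = lin j (sel w0 w1 i) y.
Proof.
move=> [h1 h2 h3 h4] [k1 k2 k3 k4] [|[|i]] // [|[|j]] // _ _ /=; rewrite ?h1 ?h2 ?h3 ?h4 ?k1 ?k2 ?k3 ?k4 //.
by rewrite dhessC.
Qed.

Lemma egrad_tau i ca cg s : egrad c n i ca cg s (tau i) = lin 1 (ca : rV) s.
Proof.
have t0 : dotp (tau i) (tau i) != 0.
  have := frame_cross (hn1 i) (hn2 i) (tau_neq0 hc i); apply: contraNneq.
  rewrite /dotp -!expr2 => /eqP; rewrite paddr_eq0 ?sqr_ge0 // !sqrf_eq0 => /andP[/eqP E0 /eqP E1].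
  by rewrite /crs E0 E1 !mulr0 subrr.
rewrite /egrad divff // mul1r [dotp _ (n i)](_ : _ = dotp (n i) (tau i)); last by rewrite /dotp; ring.
by rewrite hn2 mul0r add0r.
Qed.

Lemma egrad_normal i ca cg s : egrad c n i ca cg s (n i) = lin 0 (cg : rV) s.
Proof. by rewrite /egrad hn1 hn2 !mul0r mul1r addr0. Qed.

Lemma egradN i (ca cg : rV) s u : egrad c n i ca cg s (- u) = - egrad c n i ca cg s u.
Proof. by rewrite /egrad /dotp !mxE; ring. Qed.

Lemma egrad_dir i (ca cg : rV) s u : egrad c n i ca cg s u =
  u 0 0 * egrad c n i ca cg s (dir1 R) + u 0 1 * egrad c n i ca cg s (dir2 R).
Proof. by rewrite /egrad /dotp /dir1 /dir2 !mxE /=; ring. Qed.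

(** The reference partials on a side are derivatives along [e1] and [e2]. One of these is tangential
    and constant there up to sign; the other is affine with rate [e12], common to all sides, which
    yields compatibility at the corners. *)
Lemma tensor_from_traces (d : 'I_4 -> 'I_6 -> R) (q : R -> R -> R) (ca cg : 'I_4 -> rV) :
  (forall i k, ~~ smooth_span p p.-1 (basi R k) -> ca i 0 k = 0) ->
  (forall i k, ~~ smooth_span p.-1 p.-2 (basi R k) -> cg i 0 k = 0) ->
  (forall i, jet_match (ca i) (cg i) 0 (d i) (tau i) (n i)) ->
  (forall i, jet_match (ca i) (cg i) 1 (d (i + 1)) (tau i) (n i)) ->
  exists C : mx, (forall x y, x \in eta_points R p -> y \in eta_points R p -> fd 0 0 C x y = q x y) /\
    forall i s, 0 <= s <= 1 -> let xi := @ref_side R i s in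
    [/\ fd 0 0 C xi.1 xi.2 = lin 0 (ca i) s,
        fd 1 0 C xi.1 xi.2 = egrad c n i (ca i) (cg i) s (e1 c xi.2) &
        fd 0 1 C xi.1 xi.2 = egrad c n i (ca i) (cg i) s (e2 c xi.1)].
Proof.
move=> caQ cgQ J0 J1.
have [n0 n1 n2 n3] := ord4_next.
pose E := e12 c.
have e1E t : e1 c t = e1 c 0 + t *: E by apply: plane_eqP; rewrite !mxE; ring.
have e2E s : e2 c s = e2 c 0 + s *: E by apply: plane_eqP; rewrite !mxE; ring.
have t0 : tau 0 = e1 c 0 by rewrite n0 e1_0.
have t1 : tau 1 = e2 c 1 by rewrite n1; apply: plane_eqP; rewrite !mxE; ring.
have t2 : - tau 2 = e1 c 1 by rewrite n2; apply: plane_eqP; rewrite !mxE; ring.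
have t3 : - tau 3 = e2 c 0 by rewrite n3; apply: plane_eqP; rewrite !mxE; ring.
have [b1 [b1E b1D]] := transversal_trace 0 (e2 c 0) E (caQ 0) (cgQ 0).
have [r1 [r1E r1D]] := transversal_trace 1 (e1 c 0) E (caQ 1) (cgQ 1).
have [u0 [u1 [u0E u1E uD]]] := reversed_trace 2 (e2 c 0) E (caQ 2) (cgQ 2).
have [l0 [l1 [l0E l1E lD]]] := reversed_trace 3 (e1 c 0) E (caQ 3) (cgQ 3).
have O0 : (0 : R) = 0 \/ (0 : R) = 1 by left.
have O1 : (1 : R) = 0 \/ (1 : R) = 1 by right.
have J0' i : jet_match (ca i) (cg i) (1 - 1) (d i) (tau i) (n i) by rewrite subrr.
have J1' i : jet_match (ca i) (cg i) (1 - 0) (d (i + 1)) (tau i) (n i) by rewrite subr0.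
have B0 := b1D 0 _ O0 (J0 0); rewrite t0 -e2E in B0.
have B1 := b1D 1 _ O1 (J1 0); rewrite t0 -e2E n0 in B1.
have R0 := r1D 0 _ O0 (J0 1); rewrite t1 -e1E in R0.
have R1 := r1D 1 _ O1 (J1 1); rewrite t1 -e1E n1 in R1.
have U1 := uD 1 _ O1 (J0' 2); rewrite t2 -e2E in U1.
have U0 := uD 0 _ O0 (J1' 2); rewrite t2 -e2E n2 in U0.
have L1 := lD 1 _ O1 (J0' 3); rewrite t3 -e1E in L1.
have L0 := lD 0 _ O0 (J1' 3); rewrite t3 -e1E n3 in L0.
have [|C [Csl Cq]] := @tensor_interpolation R p hp (sel (ca 0) b1) (sel u0 u1) (sel l0 l1) (sel (ca 1) r1) q.
  move=> i j i2 j2; split.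
  - exact: (cross_data_compat B0 L0).
  - exact: (cross_data_compat B1 R0).
  - exact: (cross_data_compat U0 L1).
  - exact: (cross_data_compat U1 R1).
have [/= sB0 sT0 sL0 sR0] := Csl 0%N isT; have [/= sB1 sT1 sL1 sR1] := Csl 1%N isT.
exists C; split => // i s s01; have s01' := rev01 s01.
have ss : 1 - (1 - s) = s by rewrite opprB addrC subrK.
have [u0E' _] := reflect_derive hp u0E; have [l0E' _] := reflect_derive hp l0E.
move: i; apply: (ord4 (P := fun i => let xi := @ref_side R i s in
    [/\ fd 0 0 C xi.1 xi.2 = lin 0 (ca i) s,
        fd 1 0 C xi.1 xi.2 = egrad c n i (ca i) (cg i) s (e1 c xi.2) &
        fd 0 1 C xi.1 xi.2 = egrad c n i (ca i) (cg i) s (e2 c xi.1)])) => /=; split.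
- by rewrite fd_slice2 sB0.
- by rewrite fd_slice2 sB0 -t0 egrad_tau.
- by rewrite fd_slice2 sB1 b1E // -e2E.
- by rewrite fd_slice1 sR0.
- by rewrite fd_slice1 sR1 r1E // -e1E.
- by rewrite fd_slice1 sR0 -t1 egrad_tau.
- by rewrite fd_slice2 sT0 u0E // ss.
- by rewrite fd_slice2 sT0 u0E' // ss -t2 egradN egrad_tau.
- by rewrite fd_slice2 sT1 u1E // ss -e2E.
- by rewrite fd_slice1 sL0 l0E // ss.
- by rewrite fd_slice1 sL1 l1E // ss -e1E.
- by rewrite fd_slice1 sL0 l0E' // ss -t3 egradN egrad_tau.
Qed.

Lemma local_existence (d : 'I_4 -> 'I_6 -> R) (e : 'I_4 -> R) (q : R -> R -> R) :
  exists phi : plane R -> R^o, [/\ loc_space p c n phi,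
    forall i k, vertex_dof Q (c i) k phi = d i k,
    forall i, cl_ext Q ('D_(n i) phi) (edge_pt c i (1 / 2)) = e i &
    forall x y, x \in eta_points R p -> y \in eta_points R p -> phi (bilin c (x, y)) = q x y].
Proof.
have /choice[ca caP] : forall i, exists ca : rV,
    (forall k, ~~ smooth_span p p.-1 (basi R k) -> ca 0 k = 0) /\
    ([/\ lin 0 ca 0 = d i 0, lin 1 ca 0 = dgrad (d i) (tau i) & lin 2 ca 0 = dhess (d i) (tau i) (tau i)] /\
    [/\ lin 0 ca 1 = d (i + 1) 0, lin 1 ca 1 = dgrad (d (i + 1)) (tau i) &
        lin 2 ca 1 = dhess (d (i + 1)) (tau i) (tau i)]).
  move=> i; have [ca ? ?] := @trace_interpolation R p hp (d i 0) (dgrad (d i) (tau i))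
    (dhess (d i) (tau i) (tau i)) (d (i + 1) 0) (dgrad (d (i + 1)) (tau i)) (dhess (d (i + 1)) (tau i) (tau i)).
  by exists ca.
have /choice[cg cgP] : forall i, exists cg : rV,
    (forall k, ~~ smooth_span p.-1 p.-2 (basi R k) -> cg 0 k = 0) /\
    [/\ lin 0 cg 0 = dgrad (d i) (n i), lin 1 cg 0 = dhess (d i) (n i) (tau i),
        lin 0 cg 1 = dgrad (d (i + 1)) (n i), lin 1 cg 1 = dhess (d (i + 1)) (n i) (tau i) &
        lin 0 cg (1 / 2) = e i].
  move=> i; have [cg ? ?] := @normal_interpolation R p hp (dgrad (d i) (n i)) (dhess (d i) (n i) (tau i))
    (dgrad (d (i + 1)) (n i)) (dhess (d (i + 1)) (n i) (tau i)) (e i).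
  by exists cg.
have J0 i : jet_match (ca i) (cg i) 0 (d i) (tau i) (n i).
  by have [_ [? _]] := caP i; have [_ []] := cgP i.
have J1 i : jet_match (ca i) (cg i) 1 (d (i + 1)) (tau i) (n i).
  by have [_ [_ ?]] := caP i; have [_ []] := cgP i.
have caQ i := (caP i).1; have cgQ i := (cgP i).1.
have em i : lin 0 (cg i) (1 / 2) = e i by have [_ []] := cgP i.
have [C [Cq Cb]] := tensor_from_traces q caQ cgQ J0 J1.
pose phi (x : plane R) : R^o := if `[< cl x >] then fd 0 0 C (inv_map c x).1 (inv_map c x).2 else 0.
have rC : tensor_rep c phi C.
  move=> xi sq; have clx := bilin_closure hc sq.
  by rewrite /phi asboolT // inv_mapK.
have tr i : edge_traces c n phi i (ca i) (cg i).
  split; [exact: caQ|exact: cgQ| |] => s s01; have sq := ref_side_sq i s01; have [F0 F1 F2] := Cb i s s01.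
    by rewrite -bilin_ref_side rC.
  rewrite -bilin_ref_side (cl_ext_grad hp hc _ rC) ?inv_mapK //; last exact: bilin_closure.
  have [x1 x2] := sq; rewrite (grad_dir_span hc _ x1 x2 (etrans F1 (egrad_dir _ _ _ _ _)) (etrans F2 (egrad_dir _ _ _ _ _))).
  by rewrite -egrad_dir egrad_normal.
have H01 : 0 <= (1 / 2 : R) <= 1 by apply/andP; split; lra.
exists phi; split.
- apply: (loc_space_intro hp hc _ rC) => [x nx|i]; first by rewrite /phi asboolF.
  by exists (ca i), (cg i).
- have V i := edge_jets hp hc rC (let: And4 _ _ H _ := tr i in H) (let: And4 _ _ _ H := tr i in H).
  move=> i k.
  (* Side [i] fixes the jet at its first corner except for one second derivative; that one is
     supplied by side [i - 1], which ends there. *)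
  have cr : crs (tau (i - 1)) (tau i) != 0 by rewrite subrK gt_eqF // consecutive_cross.
  have [[a0 a1 a2] [g0 g1]] := (V i).1; have [[x0 x1 x2] [y0 y1]] := J0 i.
  have [[b0 b1 b2] [h0 h1]] := (V (i - 1)).2; have [[z0 z1 z2] [w0 w1]] := J1 (i - 1).
  apply: (corner_jet_unique (d := fun k => vertex_dof Q (c i) k phi) (d' := d i) (frame_cross (hn1 i) (hn2 i) (tau_neq0 hc i)) cr).
  + by rewrite -a0.
  + by rewrite -a1.
  + by rewrite -g0.
  + by rewrite -a2.
  + by rewrite -g1.
  + by move: b2 z2; rewrite [i - 1 + 1]subrK => <- <-.
- by move=> i; case: (tr i) => _ _ _ ->.
- move=> x y xe ye; rewrite rC ?Cq //; split => //=; exact: (eta_in01 hp).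
Qed.

End LocalExistence.

(** * Gluing C^1 functions over finitely many closed pieces *)

Lemma cvg_cover (T : Type) (U : topologicalType) (F : set_system T) {FF : Filter F}
    (I : finType) (B : I -> set T) (f : T -> U) (l : U) :
  (forall i, f @ within (B i) F --> l) -> (\forall t \near F, exists i, B i t) -> f @ F --> l.
Proof.
move=> H cov P nP; have N : \forall t \near F, forall i, B i t -> P (f t).
  by apply: filter_forall => i; have := H i P nP; rewrite !nbhs_simpl /=.
rewrite nbhs_simpl /=; near=> t.
have [i Bi] : exists i, B i t by near: t; exact: cov.
by move: i Bi; near: t; exact: N.
Unshelve. all: by end_near. Qed.

Lemma cvg_within_false (T : Type) (U : topologicalType) (F : set_system T) {FF : Filter F}
    (B : set T) (f : T -> U) (l : U) : (forall t, ~ B t) -> f @ within B F --> l.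
Proof.
move=> nB P _; have : F (fun t => B t -> P (f t)) by apply: filterE => t /nB.
by [].
Qed.

Section Gluing.
Variables (R : realType) (V : normedModType R) (I : finType).
Variables (A : I -> set V) (O : set V) (f : I -> V -> R^o) (df : V -> I -> V -> R^o).
Hypothesis oO : open O.
Hypothesis cA : forall i, closed (A i).
Hypothesis cov : forall x, O x -> exists i, A i x.
Hypothesis fcont : forall i x, A i x -> f i y @[y --> within (A i) (nbhs x)] --> f i x.
Hypothesis dfcont : forall u i x, A i x -> df u i y @[y --> within (A i) (nbhs x)] --> df u i x.
Hypothesis fder : forall u i x, A i x -> wder (A i) (f i) x u (df u i x).
Hypothesis fcompat : forall i j x, A i x -> A j x -> f i x = f j x.
Hypothesis dfcompat : forall u i j x, A i x -> A j x -> df u i x = df u j x.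

Let glued (h : I -> V -> R^o) (x : V) : R^o :=
  if [pick i | `[< A i x >]] is Some i then h i x else 0.

Let gluedE h i x : (forall i j x, A i x -> A j x -> h i x = h j x) -> A i x -> glued h x = h i x.
Proof.
move=> hc Aix; rewrite /glued; case: pickP => [j /asboolP Aj|/(_ i)]; first exact: hc.
by rewrite asboolT.
Qed.

(** The pieces are closed and finite in number, so those that miss [x] miss a whole
    neighbourhood. *)
Let near_pieces x : \forall y \near x, forall i, A i y -> A i x.
Proof.
apply: filter_forall => i; have [Ax|nA] := pselect (A i x); first exact: filterE.
have : \forall y \near x, ~ A i y.
  by apply: open_nbhs_nbhs; split => //; exact: closed_openC.
by apply: filterS => y ny /ny.
Qed.

Let glued_cont (h : I -> V -> R^o) x : (forall i j x, A i x -> A j x -> h i x = h j x) ->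
  (forall i x, A i x -> h i y @[y --> within (A i) (nbhs x)] --> h i x) -> O x ->
  {for x, continuous (glued h)}.
Proof.
move=> hc hcont Ox; apply: (@cvg_cover _ _ _ _ I (fun i y => A i y /\ A i x)) => [i|].
  have [Ax|nA] := pselect (A i x); last first.
    by apply: cvg_within_false => y [].
  rewrite (gluedE hc Ax); apply: (cvg_ext (f := h i)).
    near=> y; have [Ay _] : A i y /\ A i x by near: y; exact: withinT.
    by rewrite (gluedE hc Ay).
  by apply: cvg_within_sub (hcont i x Ax) => y [].
near=> y; have Oy : O y by near: y; exact: open_nbhs_nbhs.
have [i Ay] := cov Oy; exists i; split => //.
by move: i Ay; near: y; exact: near_pieces.
Unshelve. all: by end_near. Qed.

Lemma glue_C1 : exists g : V -> R^o, (forall i x, A i x -> g x = f i x) /\ Ck 1 O g.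
Proof.
exists (glued f); split=> [i x|]; first exact: gluedE.
apply: Ck_intro => // [x Ox|u]; first exact: glued_cont.
exists (glued (df u)).
  by split => // x Ox; apply: glued_cont => //; [exact: dfcompat|exact: dfcont].
move=> x Ox; apply: (@wder_is_derive _ _ setT); first exact: filterT.
apply: cvg_within_filter.
have N : \forall h \near (0 : R)^', (fun h : R => O (h *: u + x)) h.
  by apply: (@line_cvg _ _ x u O); exact: open_nbhs_nbhs.
(* For small [h] every piece containing [h *: u + x] also contains [x]. The points between them need
   not lie in it, since [wder] compares end points only. *)
have N2 : \forall h \near (0 : R)^', forall i, A i (h *: u + x) -> A i x.
  exact: (@line_cvg _ _ x u (fun y => forall i, A i y -> A i x) (near_pieces x)).
apply: (@cvg_cover _ _ _ _ I (fun i (h : R) => A i (h *: u + x) /\ A i x)) => [i|].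
  have [Ax|nA] := pselect (A i x); last first.
    by apply: cvg_within_false => y [].
  rewrite (gluedE (dfcompat u) Ax).
  apply: (cvg_ext (f := fun h : R => h^-1 * (f i (h *: u + x) - f i x))).
    near=> h; have [Ah _] : A i (h *: u + x) /\ A i x.
      by near: h; exact: withinT.
    by rewrite (gluedE fcompat Ah) (gluedE fcompat Ax).
  move=> P HP; have := @fder u i x Ax P HP; rewrite !nbhs_simpl /= => W.
  have {}W : \forall h \near (0 : R)^', A i (h *: u + x) -> P (h^-1 * (f i (h *: u + x) - f i x)) by exact: W.
  by apply: filterS W => h H [Ah _]; exact: H.
near=> h; have Oh : O (h *: u + x) by near: h; exact: N.
have [i Ah] := cov Oh; exists i; split => //.
by move: i Ah; near: h; exact: N2.
Unshelve. all: by end_near. Qed.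

End Gluing.

(** * Linearity of the local spaces and functionals *)

Section Linearity.
Variables (R : realType) (p : nat).
Hypothesis hp : p \in [:: 3; 4; 5]%N.
Local Notation rV := 'rV[R]_(11 - p).
Local Notation mx := 'M[R]_(11 - p).
Variables (c : 'I_4 -> plane R) (n : 'I_4 -> plane R).
Hypothesis hc : ccw_convex c.
Local Notation Q := (open_quad c).
Local Notation cl := (closure (open_quad c)).
Implicit Types (f g : plane R -> R^o).

Definition lcomb (a : R) f g : plane R -> R^o := fun x => a * f x + g x.

Lemma tensor_rep_lin b a f g (C D : mx) : tensor_rep b f C -> tensor_rep b g D ->
  tensor_rep b (lcomb a f g) (a *: C + D).
Proof. by move=> rC rD xi sq; rewrite /lcomb rC // rD // fdD fdZ. Qed.

Lemma grad_dir_lin b u a (C D : mx) s t :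
  grad_dir b u (a *: C + D) s t = a * grad_dir b u C s t + grad_dir b u D s t.
Proof. by rewrite /grad_dir /grad_num !fdD !fdZ; ring. Qed.

Lemma hess_dir_lin b u v a (C D : mx) s t :
  hess_dir b v u (a *: C + D) s t = a * hess_dir b v u C s t + hess_dir b v u D s t.
Proof. by rewrite /hess_dir /grad_ds /grad_dt /grad_num !fdD !fdZ; ring. Qed.

(** [cl_ext] is a [lim], whose linearity relies on existing limits; the tensor representations
    provide them. *)
Lemma cl_ext_grad_lin a f g (C D : mx) u x : tensor_rep c f C -> tensor_rep c g D -> cl x ->
  cl_ext Q ('D_u (lcomb a f g)) x = a * cl_ext Q ('D_u f) x + cl_ext Q ('D_u g) x.
Proof.
move=> rC rD clx; rewrite (cl_ext_grad hp hc u (tensor_rep_lin a rC rD)) //.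
by rewrite (cl_ext_grad hp hc u rC) // (cl_ext_grad hp hc u rD) // grad_dir_lin.
Qed.

Lemma vertex_dof_lin a f g (C D : mx) i k : tensor_rep c f C -> tensor_rep c g D ->
  vertex_dof Q (c i) k (lcomb a f g) = a * vertex_dof Q (c i) k f + vertex_dof Q (c i) k g.
Proof.
move=> rC rD; have [h q [C' rC']] := rotn_facts hp i hc rC.
have [_ _ [D' rD']] := rotn_facts hp i hc rD.
have [r0 _] := edge_frame c i.
have [[f0 f1 f2] [f3 f4 f5]] := vertex_dof_corner hp h rC'.
have [[g0 g1 g2] [g3 g4 g5]] := vertex_dof_corner hp h rD'.
have [[s0 s1 s2] [s3 s4 s5]] := vertex_dof_corner hp h (tensor_rep_lin a rC' rD').
rewrite q r0 in f0 f1 f2 f3 f4 f5 g0 g1 g2 g3 g4 g5 s0 s1 s2 s3 s4 s5.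
move: k; apply: ord6; first by rewrite f0 g0 s0 fdD fdZ.
- by rewrite f1 g1 s1 grad_dir_lin.
- by rewrite f2 g2 s2 grad_dir_lin.
- by rewrite f3 g3 s3 hess_dir_lin.
- by rewrite f4 g4 s4 hess_dir_lin.
- by rewrite f5 g5 s5 hess_dir_lin.
Qed.

Lemma loc_space_lin a f g : loc_space p c n f -> loc_space p c n g -> loc_space p c n (lcomb a f g).
Proof.
move=> Lf Lg; have [C rC] := local_tensor_rep hp hc Lf; have [D rD] := local_tensor_rep hp hc Lg.
apply: (loc_space_intro hp hc _ (tensor_rep_lin a rC rD)) => [x nx|i].
  by case: Lf => /(_ x nx) E _ _ _ _; case: Lg => /(_ x nx) E' _ _ _ _; rewrite /lcomb E E' mulr0 addr0.
have [ca [cg [q1 q2 t1 t2]]] := local_edge_traces hp hc Lf i rC.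
have [da [dg [q3 q4 t3 t4]]] := local_edge_traces hp hc Lg i rD.
exists (a *: ca + da), (a *: cg + dg); split => [k Hk|k Hk|s s01|s s01].
- by rewrite !mxE q1 // q3 // mulr0 addr0.
- by rewrite !mxE q2 // q4 // mulr0 addr0.
- by rewrite /lcomb t1 // t3 // linD linZ.
- rewrite (cl_ext_grad_lin _ _ rC rD) ?t2 ?t4 ?linD ?linZ //.
  by rewrite -bilin_ref_side; apply: bilin_closure => //; exact: ref_side_sq.
Qed.

End Linearity.

(** * Dimension from a unisolvent family of functionals *)

Section DualBasis.
Variables (R : realType) (V : lmodType R) (I : finType) (S : set V) (l : I -> V -> R).
Hypothesis S0 : S 0.
Hypothesis Slin : forall (a : R) v w, S v -> S w -> S (a *: v + w).
Hypothesis llin : forall i (a : R) v w, S v -> S w -> l i (a *: v + w) = a * l i v + l i w.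
Hypothesis linj : forall v, S v -> (forall i, l i v = 0) -> v = 0.
Hypothesis lsurj : forall d : I -> R, exists2 v, S v & forall i, l i v = d i.

(** The basis is the dual one. The functionals are linear on [S] only, so every combination is shown
    to lie in [S] together with its values. *)
Lemma has_dim_dual : has_dim S #|I|.
Proof.
have /choice[b bP] : forall k : 'I_#|I|, exists v, S v /\ forall i, l i v = (i == enum_val k)%:R.
  by move=> k; have [v Sv lv] := lsurj (fun i => (i == enum_val k)%:R); exists v.
have l0 i : l i 0 = 0.
  by have := llin i (-1) S0 S0; rewrite scaler0 addr0 mulN1r addNr.
have sumP (s : seq 'I_#|I|) (a : 'I_#|I| -> R) : S (\sum_(k <- s) a k *: b k) /\
    forall i, l i (\sum_(k <- s) a k *: b k) = \sum_(k <- s) a k * (i == enum_val k)%:R.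
  elim: s => [|k s [IS Il]]; first by split=> [|i]; rewrite !big_nil.
  have [Sb lb] := bP k; split=> [|i]; rewrite !big_cons; first exact: Slin.
  by rewrite llin // lb Il.
have lE a i : l i (\sum_k a k *: b k) = a (enum_rank i).
  rewrite (sumP _ a).2 (bigD1 (enum_rank i)) //= enum_rankK eqxx mulr1 big1 ?addr0 // => k.
  by rewrite -(inj_eq enum_val_inj) enum_rankK eq_sym => /negbTE ->; rewrite mulr0.
exists b; split=> [a a0 k|].
  by have := lE a (enum_val k); rewrite a0 l0 enum_valK.
apply/seteqP; split=> [v Sv|_ [a ->]]; last exact: (sumP _ a).1.
exists (fun k => l (enum_val k) v).
set w := \sum_k _; have Sw : S w by exact: (sumP _ _).1.
have wE i : l i w = l i v by rewrite lE enum_rankK.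
have Nw : S (- w) by rewrite -[- w]addr0 -scaleN1r; exact: Slin.
have Sd : S (1 *: v + - w) by exact: Slin.
apply/eqP; rewrite -subr_eq0 -[v in v - w]scale1r; apply/eqP; apply: linj => // i.
rewrite llin // -[- w]addr0 -scaleN1r llin // l0 addr0 wE mul1r mulN1r subrr //.
Qed.

End DualBasis.

(** * The global space *)

Section SegmentData.
Variables (R : realType) (p : nat).
Hypothesis hp : p \in [:: 3; 4; 5]%N.
Local Notation rV := 'rV[R]_(11 - p).
Implicit Types (Q : set (plane R)) (phi : plane R -> R^o) (a b m u : plane R).

Definition segpt a b (s : R) : plane R := (1 - s) *: a + s *: b.

Lemma segpt_rev a b s : segpt b a s = segpt a b (1 - s).
Proof. by apply: plane_eqP; rewrite !mxE; ring. Qed.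

(** Stated through end points rather than a side index, because two neighbours number their common
    side differently and may traverse it in opposite directions. *)
Definition seg_data Q m phi a b : Prop := exists ca cg : rV,
  [/\ forall k, ~~ smooth_span p p.-1 (basi R k) -> ca 0 k = 0,
      forall k, ~~ smooth_span p.-1 p.-2 (basi R k) -> cg 0 k = 0,
      forall s, 0 <= s <= 1 -> phi (segpt a b s) = lin 0 ca s,
      forall s u, 0 <= s <= 1 -> cl_ext Q ('D_u phi) (segpt a b s) =
        dotp u m * lin 0 cg s + dotp u (b - a) / dotp (b - a) (b - a) * lin 1 ca s &
      jet_match ca cg 0 (fun k => vertex_dof Q a k phi) (b - a) m /\
      jet_match ca cg 1 (fun k => vertex_dof Q b k phi) (b - a) m].

Lemma dgradN (d : 'I_6 -> R) u : dgrad d (- u) = - dgrad d u.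
Proof. by rewrite /dgrad !mxE; ring. Qed.

Lemma dhessN (d : 'I_6 -> R) u m : dhess d u (- m) = - dhess d u m.
Proof. by rewrite /dhess !mxE; ring. Qed.

Lemma jet_match_rev (ca cg ca' cg' : rV) (d : 'I_6 -> R) (x : R) (t m : plane R) :
  (forall s, 0 <= s <= 1 -> lin 0 ca' s = lin 0 ca (1 - s)) ->
  (forall s, 0 <= s <= 1 -> lin 0 cg' s = lin 0 cg (1 - s)) -> x = 0 \/ x = 1 ->
  jet_match ca cg (1 - x) d t m -> jet_match ca' cg' x d (- t) m.
Proof.
move=> caR cgR x01 [[a0 a1 a2] [g0 g1]].
have [r1 r2] := reflect_derive hp caR; have [q1 _] := reflect_derive hp cgR.
have caR' s : 0 <= s <= 1 -> lin 0 ca s = lin 0 ca' (1 - s).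
  by move=> s01; rewrite caR ?rev01 // opprB addrC subrK.
have [_ r2'] := reflect_derive hp caR'.
have I : 0 <= x <= 1 by case: x01 => ->; rewrite lexx ler01.
have r2x : lin 2 ca' x = lin 2 ca (1 - x) by case: x01 => ->; rewrite ?subr0 ?subrr.
split; split.
- by rewrite caR.
- by rewrite r1 // a1 dgradN.
- by rewrite r2x a2 dhessN dhessC dhessN opprK.
- by rewrite cgR.
- by rewrite q1 // g1 dhessN.
Qed.

Lemma seg_data_sym Q m phi a b : seg_data Q m phi a b -> seg_data Q m phi b a.
Proof.
move=> [ca [cg [caQ cgQ caE cgE [j0 j1]]]].
have pb : (2 < p < 6)%N by move: hp; rewrite !inE => /or3P[] /eqP ->.
have [||ca' caQ' caR] := @lin_reflect R p hp p p.-1 ca _ _ caQ; try lia.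
have [||cg' cgQ' cgR] := @lin_reflect R p hp p.-1 p.-2 cg _ _ cgQ; try lia.
have [r1 _] := reflect_derive hp caR.
have tE : a - b = - (b - a) by rewrite opprB.
exists ca', cg'; split; [exact: caQ'|exact: cgQ'| | |split; rewrite tE].
- by move=> s s01; rewrite segpt_rev caE ?rev01 // caR.
- move=> s u s01; have := cgE (1 - s) u (rev01 s01); rewrite -segpt_rev => ->.
  rewrite cgR // r1 // tE.
  have -> : dotp u (- (b - a)) = - dotp u (b - a) by rewrite /dotp !mxE; ring.
  have -> : dotp (- (b - a)) (- (b - a)) = dotp (b - a) (b - a) by rewrite /dotp !mxE; ring.
  by ring.
- by apply: (jet_match_rev caR cgR); [left|rewrite subr0; exact: j1].
- by apply: (jet_match_rev caR cgR); [right|rewrite subrr; exact: j0].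
Qed.

Lemma seg_data_match Q Q' m phi phi' a b : dotp m m = 1 -> dotp m (b - a) = 0 ->
  seg_data Q m phi a b -> seg_data Q' m phi' a b ->
  (forall k, vertex_dof Q a k phi = vertex_dof Q' a k phi') ->
  (forall k, vertex_dof Q b k phi = vertex_dof Q' b k phi') ->
  cl_ext Q ('D_m phi) (segpt a b (1 / 2)) = cl_ext Q' ('D_m phi') (segpt a b (1 / 2)) ->
  forall s, 0 <= s <= 1 -> phi (segpt a b s) = phi' (segpt a b s) /\
    forall u, cl_ext Q ('D_u phi) (segpt a b s) = cl_ext Q' ('D_u phi') (segpt a b s).
Proof.
move=> mm mt [ca [cg [caQ cgQ caE cgE [j0 j1]]]] [ca' [cg' [caQ' cgQ' caE' cgE' [j0' j1']]]] da db e.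
have da' : (fun k => vertex_dof Q a k phi) = (fun k => vertex_dof Q' a k phi') by apply/funext.
have db' : (fun k => vertex_dof Q b k phi) = (fun k => vertex_dof Q' b k phi') by apply/funext.
rewrite da' in j0; rewrite db' in j1.
have H01 : 0 <= (1 / 2 : R) <= 1 by apply/andP; split; lra.
have [] := jets_determine hp caQ cgQ caQ' cgQ' j0 j1 j0' j1'.
  have := cgE (1 / 2) m H01; have := cgE' (1 / 2) m H01; rewrite e => -> /esym.
  by rewrite mm mt !mul0r !mul1r !addr0.
move=> Ea Eg s s01; rewrite -Ea in caE' cgE'; rewrite -Eg in cgE'; split=> [|u].
  by rewrite (caE s s01) (caE' s s01).
by rewrite (cgE s u s01) (cgE' s u s01).
Qed.

Section Element.
Variables (c : 'I_4 -> plane R) (n : 'I_4 -> plane R).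
Hypothesis hc : ccw_convex c.
Local Notation tau := (fun i => c (i + 1) - c i).
Hypothesis hn1 : forall i, dotp (n i) (n i) = 1.
Hypothesis hn2 : forall i, dotp (n i) (tau i) = 0.

Lemma loc_seg_data phi i : loc_space p c n phi ->
  seg_data (open_quad c) (n i) phi (c i) (c (i + 1)).
Proof.
move=> L; have [C rC] := local_tensor_rep hp hc L.
have [ca [cg tr]] := local_edge_traces hp hc L i rC.
have [q1 q2 t1 t2] := tr; exists ca, cg; split => //.
  by move=> s u s01; rewrite -/(edge_pt c i s) (edge_gradient hp hc hn1 hn2 rC tr).
exact: (edge_jets hp hc rC t1 t2).
Qed.

Lemma vertex_gradient phi i u : loc_space p c n phi ->
  cl_ext (open_quad c) ('D_u phi) (c i) = dgrad (fun k => vertex_dof (open_quad c) (c i) k phi) u.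
Proof.
move=> /(loc_seg_data i)[ca [cg [_ _ _ gE [[[_ a1 _] [g0 _]] _]]]].
have := gE 0 u; rewrite lexx ler01 => /(_ isT).
have -> : segpt (c i) (c (i + 1)) 0 = c i by rewrite /segpt subr0 scale1r scale0r addr0.
by move=> ->; rewrite a1 g0 [RHS](dgrad_frame hc hn1 hn2 _ i).
Qed.

End Element.
End SegmentData.

(** * Open segments and the boundary of a quadrilateral *)

Section MeshGeometry.
Variable R : realType.
Implicit Types (a b x : plane R).

Lemma open_segmentP a b x : open_segment a b x <-> exists2 s, 0 < s < 1 & x = segpt a b s.
Proof.
split=> [[s]|[s s01 ->]]; first by rewrite /= in_itv /= => s01 <-; exists s.
by exists s => //; rewrite /= in_itv.
Qed.

Lemma segptE a b s : segpt a b s = a + s *: (b - a).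
Proof. by apply: plane_eqP; rewrite !mxE; ring. Qed.

Lemma segpt_inj a b : a != b -> injective (segpt a b).
Proof.
move=> ab s t; rewrite !segptE => /addrI /eqP; rewrite -subr_eq0 -scalerBl scaler_eq0.
by rewrite !subr_eq0 [b == a]eq_sym (negbTE ab) orbF => /eqP.
Qed.

(** Starting outside [0, 1], the affine function would reach 0 or 1 at a parameter strictly between
    0 and 1. *)
Lemma affine_in01 (x y : R) : (forall t, 0 < t < 1 -> 0 < x + t * (y - x) < 1) -> 0 <= x <= 1.
Proof.
move=> H; have h2 : 0 < (1 / 2 : R) < 1 by apply/andP; split; lra.
have /andP[m0 m1] := H _ h2; apply/andP; split; rewrite leNgt; apply/negP => xb.
  have y0 : 0 < y by lra.
  have d0 : 0 < y - x by lra.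
  have /H /andP[] : 0 < - x / (y - x) < 1.
    by rewrite divr_gt0 ?oppr_gt0 // ltr_pdivrMr // mul1r ltrDr.
  by rewrite divfK ?gt_eqF // addrN ltxx.
have d0 : 0 < x - y by lra.
have /H /andP[_] : 0 < (x - 1) / (x - y) < 1.
  apply/andP; split; first by rewrite divr_gt0 // subr_gt0.
  by rewrite ltr_pdivrMr // mul1r; lra.
have -> : x + (x - 1) / (x - y) * (y - x) = 1.
  by rewrite -(opprB x y) mulrN divfK ?gt_eqF //; ring.
by rewrite ltxx.
Qed.

(** The parameter of [a'] on the line through [a] and [b] lies in [0, 1] by [affine_in01], but not
    inside, because the common open segment omits its own end point [a']. *)
Lemma open_segment_endpoint a b a' b' : a != b -> a' != b' ->
  open_segment a b = open_segment a' b' -> a' = a \/ a' = b.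
Proof.
move=> ab ab' E.
have P s : 0 < s < 1 -> exists2 t, 0 < t < 1 & segpt a' b' s = segpt a b t.
  by move=> s01; apply/open_segmentP; rewrite E; apply/open_segmentP; exists s.
have [|t1 t1i E1] := P (1 / 3); first by apply/andP; split; lra.
have [|t2 t2i E2] := P (2 / 3); first by apply/andP; split; lra.
(* Linear extrapolation from the points at 1/3 and 2/3 to the two end points. *)
pose al := 2 * t1 - t2; pose be := 2 * t2 - t1.
have aE : a' = segpt a b al.
  have -> : a' = 2 *: segpt a' b' (1 / 3) - segpt a' b' (2 / 3).
    by apply: plane_eqP; rewrite !mxE; field.
  by rewrite E1 E2; apply: plane_eqP; rewrite !mxE /al; ring.
have bE : b' = segpt a b be.
  have -> : b' = 2 *: segpt a' b' (2 / 3) - segpt a' b' (1 / 3).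
    by apply: plane_eqP; rewrite !mxE; field.
  by rewrite E1 E2; apply: plane_eqP; rewrite !mxE /be; ring.
have al01 : 0 <= al <= 1.
  apply: (@affine_in01 al be) => s /P[t t01].
  have -> : segpt a' b' s = segpt a b (al + s * (be - al)).
    by rewrite aE bE; apply: plane_eqP; rewrite !mxE; ring.
  by move=> /(segpt_inj ab) ->.
have nal : ~ (0 < al < 1).
  move=> al'; have : open_segment a' b' a' by rewrite -E; apply/open_segmentP; exists al.
  move=> /open_segmentP[s /andP[s0 _]].
  have {1}-> : a' = segpt a' b' 0 by rewrite segptE scale0r addr0.
  by move=> /(segpt_inj ab') E0; move: s0; rewrite -E0 ltxx.
have : al = 0 \/ al = 1.
  case/andP: al01; rewrite le_eqVlt => /orP[/eqP <-|a0]; first by left.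
  by rewrite le_eqVlt => /orP[/eqP ->|a1]; [right|case: nal; rewrite a0].
by rewrite aE segptE => -[] ->; [left; rewrite scale0r addr0|right; rewrite scale1r addrC subrK].
Qed.

Lemma open_segment_ends a b a' b' : a != b -> a' != b' ->
  open_segment a b = open_segment a' b' -> (a' = a /\ b' = b) \/ (a' = b /\ b' = a).
Proof.
have sym x y : open_segment x y = open_segment y x.
  have R01 (s : R) : 0 < s < 1 -> 0 < 1 - s < 1 by rewrite subr_gt0 ltrBlDr ltrDl andbC.
  apply/seteqP; split=> z /open_segmentP[s s01 ->]; apply/open_segmentP; exists (1 - s); rewrite ?R01 //.
    by rewrite -segpt_rev.
  by rewrite -segpt_rev.
move=> ab ab' E; have Ea := open_segment_endpoint ab ab' E.
have ba' : b' != a' by rewrite eq_sym.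
have Eb := open_segment_endpoint ab ba' (etrans E (sym _ _)).
case: Ea Eb => Ea [] Eb; [|by left|by right|]; by move: ab'; rewrite Ea Eb eqxx.
Qed.

Lemma open_segment_not_point a b v : a != b -> open_segment a b <> [set v].
Proof.
move=> ab E.
have P s : 0 < s < 1 -> segpt a b s = v.
  move=> s01; have : open_segment a b (segpt a b s) by apply/open_segmentP; exists s.
  by rewrite E.
have : (1 / 3 : R) = 2 / 3.
  apply: (segpt_inj ab); rewrite !P //; apply/andP; split; lra.
lra.
Qed.

Lemma closure_quad_cases (c : 'I_4 -> plane R) x : ccw_convex c -> closure (open_quad c) x ->
  [\/ open_quad c x, exists i, quad_side c i x | exists i, x = c i].
Proof.
move=> hc; rewrite closure_quad // => -[xi [x1 x2] <-].
have E i s : bilin c (ref_side i s) = segpt (c i) (c (i + 1)) s by rewrite bilin_ref_side.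
have B i s : 0 <= s <= 1 -> [\/ open_quad c (bilin c (ref_side i s)), exists i0, quad_side c i0 (bilin c (ref_side i s)) |
     exists i0, bilin c (ref_side i s) = c i0].
  rewrite E => /andP[]; rewrite le_eqVlt => /orP[/eqP <- _|s0].
    by constructor 3; exists i; rewrite segptE scale0r addr0.
  rewrite le_eqVlt => /orP[/eqP ->|s1].
    by constructor 3; exists (i + 1); rewrite segptE scale1r addrC subrK.
  by constructor 2; exists i; apply/open_segmentP; exists s => //; rewrite s0.
case: xi x1 x2 => y z /= y01 z01.
have [y0|y0] := eqVneq y 0.
  have -> : (y, z) = ref_side 3 (1 - z) by rewrite /ref_side /= y0 opprB addrC subrK.
  by apply: B; exact: rev01.
have [y1|y1] := eqVneq y 1.
  have -> : (y, z) = ref_side 1 z by rewrite /ref_side /= y1.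
  exact: B.
have [z0|z0] := eqVneq z 0.
  have -> : (y, z) = ref_side 0 y by rewrite /ref_side /= z0.
  exact: B.
have [z1|z1] := eqVneq z 1.
  have -> : (y, z) = ref_side 2 (1 - y) by rewrite /ref_side /= z1 opprB addrC subrK.
  by apply: B; exact: rev01.
constructor 1; apply/(open_quadP hc); exists (y, z) => //.
by case/andP: y01 => ? ?; case/andP: z01 => ? ?; split; rewrite /= !lt_neqAle ?[0 == _]eq_sym; apply/andP; split; apply/andP.
Qed.

End MeshGeometry.

Section LocalRegularity.
Variables (R : realType) (p : nat).
Hypothesis hp : p \in [:: 3; 4; 5]%N.
Variables (c : 'I_4 -> plane R) (n : 'I_4 -> plane R).
Hypothesis hc : ccw_convex c.
Local Notation Q := (open_quad c).
Local Notation cl := (closure (open_quad c)).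

Lemma loc_space_regular phi x : loc_space p c n phi -> cl x ->
  [/\ phi y @[y --> within cl (nbhs x)] --> phi x,
      forall u, cl_ext Q ('D_u phi) y @[y --> within cl (nbhs x)] --> cl_ext Q ('D_u phi) x &
      forall u, wder cl phi x u (cl_ext Q ('D_u phi) x)].
Proof.
move=> L clx; have [C rC] := local_tensor_rep hp hc L.
have phiE y : cl y -> fd 0 0 C (inv_map c y).1 (inv_map c y).2 = phi y.
  by move=> /(inv_mapP hc)[sq E]; rewrite -[in RHS]E rC.
have [[/andP[x1 _] /andP[x2 _]] _] := inv_mapP hc clx.
split=> [|u|u].
- rewrite -(phiE x clx); apply: (cvg_ext (f := fun y => fd 0 0 C (inv_map c y).1 (inv_map c y).2)).
    by near=> y; apply: phiE; near: y; exact: withinT.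
  by apply: (fd_cvg hp) => //; [left|left|exact: inv_map_cvg1|exact: inv_map_cvg2].
- rewrite (cl_ext_grad hp hc u rC clx).
  apply: (cvg_ext (f := fun y => grad_dir c u C (inv_map c y).1 (inv_map c y).2)).
    near=> y; rewrite (cl_ext_grad hp hc u rC) //; near: y; exact: withinT.
  exact: grad_dir_inv.
- by rewrite (cl_ext_grad hp hc u rC clx); apply: wder_rep.
Unshelve. all: by end_near. Qed.

End LocalRegularity.

(** * Agreement of neighbouring elements and C^1 continuity *)

Section OnMesh.
Variables (R : realType) (p : nat).
Hypothesis hp : p \in [:: 3; 4; 5]%N.
Variables (Omega : set (plane R)) (M : quad_mesh Omega).
Local Notation qc Q := (corner M (val Q)).
Implicit Types (Q : elements M) (phi : elements M -> plane R -> R^o).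

Definition side_normal (Q : set (plane R)) (i : 'I_4) : plane R := normal M (side M Q i).

Lemma element_convex Q : ccw_convex (qc Q).
Proof. by have [] := element_quad (fsvalP Q). Qed.

Lemma elementE Q : val Q = open_quad (qc Q).
Proof. by have [] := element_quad (fsvalP Q). Qed.

Lemma corner_neq Q i : qc Q i != qc Q (i + 1).
Proof. by rewrite eq_sym -subr_eq0; exact: tau_neq0 (element_convex Q) i. Qed.

Lemma side_frame Q i :
  [/\ dotp (side_normal (val Q) i) (side_normal (val Q) i) = 1,
      dotp (side_normal (val Q) i) (qc Q (i + 1) - qc Q i) = 0 &
      midpoint M (side M (val Q) i) = edge_pt (qc Q) i (1 / 2)].
Proof.
have eM : side M (val Q) i \in edges M by exact: element_side (fsvalP Q).
have [_ _ ab E] := edge_segment eM.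
have nn := normal_unit eM; have nt := normal_orth eM.
have hh : (1 / 2 : R) = 2^-1 by rewrite mul1r.
have h1 : (1 - 2^-1 : R) = 2^-1 by field.
have [[Ea Eb]|[Ea Eb]] := open_segment_ends ab (corner_neq Q i) (esym E).
  split; first by rewrite /dotp -!expr2.
    by rewrite Ea Eb /dotp !mxE.
  by rewrite /midpoint /edge_pt Ea Eb hh h1 scalerDr.
split; first by rewrite /dotp -!expr2.
  by rewrite Ea Eb -[RHS]oppr0 -nt /dotp !mxE; ring.
by rewrite /midpoint /edge_pt Ea Eb hh h1 scalerDr addrC.
Qed.

Let n1 Q i := let: And3 H _ _ := side_frame Q i in H.
Let n2 Q i := let: And3 _ H _ := side_frame Q i in H.

Lemma local_spaceE Q f :
  local_space M p (val Q) f <-> loc_space p (qc Q) (side_normal (val Q)) f.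
Proof.
have QE := elementE Q; rewrite /local_space.
have dnE i x : dnormal M (val Q) (side M (val Q) i) f x =
    cl_ext (open_quad (qc Q)) ('D_(side_normal (val Q) i) f) x by rewrite -QE.
have clE : on_closure (val Q) f = (forall x, ~ closure (open_quad (qc Q)) x -> f x = 0).
  by rewrite -QE.
have CkE : Ck (p - 2) (val Q) f = Ck (p - 2) (open_quad (qc Q)) f by rewrite -QE.
case: eqVneq => [p5|p5].
  subst p; rewrite /local_space5 /loc_space clE.
  have S0 (a b : 'I_(6 - 5)) : @subsquare R _ a b = `[0, 1]%classic `*` `[0, 1]%classic.
    have a0 (d : 'I_(6 - 5)) : (d : nat) = 0%N by case: d => [[|]].
    by rewrite /subsquare !a0 mul0r divr1.
  have i0 : 'I_(6 - 5) by exact: (Ordinal (isT : (0 < 6 - 5)%N)).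
  have IE i : (`]0, 1[%classic `&` @ref_side R i @^-1` (`[0, 1]%classic `*` `[0, 1]%classic)) = `]0, 1[%classic :> set R.
    apply/seteqP; split=> s; first by case.
    move=> s01; split => //; have : 0 <= s <= 1.
      by move: s01 => /segment01o /andP[? ?]; rewrite !ltW.
    by move=> /(ref_side_sq i)[x1 x2]; split; exact/segment01P.
  have dE i : dnormal M (val Q) (side M (val Q) i) f \o param M (val Q) \o ref_side i =
    cl_ext (open_quad (qc Q)) ('D_(side_normal (val Q) i) f) \o bilin (qc Q) \o ref_side i.
    by apply/funext => s; exact: dnE.
  split=> [[h1 h2 h3]|[h1 _ h2 _ h3]]; split=> //.
  - by move=> a b; rewrite S0.
  - by move=> i a b; rewrite S0 IE -dE.
  - by have := h2 i0 i0; rewrite S0.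
  - by move=> i; have := h3 i i0 i0; rewrite S0 IE dE.
have p5' : (p < 5)%N by move: hp p5; rewrite !inE => /or3P[] /eqP ->.
have dE i : dnormal M (val Q) (side M (val Q) i) f \o param M (val Q) \o ref_side i =
    cl_ext (open_quad (qc Q)) ('D_(side_normal (val Q) i) f) \o bilin (qc Q) \o ref_side i.
  by apply/funext => s; exact: dnE.
rewrite /local_space34 /loc_space clE CkE.
split=> [[h1 h2 h3 h4 h5]|[h1 h2 h3 h4 h5]]; split=> //.
- by move=> i a b; rewrite -dE.
- exact: h2.
- exact: h4.
- by move=> i a b; rewrite dE.
Qed.

Lemma edge_dofE Q i f : edge_dof M (val Q) (side M (val Q) i) f =
  cl_ext (open_quad (qc Q)) ('D_(side_normal (val Q) i) f) (edge_pt (qc Q) i (1 / 2)).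
Proof. by have [_ _ mE] := side_frame Q i; rewrite /edge_dof mE -elementE. Qed.

Let members : set (set (plane R)) :=
  [set` elements M] `|` [set` edges M] `|` [set [set v] | v in [set` vertices M]].

Lemma global_dof_lin a phi psi Q : global_space M p phi -> global_space M p psi ->
  (forall i k, vertex_dof (val Q) (qc Q i) k ((a *: phi + psi) Q) =
     a * vertex_dof (val Q) (qc Q i) k (phi Q) + vertex_dof (val Q) (qc Q i) k (psi Q)) /\
  (forall i, edge_dof M (val Q) (side M (val Q) i) ((a *: phi + psi) Q) =
     a * edge_dof M (val Q) (side M (val Q) i) (phi Q) + edge_dof M (val Q) (side M (val Q) i) (psi Q)).
Proof.
move=> [L _ _] [L' _ _].
have [C rC] := local_tensor_rep hp (element_convex Q) ((local_spaceE Q _).1 (L Q)).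
have [D rD] := local_tensor_rep hp (element_convex Q) ((local_spaceE Q _).1 (L' Q)).
split=> [i k|i].
  by have := vertex_dof_lin hp (element_convex Q) a i k rC rD; rewrite -elementE.
rewrite !edge_dofE; apply: (cl_ext_grad_lin hp (element_convex Q) a _ rC rD).
rewrite -bilin_ref_side; apply: (bilin_closure (element_convex Q)); apply: ref_side_sq.
by apply/andP; split; lra.
Qed.

Lemma members_disjoint (A B : set (plane R)) x  : members A -> members B ->
  A x -> B x -> A = B.
Proof. by move=> hA hB Ax Bx; apply: (mesh_disjoint hA hB); exists x. Qed.

Lemma element_member Q  : members (val Q).
Proof. by left; left; exact: fsvalP. Qed.

Lemma side_member Q i  : members (side M (val Q) i).
Proof. by left; right; exact: element_side (fsvalP Q). Qed.

Lemma corner_member Q i  : members [set qc Q i].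
Proof. by right; exists (qc Q i) => //; exact: element_corner (fsvalP Q). Qed.

(** An open element that meets the closure of another also meets that element itself, which
    disjointness forbids for different ones. *)
Lemma element_disjoint Q Q' x : val Q x -> closure (val Q') x -> Q = Q'.
Proof.
move=> Qx clx; have oQ : open (val Q) by rewrite elementE; exact: open_open_quad.
have [y [Q'y Qy]] := clx _ (open_nbhs_nbhs (conj oQ Qx)).
by apply: val_inj; exact: (members_disjoint (element_member Q) (element_member Q') Qy Q'y).
Qed.

Lemma global_seg_data phi Q i : global_space M p phi ->
  seg_data p (val Q) (side_normal (val Q) i) (phi Q) (qc Q i) (qc Q (i + 1)).
Proof.
move=> [L _ _]; have /local_spaceE LQ := L Q.
by have := loc_seg_data hp (element_convex Q) (n1 Q) (n2 Q) i LQ; rewrite -elementE.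
Qed.

Lemma global_vertex_gradient phi Q i u x : global_space M p phi -> x = qc Q i ->
  cl_ext (val Q) ('D_u (phi Q)) x = dgrad (fun k => vertex_dof (val Q) x k (phi Q)) u.
Proof.
move=> [L _ _] ->; have /local_spaceE LQ := L Q.
by have := vertex_gradient hp (element_convex Q) (n1 Q) (n2 Q) i u LQ; rewrite -elementE.
Qed.

Lemma side_cases Q Q' i i' : side M (val Q) i = side M (val Q') i' ->
  (qc Q' i' = qc Q i /\ qc Q' (i' + 1) = qc Q (i + 1)) \/
  (qc Q' i' = qc Q (i + 1) /\ qc Q' (i' + 1) = qc Q i).
Proof. exact: open_segment_ends (corner_neq Q i) (corner_neq Q' i'). Qed.

(** Between different elements, disjointness of the mesh members leaves two cases: a point inside a
    common edge, settled by the edge data, or a common vertex, settled by the vertex values. A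
    vertex of one inside a side of the other is impossible, an open segment not being a point. *)
Lemma overlap phi Q Q' x : global_space M p phi -> closure (val Q) x -> closure (val Q') x ->
  phi Q x = phi Q' x /\
  forall u, cl_ext (val Q) ('D_u (phi Q)) x = cl_ext (val Q') ('D_u (phi Q')) x.
Proof.
move=> G clx clx'; have [L V E] := G.
have [->//|QQ] := pselect (Q = Q').
have := clx; rewrite {1}(elementE Q) => /(closure_quad_cases (element_convex Q)) HQ.
have := clx'; rewrite {1}(elementE Q') => /(closure_quad_cases (element_convex Q')) HQ'.
case: HQ => [Qx|[i ix]|[i xi]].
- by case: QQ; apply: (element_disjoint _ clx'); rewrite elementE.
- case: HQ' => [Qx'|[i' ix']|[i' xi']].
  + by case: QQ; apply/esym; apply: (element_disjoint _ clx); rewrite elementE.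
  + have SE := members_disjoint (side_member Q i) (side_member Q' i') ix ix'.
    have D := global_seg_data Q i G; have D' := global_seg_data Q' i' G.
    rewrite /side_normal -SE -/(side_normal (val Q) i) in D'.
    have {}D' : seg_data p (val Q') (side_normal (val Q) i) (phi Q') (qc Q i) (qc Q (i + 1)).
      by have [[<- <-]|[<- <-]] := side_cases SE; [exact: D'|exact: (seg_data_sym hp D')].
    have [a1 [b1 [Ea Eb]]] : exists j k, qc Q i = qc Q' j /\ qc Q (i + 1) = qc Q' k.
      by have [[Ea Eb]|[Ea Eb]] := side_cases SE; [exists i', (i' + 1)|exists (i' + 1), i'].
    have [_ _ mE] := side_frame Q i.
    have := E Q Q' _ _ _ erefl SE; rewrite /edge_dof mE => e.
    have := seg_data_match hp (n1 Q i) (n2 Q i) D D' (V Q Q' _ i a1 erefl Ea) (V Q Q' _ (i + 1) b1 erefl Eb) e.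
    move=> H; have /open_segmentP[s /andP[s0 s1] ->] := ix.
    by apply: H; rewrite !ltW.
  + have := members_disjoint (side_member Q i) (corner_member Q' i') ix xi'.
    by move=> /open_segment_not_point; have := corner_neq Q i.
- case: HQ' => [Qx'|[i' ix']|[i' xi']].
  + by case: QQ; apply/esym; apply: (element_disjoint _ clx); rewrite elementE.
  + have := members_disjoint (side_member Q' i') (corner_member Q i) ix' xi.
    by move=> /open_segment_not_point; have := corner_neq Q' i'.
  + have VE := V Q Q' x i i' xi xi'; split; first exact: (VE 0).
    move=> u; rewrite (global_vertex_gradient u G xi) (global_vertex_gradient u G xi').
    exact: (congr1 (fun d => dgrad d u) (funext VE)).
Qed.

Lemma global_space_C1 phi : open Omega -> global_space M p phi -> piecewise_C1 phi.
Proof.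
move=> oO G; have [L _ _] := G.
have reg Q x : closure (val Q) x -> _ := fun clx =>
  loc_space_regular hp (element_convex Q) ((local_spaceE Q (phi Q)).1 (L Q)) (eq_ind _ (fun A => closure A x) clx _ (elementE Q)).
have [||x Ox||||||g [gE Cg]] := @glue_C1 R (plane R) (elements M) (fun Q => closure (val Q)) Omega phi
   (fun u Q x => cl_ext (val Q) ('D_u (phi Q)) x).
- exact: oO.
- by move=> Q; exact: closed_closure.
- have := @subset_closure _ Omega x Ox; rewrite (mesh_cover M) => -[Q QM clx].
  by exists [` QM]%fset.
- by move=> Q x clx; have [] := reg Q x clx; rewrite -elementE.
- by move=> u Q x clx; have [_ + _] := reg Q x clx; rewrite -elementE; exact.
- by move=> u Q x clx; have [_ _] := reg Q x clx; rewrite -elementE; exact.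
- by move=> Q Q' x clx clx'; have [] := overlap G clx clx'.
- by move=> u Q Q' x clx clx'; have [_] := overlap G clx clx'; exact.
- by exists g; split => // Q x clx _; exact: gE.
Qed.

End OnMesh.

(** * Counting the degrees of freedom *)

Section Dimension.
Variables (R : realType) (p : nat).
Hypothesis hp : p \in [:: 3; 4; 5]%N.
Variables (Omega : set (plane R)) (M : quad_mesh Omega).
Local Notation qc Q := (corner M (val Q)).
Implicit Types (Q : elements M) (phi psi : elements M -> plane R -> R^o).

Let n1 Q i := let: And3 H _ _ := side_frame (M := M) Q i in H.
Let n2 Q i := let: And3 _ H _ := side_frame (M := M) Q i in H.

Lemma eta_uniq : uniq (eta_points R p).
Proof.
have neq (x y : R) : x < y -> (x == y) = false by move=> xy; rewrite lt_eqF.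
by move: hp; rewrite !inE => /or3P[] /eqP -> /=; rewrite !inE !neq //; lra.
Qed.

Lemma eta_index : exists ix : R -> 'I_(7 - p), forall a : 'I_(7 - p), ix (nth 0 (eta_points R p) a) = a.
Proof.
have p0 : (0 < 7 - p)%N by move: hp; rewrite !inE => /or3P[] /eqP ->.
exists (fun x => odflt (Ordinal p0) (insub (index x (eta_points R p)))) => a.
rewrite index_uniq ?eta_uniq ?(size_eta R hp) //.
by rewrite insubT //= => la; apply: val_inj.
Qed.

Lemma eta_nth x : x \in eta_points R p -> exists a : 'I_(7 - p), x = nth 0 (eta_points R p) a.
Proof.
move=> xe; have := xe; rewrite -index_mem (size_eta R hp) => la.
by exists (Ordinal la); rewrite /= nth_index.
Qed.

Lemma global_space_lin a phi psi : global_space M p phi -> global_space M p psi ->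
  global_space M p (a *: phi + psi).
Proof.
move=> G G'; have [L V E] := G; have [L' V' E'] := G'.
have D Q := global_dof_lin hp a Q G G'.
split=> [Q|Q Q' v i i' vi vi' k|Q Q' e i i' ei ei'].
- apply/(local_spaceE hp Q); apply: (loc_space_lin hp (element_convex Q) a).
    exact/(local_spaceE hp Q)/L.
  exact/(local_spaceE hp Q)/L'.
- have H Q0 i0 : v = qc Q0 i0 -> vertex_dof (val Q0) v k ((a *: phi + psi) Q0) =
      a * vertex_dof (val Q0) v k (phi Q0) + vertex_dof (val Q0) v k (psi Q0).
    by move=> ->; exact: (D Q0).1.
  by rewrite (H Q i vi) (H Q' i' vi') (V Q Q' v i i' vi vi') (V' Q Q' v i i' vi vi').
- have H Q0 i0 : e = side M (val Q0) i0 -> edge_dof M (val Q0) e ((a *: phi + psi) Q0) =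
      a * edge_dof M (val Q0) e (phi Q0) + edge_dof M (val Q0) e (psi Q0).
    by move=> ->; exact: (D Q0).2.
  by rewrite (H Q i ei) (H Q' i' ei') (E Q Q' e i i' ei ei') (E' Q Q' e i i' ei ei').
Qed.

Definition dof_index : finType :=
  ((vertices M * 'I_6) + edges M + (elements M * ('I_(7 - p) * 'I_(7 - p))))%type.

Lemma dof_index_card : #|dof_index| =
  ((7 - p) ^ 2 * #|` elements M| + 1 * #|` edges M| + 6 * #|` vertices M|)%N.
Proof.
rewrite /dof_index !card_sum !card_prod !card_ord !cardfE mulnn.
rewrite mul1n addnC addnA (mulnC _ 6%N).
by rewrite addnAC (mulnC _ ((7 - p) ^ 2)%N).
Qed.

Lemma vertex_place : exists vr : vertices M -> elements M * 'I_4, forall v, val v = qc (vr v).1 (vr v).2.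
Proof.
have /choice[vr vrP] : forall v : vertices M, exists Qi : elements M * 'I_4, val v = qc Qi.1 Qi.2.
  by move=> v; have [Q [i [QM vE]]] := vertex_incident (fsvalP v); exists ([` QM]%fset, i).
by exists vr.
Qed.

Lemma edge_place : exists er : edges M -> elements M * 'I_4,
  forall e, val e = side M (val (er e).1) (er e).2.
Proof.
have /choice[er erP] : forall e : edges M, exists Qi : elements M * 'I_4, val e = side M (val Qi.1) Qi.2.
  by move=> e; have [Q [i [QM eE]]] := edge_incident (fsvalP e); exists ([` QM]%fset, i).
by exists er.
Qed.

Lemma dual_functionals : exists l : dof_index -> (elements M -> plane R -> R^o) -> R,
  [/\ forall i a phi psi, global_space M p phi -> global_space M p psi ->
        l i (a *: phi + psi) = a * l i phi + l i psi,
      forall phi, global_space M p phi -> (forall i, l i phi = 0) -> phi = 0,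
      forall d : dof_index -> R, exists2 phi, global_space M p phi & forall i, l i phi = d i &
      global_dofs M p = range (fun i => (fun phi : {phi | global_space M p phi} => l i (sval phi)))].
Proof.
have [vr vrP] := vertex_place; have [er erP] := edge_place; have [ix ixP] := eta_index.
pose eta (a : 'I_(7 - p)) : R := nth 0 (eta_points R p) a.
have etaP a : eta a \in eta_points R p by rewrite mem_nth // (size_eta R hp).
(* Vertex and edge functionals are evaluated on one chosen incident element; [lv] and [le] show that
   on the global space every incident element gives the same value. *)
pose l (i : dof_index) phi : R := match i with
  | inl (inl (v, k)) => vertex_dof (val (vr v).1) (val v) k (phi (vr v).1)
  | inl (inr e) => edge_dof M (val (er e).1) (val e) (phi (er e).1)
  | inr (Q, (a, b)) => phi Q (param M (val Q) (eta a, eta b))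
  end.
pose vof Q i : vertices M := [` element_corner i (fsvalP Q)]%fset.
pose eof Q i : edges M := [` element_side i (fsvalP Q)]%fset.
have lv phi Q i k : global_space M p phi -> l (inl (inl (vof Q i, k))) phi = vertex_dof (val Q) (qc Q i) k (phi Q).
  by move=> [_ V _]; exact: (V _ Q (qc Q i) (vr (vof Q i)).2 i (vrP (vof Q i)) erefl k).
have le phi Q i : global_space M p phi -> l (inl (inr (eof Q i))) phi = edge_dof M (val Q) (side M (val Q) i) (phi Q).
  by move=> [_ _ E]; exact: (E _ Q (side M (val Q) i) (er (eof Q i)).2 i (erP (eof Q i)) erefl).
exists l; split.
- move=> [[[v k]|e]|[Q [a b]]] k0 phi psi G G'.
  + by rewrite /l vrP; exact: (global_dof_lin hp k0 _ G G').1.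
  + by rewrite /l erP; exact: (global_dof_lin hp k0 _ G G').2.
  + by [].
- move=> phi G l0; have [L _ _] := G.
  apply/funext => Q; apply/funext => x; have LQ := (local_spaceE hp Q _).1 (L Q).
  apply: (local_injective hp (element_convex Q) (n1 Q) (n2 Q) LQ).
  + by move=> i k; have := l0 (inl (inl (vof Q i, k))); rewrite lv // {1}elementE.
  + by move=> i; have := l0 (inl (inr (eof Q i))); rewrite le // edge_dofE.
  + move=> y z /eta_nth[a ->] /eta_nth[b ->]; exact: l0 (inr (Q, (a, b))).
- move=> d.
  have /choice[phi phiP] : forall Q, exists f : plane R -> R^o,
    [/\ loc_space p (qc Q) (side_normal M (val Q)) f,
      forall i k, vertex_dof (open_quad (qc Q)) (qc Q i) k f = d (inl (inl (vof Q i, k))),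
      forall i, cl_ext (open_quad (qc Q)) ('D_(side_normal M (val Q) i) f) (edge_pt (qc Q) i (1 / 2)) = d (inl (inr (eof Q i))) &
      forall x y, x \in eta_points R p -> y \in eta_points R p -> f (bilin (qc Q) (x, y)) = d (inr (Q, (ix x, ix y)))].
    move=> Q; exact: (local_existence hp (element_convex Q) (n1 Q) (n2 Q) (fun i k => d (inl (inl (vof Q i, k))))
      (fun i => d (inl (inr (eof Q i)))) (fun x y => d (inr (Q, (ix x, ix y))))).
  have G : global_space M p phi.
    split=> [Q|Q Q' v i i' vi vi' k|Q Q' e i i' ei ei'].
    + by apply/(local_spaceE hp Q); case: (phiP Q).
    + have H Q0 i0 : v = qc Q0 i0 -> vertex_dof (val Q0) v k (phi Q0) = d (inl (inl (vof Q0 i0, k))).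
        by move=> ->; have [_ + _ _] := phiP Q0 => /(_ i0 k); rewrite -elementE.
      rewrite (H Q i vi) (H Q' i' vi'); congr (d (inl (inl (_, k)))).
      by apply: val_inj; rewrite /= -vi -vi'.
    + have H Q0 i0 : e = side M (val Q0) i0 -> edge_dof M (val Q0) e (phi Q0) = d (inl (inr (eof Q0 i0))).
        by move=> ->; rewrite edge_dofE; have [_ _ + _] := phiP Q0; exact.
      rewrite (H Q i ei) (H Q' i' ei'); congr (d (inl (inr _))).
      by apply: val_inj; rewrite /= -[quad_side _ i]ei -[quad_side _ i']ei'.
  exists phi => // -[[[v k]|e]|[Q [a b]]].
  + have -> : v = vof (vr v).1 (vr v).2 by apply: val_inj; exact: vrP.
    rewrite lv //; have [_ + _ _] := phiP (vr v).1 => /(_ (vr v).2 k); rewrite -elementE; exact.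
  + have -> : e = eof (er e).1 (er e).2 by apply: val_inj; exact: erP.
    by rewrite le // edge_dofE; have [_ _ + _] := phiP (er e).1; exact.
  + by have [_ _ _ H] := phiP Q; rewrite /l H // !ixP.
- apply/seteqP; split=> [f [[[Q [v [i [k [vE ->]]]]]|[Q [e [i [eE ->]]]]]|[Q [x [y [xe ye ->]]]]]|_ [[[[v k]|e]|[Q [a b]]] _ <-]].
  + exists (inl (inl (vof Q i, k))); first exact: I.
    by rewrite vE; apply/funext => phi; exact: lv (svalP phi).
  + exists (inl (inr (eof Q i))); first exact: I.
    by rewrite eE; apply/funext => phi; exact: le (svalP phi).
  + have [a aE] := eta_nth xe; have [b bE] := eta_nth ye.
    by exists (inr (Q, (a, b))) => //; rewrite /l /eta -aE -bE.
  + by left; left; exists (vr v).1, (val v), (vr v).2, k.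
  + by left; right; exists (er e).1, (val e), (er e).2.
  + by right; exists Q, (eta a), (eta b).
Qed.

Lemma card_setT_finType (I : finType) : ([set: I] #= `I_#|I|)%card.
Proof.
apply: (@card_eq_trans _ _ _ _ [set: 'I_#|I|]); last by rewrite card_eq_sym; exact: card_II.
have -> : [set: 'I_#|I|] = enum_rank @` [set: I].
  by apply/seteqP; split=> // i _; exists (enum_val i) => //; exact: enum_valK.
by rewrite card_eq_sym; apply: inj_card_eq => x y _ _; exact: enum_rank_inj.
Qed.

Lemma global_space_dim : has_dim (global_space M p) #|dof_index| /\
  (global_dofs M p #= `I_#|dof_index|)%card.
Proof.
have [l [llin linj lsurj lE]] := dual_functionals; split.
  apply: (@has_dim_dual R _ dof_index (global_space M p) l _ _ llin linj lsurj).
    have [phi G _] := lsurj (fun=> 0).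
    have := global_space_lin (-1) G G; rewrite scaleN1r addNr; exact.
  exact: global_space_lin.
rewrite lE; apply: (card_eq_trans _ (card_setT_finType dof_index)).
apply: inj_card_eq => i j _ _ E.
(* The function dual to [i] separates the functional [i] from all others, so distinct indices give
   distinct functionals. *)
have [phi G lphi] := lsurj (fun k => (k == i)%:R).
have := congr1 (fun f => f (exist _ phi G)) E; rewrite /= !lphi eqxx.
by case: eqVneq => // _ /eqP; rewrite oner_eq0.
Qed.

End Dimension.

Theorem lemma3p8 (R : realType) (p : nat) (hp : p \in [:: 3; 4; 5]%N)
    (Omega : set 'rV[R]_2) (Oopen : open Omega) (Oconn : connected Omega)
    (M : quad_mesh Omega) :
  let N := ((7 - p) ^ 2 * #|` elements M| + 1 * #|` edges M|
            + 6 * #|` vertices M|)%N in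
  [/\ forall phi, global_space M p phi -> piecewise_C1 phi,
      has_dim (global_space M p) N &
      (global_dofs M p #= `I_N)%card].
Proof.
have [dim card] := global_space_dim hp M; rewrite dof_index_card // in dim card.
by split=> // phi; exact: (global_space_C1 hp).
Qed.
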